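(* Fix $d\in\mathbb{N}=\{1,2,\dots\}$. For each $n$, let $\{w_{n,\tau}\}$, indexed by the $(d+1)$-element subsets $\tau$ of $[n]=\{1,\dots,n\}$, be i.i.d. exponential random variables with mean $n$. For a $d$-element subset $\sigma\subset[n]$ put $\mathrm{NN}_n(\sigma)=\min_{\tau\supset\sigma,\ |\tau|=d+1}w_{n,\tau}$, and let $\mathrm{NN}_n(\mathbb{K}_n)=\sum_{\sigma\subset[n],\,|\sigma|=d}\mathrm{NN}_n(\sigma)$. Then, as $n\to\infty$, \[ \operatorname{Var}(\mathrm{NN}_n(\mathbb{K}_n))\sim\Bigl(1+\frac d2\Bigr)\binom nd \qquad\text{and}\qquad \frac{\mathrm{NN}_n(\mathbb{K}_n)-\mathbb{E}[\mathrm{NN}_n(\mathbb{K}_n)]}{\sqrt{\operatorname{Var}(\mathrm{NN}_n(\mathbb{K}_n))}}\xrightarrow{\ d\ }\mathcal{N}(0,1). \]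
   Context: $a_n\sim b_n$ means $a_n/b_n\to1$ as $n\to\infty$. $\xrightarrow{d}$ denotes convergence in distribution and $\mathcal N(0,1)$ is the standard normal law. $\mathbb{K}_n$ denotes the complete $d$-dimensional simplicial complex on $[n]$ (all subsets of size at most $d+1$) with the weight $w_{n,\tau}$ attached to each $d$-simplex $\tau$ (a $(d+1)$-element subset); $\mathrm{NN}_n(\sigma)$ is the nearest face-weight of the $(d-1)$-simplex $\sigma$ and $\mathrm{NN}_n(\mathbb{K}_n)$ is the total nearest face-weight. *)

(* Defs.v *)
From HB Require Import structures.
From mathcomp Require Import all_boot all_order all_algebra.
From mathcomp Require Import all_classical all_reals all_analysis.
From mathcomp Require Import measurable_realfun.
Import Order.TTheory GRing.Theory Num.Theory.
Import numFieldNormedType.Exports.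

Set Implicit Arguments.
Unset Strict Implicit.
Unset Printing Implicit Defensive.

Local Open Scope classical_set_scope.
Local Open Scope ring_scope.

Section probability_notions.

Definition mutually_independent (R : realType) (d d' : measure_display)
    (T : measurableType d) (P : probability T R) (T' : measurableType d')
    (I : finType) (X : I -> {RV P >-> T'}) : Prop :=
  forall (J : {set I}) (A : I -> set T'),
    (forall i, i \in J -> measurable (A i)) ->
    (P (\bigcap_(i in [set` J]) (X i @^-1` A i)) =
     \prod_(i in J) P (X i @^-1` A i))%E.

(* [exponential_prob] takes the rate, i.e. the inverse of the mean. Only
   measurable sets are tested: on other sets the values of the set functions
   [distribution P X] and [exponential_prob m^-1] are not meaningful. *)
Definition exponential_with_mean (R : realType) (d : measure_display)
    (T : measurableType d) (P : probability T R) (m : R)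
    (X : {RV P >-> R}) : Prop :=
  forall A : set R, measurable A -> distribution P X A = exponential_prob m^-1 A.

(* Each variable may live on its own probability space. *)
Definition cvg_in_distribution (R : realType) (d : nat -> measure_display)
    (T : forall n, measurableType (d n)) (P : forall n, probability (T n) R)
    (X : forall n, {RV P n >-> R}) (mu : probability (measurableTypeR R) R) : Prop :=
  forall x : R, {for x, continuous (fun y : R => mu `]-oo, y]%classic)} ->
    cdf (X n) x @[n --> \oo] --> mu `]-oo, x]%classic.

Definition asymptotically_equivalent (R : realType) (a b : R^nat) : Prop :=
  a n / b n @[n --> \oo] --> (1 : R).

End probability_notions.

Section standardization.
Context (R : realType) (d : measure_display) (T : measurableType d).
Context (P : probability T R) (X : {RV P >-> R}).

Definition standardize (t : T) : R :=
  (X t - fine 'E_P[X]) / Num.sqrt (fine 'V_P[X]).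

Lemma measurable_standardize : measurable_fun setT standardize.
Proof. by apply: measurable_funM => //; apply: measurable_funB. Qed.

HB.instance Definition _ :=
  isMeasurableFun.Build _ _ _ _ standardize measurable_standardize.

End standardization.

Definition ksubset (n k : nat) : finType := {A : {set 'I_n} | #|A| == k}.

Section nearest_face_weight.
Context (R : realType) (d : measure_display) (T : measurableType d).
Context (P : probability T R) (n k : nat) (w : ksubset n k.+1 -> {RV P >-> R}).

(* The minimum is taken in \bar R, where +oo is neutral; it is finite as soon
   as some (k+1)-subset contains sigma, that is, when k < n. *)
Definition nearest_face_weight (sigma : ksubset n k) (t : T) : R :=
  fine (\big[Order.min/+oo%E]_(tau : ksubset n k.+1 |
          val sigma \subset val tau) (w tau t)%:E).

Definition total_nearest_face_weight (t : T) : R :=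
  \sum_(sigma : ksubset n k) nearest_face_weight sigma t.

Lemma measurable_nearest_face_weight (sigma : ksubset n k) :
  measurable_fun setT (nearest_face_weight sigma).
Proof.
apply: measurableT_comp => //=.
rewrite unlock /reducebig; elim: (index_enum _) => [|tau s IHs] /=.
  exact: measurable_cst.
case: (val sigma \subset val tau) => //.
by apply: measurable_mine => //; exact/measurable_EFinP.
Qed.

Lemma measurable_total_nearest_face_weight :
  measurable_fun setT total_nearest_face_weight.
Proof.
by apply: measurable_sum => sigma; exact: measurable_nearest_face_weight.
Qed.

HB.instance Definition _ :=
  isMeasurableFun.Build _ _ _ _ total_nearest_face_weight
    measurable_total_nearest_face_weight.

End nearest_face_weight.

(* Main.v *)
(* The weights are truncated at a level K of order ln n and rounded down to a
   mesh so fine that the total nearest face-weight is within o(1) in L^2 of the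
   corresponding function of a finite product of truncated geometric laws.
   There the covariance of two minima is an explicit geometric sum: it tends
   to 1 for a minimum with itself, is about 1/(2n) for two d-sets with a common
   coface, and vanishes otherwise. As each d-set has d(n - d) such neighbours,
   the variance is about (1 + d/2) 'C(n, d).
   For normality, deleting all cofaces of s turns the total W into a W_s that
   is independent of the minimum X_s, so that T = \sum_s (X_s - E X_s)(W - W_s)
   serves as a Stein coefficient. Redrawing one weight affects T only if the
   weight is below K, an event of probability O(K / n), and the Efron-Stein
   inequality then gives Var T = o((Var W)^2). The Stein equation is solved for
   logistic test functions, which are smooth and approximate indicators. *)
Require Import Defs.
From HB Require Import structures.
From mathcomp Require Import all_boot all_order all_algebra.
From mathcomp Require Import all_classical all_reals all_analysis.
From mathcomp Require Import measurable_realfun.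
From mathcomp Require Import ring lra zify.
Import Order.TTheory GRing.Theory Num.Theory.
Import numFieldNormedType.Exports.
Set Implicit Arguments.
Unset Strict Implicit.
Unset Printing Implicit Defensive.
Local Open Scope classical_set_scope.
Local Open Scope ring_scope.

(** * Finite product spaces and the Efron-Stein inequality *)

(** The minima are only locally dependent, but each shares faces with d(n - d) others, and for small
    d the usual normal approximation under local dependence is too weak for neighbourhoods of that
    size. What helps is sparsity: a minimum has order 1 while a weight has order n, so only about K
    of the n - d cofaces of a d-set have a weight below K, and no other face can influence a
    truncated minimum. Counting these faces ([nsmall], [nlink]) in place of neighbours makes the
    bounds lose powers of ln n in place of powers of n. Rounding to a mesh has two purposes.
    Expectations become finite sums, so that conditional expectations, independence and the
    Efron-Stein inequality are plain algebra; and the exponential tails become powers of one number,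
    so that covariances can be computed exactly. The price is the transfer to the true total: the at
    most n^d errors are summed by Cauchy-Schwarz, which asks for a mesh well below n^-d and for a
    large constant in K. In return, an error o(1) in mean square is harmless next to a variance of
    order n^d. *)

Section finite_product_space.
Context (R : realFieldType) (I V : finType) (p : V -> R).
Hypotheses (p_ge0 : forall v, 0 <= p v) (p_sum1 : \sum_v p v = 1).
Local Notation config := {ffun I -> V}.
Implicit Types (F G H : config -> R) (x y : config).

Definition upd x (i : I) (v : V) : config :=
  [ffun j => if j == i then v else x j].

Definition invariant_at (i : I) F := forall x v, F (upd x i v) = F x.

Definition Ex F : R := \sum_(x : config) (\prod_i p (x i)) * F x.

(** This is the conditional expectation given all coordinates other than [i], kept as a function on
    the whole space so that such projections can be composed. *)
Definition Ei i F : config -> R := fun x => \sum_v p v * F (upd x i v).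

Definition Es (s : seq I) F : config -> R := foldr Ei F s.

Lemma upd_id x i : upd x i (x i) = x.
Proof. by apply/ffunP => j; rewrite ffunE; case: eqP => // ->. Qed.

Lemma upd_upd x i v w : upd (upd x i v) i w = upd x i w.
Proof. by apply/ffunP => j; rewrite !ffunE; case: eqP. Qed.

Lemma upd_comm x i j v w : i != j ->
  upd (upd x i v) j w = upd (upd x j w) i v.
Proof.
move=> ij; apply/ffunP => k; rewrite !ffunE.
by case: (k =P j) => // ->; rewrite eq_sym (negPf ij).
Qed.

(** Both sides are the joint weight of [x] and an independent copy [v] of its coordinate [i], before
    and after exchanging the two. *)
Lemma weight_upd x i v :
  (\prod_j p (x j)) * p v = (\prod_j p (upd x i v j)) * p (x i).
Proof.
rewrite (bigD1 i)//= [in RHS](bigD1 i)//= ffunE eqxx.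
rewrite [X in _ = _ * X * _](eq_bigr (fun j => p (x j))); first by ring.
by move=> j ji; rewrite ffunE (negPf ji).
Qed.

Lemma Ex_Ei i F : Ex (Ei i F) = Ex F.
Proof.
rewrite /Ex /Ei; under eq_bigr do rewrite big_distrr/=.
rewrite pair_big/=.
(* The exchange of coordinate [i] with its fresh copy is an involution, so it reindexes the double
   sum; by [weight_upd] it preserves the weight. *)
pose h (a : config * V) := (upd a.1 i a.2, a.1 i).
have hK : involutive h.
  by move=> [x v]; rewrite /h/= upd_upd upd_id ffunE eqxx.
rewrite (reindex_inj (inv_inj hK))/=.
transitivity (\sum_(a : config * V) (\prod_j p (a.1 j)) * F a.1 * p a.2).
  apply: eq_bigr => -[x v] _ /=.
  by rewrite upd_upd upd_id !mulrA -weight_upd; ring.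
rewrite -(pair_big xpredT xpredT
  (fun x v => (\prod_j p (x j)) * F x * p v))/=.
by apply: eq_bigr => x _; rewrite -big_distrr/= p_sum1 mulr1.
Qed.

Lemma Ex_prod (g : I -> V -> R) :
  Ex (fun x => \prod_i g i (x i)) = \prod_i \sum_v p v * g i v.
Proof.
by rewrite /Ex bigA_distr_bigA/=; apply: eq_bigr => x _; rewrite big_split.
Qed.

Lemma weight_sum1 : \sum_(x : config) \prod_i p (x i) = 1.
Proof. by rewrite -(bigA_distr_bigA (fun (_ : I) v => p v))/=; apply: big1. Qed.

Lemma Ex_cst c : Ex (fun=> c) = c.
Proof. by rewrite /Ex -big_distrl/= weight_sum1 mul1r. Qed.

Lemma ExD F G : Ex (fun x => F x + G x) = Ex F + Ex G.
Proof. by rewrite /Ex -big_split; apply: eq_bigr => x _; rewrite mulrDr. Qed.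

Lemma ExZ c F : Ex (fun x => c * F x) = c * Ex F.
Proof. by rewrite /Ex big_distrr; apply: eq_bigr => x _ /=; ring. Qed.

Lemma ExB F G : Ex (fun x => F x - G x) = Ex F - Ex G.
Proof.
rewrite -[in RHS]mulN1r -ExZ -ExD; congr Ex; apply/funext => x; ring.
Qed.

Lemma Ex_sum (J : Type) (r : seq J) (Q : pred J) (F : J -> config -> R) :
  Ex (fun x => \sum_(j <- r | Q j) F j x) = \sum_(j <- r | Q j) Ex (F j).
Proof.
rewrite /Ex exchange_big/=; apply: eq_bigr => x _.
by rewrite big_distrr.
Qed.

Lemma weight_ge0 x : 0 <= \prod_i p (x i).
Proof. exact: prodr_ge0. Qed.

Lemma Ex_ge0 F : (forall x, 0 <= F x) -> 0 <= Ex F.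
Proof. by move=> F0; apply: sumr_ge0 => x _; rewrite mulr_ge0 ?weight_ge0. Qed.

Lemma Ex_le F G : (forall x, F x <= G x) -> Ex F <= Ex G.
Proof.
by move=> FG; apply: ler_sum => x _; rewrite ler_wpM2l ?weight_ge0.
Qed.

Lemma Ex_norm F : `|Ex F| <= Ex (fun x => `|F x|).
Proof.
rewrite (le_trans (ler_norm_sum _ _ _))//; apply: ler_sum => x _.
by rewrite normrM ger0_norm ?weight_ge0.
Qed.

Lemma Ei_inv i F : invariant_at i (Ei i F).
Proof. by move=> x v; apply: eq_bigr => w _; rewrite upd_upd. Qed.

Lemma Ei_comm i j F : Ei i (Ei j F) = Ei j (Ei i F).
Proof.
case: (eqVneq i j) => [->//|ij]; apply/funext => x; rewrite /Ei.
under eq_bigr do rewrite big_distrr/=.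
under [RHS]eq_bigr do rewrite big_distrr/=.
rewrite exchange_big/=; apply: eq_bigr => v _; apply: eq_bigr => w _.
by rewrite upd_comm// mulrCA.
Qed.

Lemma Ei_keep_inv i j F : invariant_at j F -> invariant_at j (Ei i F).
Proof.
case: (eqVneq i j) => [->_|ij Fj x v]; first exact: Ei_inv.
by apply: eq_bigr => w _; rewrite upd_comm ?Fj// eq_sym.
Qed.

Lemma Ei_id i F : invariant_at i F -> Ei i F = F.
Proof.
move=> Fi; apply/funext => x; rewrite /Ei.
by under eq_bigr do rewrite Fi; rewrite -big_distrl/= p_sum1 mul1r.
Qed.

Lemma Ei_mulr i F G : invariant_at i G ->
  Ei i (fun x => F x * G x) = (fun x => Ei i F x * G x).
Proof.
move=> Gi; apply/funext => x; rewrite /Ei big_distrl/=.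
by apply: eq_bigr => v _; rewrite Gi mulrA.
Qed.

Lemma EiB i F G : Ei i (fun x => F x - G x) = (fun x => Ei i F x - Ei i G x).
Proof.
apply/funext => x; rewrite /Ei -sumrB; apply: eq_bigr => v _; ring.
Qed.

Lemma Es_keep_inv s j F : invariant_at j F -> invariant_at j (Es s F).
Proof. by move=> Fj; elim: s => //= i s; exact: Ei_keep_inv. Qed.

Lemma Es_inv s j F : j \in s -> invariant_at j (Es s F).
Proof.
elim: s => //= i s IH; rewrite inE => /orP[/eqP ->|js]; first exact: Ei_inv.
by apply: Ei_keep_inv; exact: IH.
Qed.

Lemma Ei_Es_comm i s F : Ei i (Es s F) = Es s (Ei i F).
Proof. by elim: s => //= j s IH; rewrite Ei_comm IH. Qed.

Lemma EsB s F G : Es s (fun x => F x - G x) = (fun x => Es s F x - Es s G x).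
Proof. by elim: s => //= j s ->; rewrite EiB. Qed.

Lemma Ex_Es s F : Ex (Es s F) = Ex F.
Proof. by elim: s => //= i s IH; rewrite Ex_Ei. Qed.

Lemma Ex_Es_mulr s F G : (forall i, i \in s -> invariant_at i G) ->
  Ex (fun x => F x * G x) = Ex (fun x => Es s F x * G x).
Proof.
elim: s => //= i s IH sG; rewrite IH; last first.
  by move=> j js; apply: sG; rewrite inE js orbT.
by rewrite -(Ex_Ei i) Ei_mulr//; apply: sG; rewrite mem_head.
Qed.

(** Overwriting the coordinates of [x] by those of [y] one at a time never changes the value, so
    [F x = F y] for all [y]; averaging over [y] gives the claim. *)
Lemma invariant_cst F : (forall i, invariant_at i F) -> forall x, F x = Ex F.
Proof.
move=> Finv x; rewrite -[LHS]Ex_cst; congr Ex; apply/funext => y.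
have H (s : seq I) : F [ffun i => if i \in s then y i else x i] = F x.
  elim: s => [|i s <-]; first by congr F; apply/ffunP => i; rewrite ffunE.
  rewrite -[RHS](Finv i _ (y i)); congr F; apply/ffunP => j.
  by rewrite !ffunE in_cons; case: eqP => //= ->.
rewrite -(H (enum I)); congr F; apply/ffunP => j.
by rewrite ffunE mem_enum.
Qed.

(** [G] ignores the coordinates in [B], so they can be integrated out of [F] alone; what is left of
    [F] depends on no coordinate and is its mean. *)
Lemma Ex_indep (B : {set I}) F G :
    (forall i, i \notin B -> invariant_at i F) ->
    (forall i, i \in B -> invariant_at i G) ->
  Ex (fun x => F x * G x) = Ex F * Ex G.
Proof.
move=> FB GB; rewrite (@Ex_Es_mulr (enum B)); last first.
  by move=> i; rewrite mem_enum; exact: GB.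
rewrite -ExZ; congr Ex; apply/funext => x; congr (_ * _).
rewrite -(Ex_Es (enum B)); apply: invariant_cst => i.
case: (boolP (i \in B)) => iB; first by apply: Es_inv; rewrite mem_enum.
by apply: Es_keep_inv; exact: FB.
Qed.

Lemma Ex_orth i F G : invariant_at i G -> Ex (fun x => (F x - Ei i F x) * G x) = 0.
Proof.
move=> Gi; rewrite -(Ex_Ei i) Ei_mulr// EiB (Ei_id (@Ei_inv i F)).
by under [X in Ex X]eq_fun do rewrite subrr mul0r; rewrite Ex_cst.
Qed.

(** Pythagoras: [Ei i] is the orthogonal projection onto the functions that ignore coordinate
    [i]. *)
Lemma Ex_sqr_Ei i F : Ex (fun x => F x ^+ 2) =
  Ex (fun x => (F x - Ei i F x) ^+ 2) + Ex (fun x => Ei i F x ^+ 2).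
Proof.
rewrite -ExD -[RHS]addr0 -[X in _ + X](mulr0 2) -(Ex_orth F (@Ei_inv i F)).
by rewrite -ExZ -ExD; congr Ex; apply/funext => x; ring.
Qed.

Lemma Ex_sqr_Es_le s F : Ex (fun x => Es s F x ^+ 2) <= Ex (fun x => F x ^+ 2).
Proof.
elim: s => //= i s; apply: le_trans; rewrite (Ex_sqr_Ei i (Es s F)) lerDr.
by apply: Ex_ge0 => x; exact: sqr_ge0.
Qed.

Lemma Ex_Ei_best i F H : invariant_at i H ->
  Ex (fun x => (F x - Ei i F x) ^+ 2) <= Ex (fun x => (F x - H x) ^+ 2).
Proof.
move=> Hi; rewrite -subr_ge0 -ExB.
have -> : Ex (fun x => (F x - H x) ^+ 2 - (F x - Ei i F x) ^+ 2) =
    Ex (fun x => (Ei i F x - H x) ^+ 2).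
  rewrite -[RHS]addr0 -[X in _ + X](mulr0 2).
  have iH : invariant_at i (fun x => Ei i F x - H x).
    by move=> x v; rewrite Ei_inv Hi.
  rewrite -(Ex_orth F iH) -ExZ -ExD; congr Ex; apply/funext => x; ring.
by apply: Ex_ge0 => x; exact: sqr_ge0.
Qed.

Definition Var F := Ex (fun x => (F x - Ex F) ^+ 2).

Lemma VarE F : Var F = Ex (fun x => F x ^+ 2) - Ex F ^+ 2.
Proof.
rewrite /Var; set c := Ex F.
under [X in Ex X]eq_fun do rewrite sqrrB.
rewrite ExD ExB Ex_cst.
have -> : Ex (fun x => F x * c *+ 2) = 2 * c ^+ 2.
  rewrite (_ : (fun x => _) = (fun x => (2 * c) * F x)); first by rewrite ExZ -/c; ring.
  by apply/funext => x; ring.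
ring.
Qed.

Lemma Var_ge0 F : 0 <= Var F.
Proof. by apply: Ex_ge0 => x; exact: sqr_ge0. Qed.

Lemma Ex_sqr_le F : Ex F ^+ 2 <= Ex (fun x => F x ^+ 2).
Proof. by have := Var_ge0 F; rewrite VarE subr_ge0. Qed.

(* The Efron-Stein inequality; the comparison function [H i] need only ignore
   the coordinate [i], since the conditional mean is the best such one. *)
Lemma Efron_Stein F (H : I -> config -> R) :
    (forall i, invariant_at i (H i)) ->
  Var F <= \sum_i Ex (fun x => (F x - H i x) ^+ 2).
Proof.
move=> Hinv.
(* Integrating out one more coordinate [i] lowers the second moment by that of [Es s] applied to
   [F - Ei i F]. The projections in [Es s] contract, and [Ei i F] is the best approximation of [F]
   that ignores [i]. *)
have main s : Ex (fun x => F x ^+ 2) - Ex (fun x => Es s F x ^+ 2) <=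
    \sum_(i <- s) Ex (fun x => (F x - H i x) ^+ 2).
  elim: s => [|i s IH]; first by rewrite subrr big_nil.
  rewrite big_cons /= (le_trans _ (lerD (le_refl _) IH))//.
  rewrite -lerBlDr opprB addrCA addrAC subrr add0r.
  rewrite (Ex_sqr_Ei i (Es s F)) addrK.
  apply: le_trans (Ex_Ei_best F (Hinv i)).
  rewrite Ei_Es_comm.
  have -> : (fun x => (Es s F x - Es s (Ei i F) x) ^+ 2) =
            (fun x => Es s (fun x => F x - Ei i F x) x ^+ 2).
    by rewrite EsB.
  exact: Ex_sqr_Es_le.
rewrite VarE (le_trans _ (le_trans (main (enum I)) _))//; last first.
  by rewrite big_enum.
rewrite lerB// -[leRHS]Ex_cst; apply: Ex_le => x.
suff -> : Es (enum I) F x = Ex F by [].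
rewrite -(Ex_Es (enum I) F); apply: invariant_cst => i.
by apply: Es_inv; rewrite mem_enum.
Qed.

End finite_product_space.

(** * Stein's method for sums of truncated minima *)

(** Cauchy-Schwarz against the constant 1, from [2 * a * b <= a ^+ 2 + b ^+ 2]. *)
Lemma sqr_sum_le (R : realFieldType) (J : finType) (Q : pred J) (g : J -> R) :
  (\sum_(j | Q j) g j) ^+ 2 <= #|Q|%:R * \sum_(j | Q j) g j ^+ 2.
Proof.
rewrite expr2 big_distrlr/=.
have -> : #|Q|%:R * \sum_(j | Q j) g j ^+ 2 =
    \sum_(i | Q i) \sum_(j | Q j) (g i ^+ 2 + g j ^+ 2) / 2.
  rewrite [RHS](eq_bigr (fun i => (g i ^+ 2 *+ #|Q| + \sum_(j | Q j) g j ^+ 2) / 2)).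
    rewrite -mulr_suml big_split/= sumr_const sumrMnl mulr_natl.
    set A := _ *+ _; lra.
  by move=> i _; rewrite -mulr_suml big_split/= sumr_const.
apply: ler_sum => i _; apply: ler_sum => j _.
have := sqr_ge0 (g i - g j); rewrite sqrrB; lra.
Qed.

Section truncated_minima.
Context (R : realFieldType) (I J V : finType) (p : V -> R) (top : V).
Context (inc : J -> I -> bool) (vl : V -> R) (K : R).
Hypotheses (p_ge0 : forall v, 0 <= p v) (p_sum1 : \sum_v p v = 1).
Hypotheses (vl_ge0 : forall v, 0 <= vl v).
Hypothesis (vl_top : vl top = K).
Context (D m : nat).
Hypothesis inc_D : forall i, (#|[pred s | inc s i]| <= D)%N.
Hypothesis inc_m : forall s, (#|[pred i | inc s i]| <= m)%N.
Local Notation config := {ffun I -> V}.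
Local Notation E := (Ex p).
Implicit Types (x : config) (s t : J) (i : I).

(** Taking [K] as the neutral element truncates the minimum, and since [vl top = K], a face in state
    [top] is as good as absent. *)
Definition rmin s x : R := \big[Num.min/K]_(i | inc s i) vl (x i).

Definition rtotal x : R := \sum_s rmin s x.

(* Raising a coordinate to [top] amounts to deleting the corresponding face. *)
Definition clear s x : config := [ffun i => if inc s i then top else x i].

Definition drop_ i x : config := upd x i top.

(** Only faces in a state other than [top] can lower a minimum; each is in such a state with
    probability [rho], which is O(K / n) in the application. *)
Definition small i x : R := (x i != top)%:R.

Definition nsmall s x : R := \sum_(i | inc s i) small i x.

Definition rho : R := \sum_(v | v != top) p v.

Definition cmin s x : R := rmin s x - E (rmin s).

Definition gap s t x : R := rmin t x - rmin t (clear s x).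

Definition jump s x : R := \sum_t gap s t x.

(* The random variable of Stein's method: [E stein = Var rtotal], and
   [rtotal f(rtotal)] is close to [stein f'(rtotal)] in the mean. *)
Definition stein x : R := \sum_s cmin s x * jump s x.

Definition nlink s t x : R := \sum_(i | inc s i && inc t i) small i x.

Lemma K_ge0 : 0 <= K. Proof. by rewrite -vl_top. Qed.

Lemma rmin_ge0 s x : 0 <= rmin s x.
Proof. by apply: le_bigmin => // *; exact: K_ge0. Qed.

Lemma rmin_le s x : rmin s x <= K.
Proof. exact: bigmin_le_id. Qed.

Lemma rmin_inv s i : ~~ inc s i -> invariant_at i (rmin s).
Proof.
move=> si x v; apply: eq_bigr => j sj; rewrite ffunE.
by case: eqP si => // <-; rewrite sj.
Qed.

Lemma rmin_clear_inv s t i : inc s i || ~~ inc t i ->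
  invariant_at i (fun x => rmin t (clear s x)).
Proof.
move=> sti x v; apply: eq_bigr => j tj; rewrite !ffunE.
case: (boolP (inc s j)) => // sj; case: eqP sti => // <-.
by rewrite tj (negPf sj).
Qed.

Lemma rho_ge0 : 0 <= rho.
Proof. by apply: sumr_ge0 => v _. Qed.

Lemma small_ge0 i x : 0 <= small i x. Proof. exact: ler0n. Qed.

Lemma small_le1 i x : small i x <= 1. Proof. by rewrite lern1 leq_b1. Qed.

Lemma nsmall_ge0 s x : 0 <= nsmall s x.
Proof. by apply: sumr_ge0 => i _; exact: small_ge0. Qed.

Lemma nlink_ge0 s t x : 0 <= nlink s t x.
Proof. by apply: sumr_ge0 => i _; exact: small_ge0. Qed.

Lemma small_drop_le i j x : small j (drop_ i x) <= small j x.
Proof.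
rewrite /small ffunE; case: (j =P i) => // _.
by rewrite eqxx ler0n.
Qed.

Lemma nsmall_drop_le i s x : nsmall s (drop_ i x) <= nsmall s x.
Proof. by apply: ler_sum => j _; exact: small_drop_le. Qed.

Lemma nlink_drop_le i s t x : nlink s t (drop_ i x) <= nlink s t x.
Proof. by apply: ler_sum => j _; exact: small_drop_le. Qed.

Lemma nsmall_le_drop i s x : nsmall s x <= 1 + nsmall s (drop_ i x).
Proof.
rewrite /nsmall; case: (boolP (inc s i)) => si; last first.
  rewrite -[leLHS]add0r lerD// le_eqVlt; apply/orP; left; apply/eqP.
  apply: eq_bigr => j sj; rewrite /small ffunE.
  by case: (j =P i) si => // <-; rewrite sj.
rewrite (bigD1 i)//= lerD ?small_le1// (bigD1 i si)/=.
rewrite -[leLHS]add0r lerD ?small_ge0//; apply: ler_sum => j /andP[_ ji].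
by rewrite /small ffunE (negPf ji).
Qed.

Lemma drop_inv i (G : config -> R) : invariant_at i (fun x => G (drop_ i x)).
Proof. by move=> x v; rewrite /drop_ upd_upd. Qed.

(** [small i] reads coordinate [i] only, so integrating out this coordinate first replaces it by
    [rho]. *)
Lemma Ex_small i (G : config -> R) : invariant_at i G ->
  E (fun x => small i x * G x) = rho * E G.
Proof.
move=> Gi; rewrite -(Ex_Ei p_sum1 i) (Ei_mulr _ _ Gi) -ExZ.
congr Ex; apply/funext => x; congr (_ * _).
rewrite /Ei /rho [RHS]big_mkcond/=; apply: eq_bigr => v _.
by rewrite /small ffunE eqxx; case: ifP => _; rewrite ?mulr1 ?mulr0.
Qed.

Lemma Ex_small1 i : E (small i) = rho.
Proof.
rewrite -[RHS]mulr1 -[X in _ * X](Ex_cst I p_sum1 1) -(@Ex_small i)//.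
by congr Ex; apply/funext => x; rewrite mulr1.
Qed.

Lemma Ex_nsmall s : E (nsmall s) <= m%:R * rho.
Proof.
rewrite Ex_sum; under eq_bigr do rewrite Ex_small1.
rewrite sumr_const -[leLHS]mulr_natl ler_wpM2r ?rho_ge0// ler_nat.
exact: inc_m.
Qed.

Let y := m%:R * rho.

Let y_ge0 : 0 <= y. Proof. by rewrite mulr_ge0// rho_ge0. Qed.

(** As for a binomial variable: one factor of the square is expanded, and next to [small i] the
    other factor is at most 1 plus the count without face [i], which ignores coordinate [i]. *)
Lemma Ex_nsmall_sqr s : E (fun x => nsmall s x ^+ 2) <= y * (1 + y).
Proof.
have -> : (fun x => nsmall s x ^+ 2) =
    fun x => \sum_(i | inc s i) small i x * nsmall s x.
  by apply/funext => x; rewrite expr2 {1}/nsmall big_distrl.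
rewrite Ex_sum (@le_trans _ _ (\sum_(i | inc s i) rho * (1 + y)))//.
  apply: ler_sum => i si.
  rewrite (@le_trans _ _ (E (fun x => small i x * (1 + nsmall s (drop_ i x)))))//.
    by apply: Ex_le => // x; rewrite ler_wpM2l ?small_ge0 ?nsmall_le_drop.
  rewrite Ex_small; last exact: (@drop_inv i (fun x => 1 + nsmall s x)).
  rewrite ler_wpM2l ?rho_ge0// ExD Ex_cst// lerD2l.
  apply: le_trans (Ex_nsmall s).
  by apply: Ex_le => // x; exact: nsmall_drop_le.
rewrite sumr_const -[leLHS]mulr_natl mulrA ler_wpM2r ?addr_ge0//.
by rewrite ler_wpM2r ?rho_ge0// ler_nat inc_m.
Qed.

Lemma Ex_nsmall1_sqr s : E (fun x => (1 + nsmall s x) ^+ 2) <= (1 + 2 * y) ^+ 2.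
Proof.
have -> : (fun x => (1 + nsmall s x) ^+ 2) =
    fun x => (1 + 2 * nsmall s x) + nsmall s x ^+ 2.
  by apply/funext => x; ring.
rewrite !ExD Ex_cst// ExZ.
have := Ex_nsmall_sqr s; have := Ex_nsmall s; rewrite -/y.
have := y_ge0; nra.
Qed.

Lemma cmin_norm s x : `|cmin s x| <= K.
Proof.
have EK : E (rmin s) <= K.
  by rewrite -[leRHS](Ex_cst I p_sum1); apply: Ex_le => // z; exact: rmin_le.
have E0 : 0 <= E (rmin s) by apply: Ex_ge0 => // z; exact: rmin_ge0.
have := rmin_ge0 s x; have := rmin_le s x.
by rewrite /cmin ler_norml; lra.
Qed.

Lemma Ex_cmin s : E (cmin s) = 0.
Proof. by rewrite /cmin ExB Ex_cst// subrr. Qed.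

(** Clearing [s] can alter the minimum of [t] only through a common face that is not at [top]. If
    there is one, [nlink] is at least 1 and both minima lie between 0 and [K]; if there is none,
    they coincide. *)
Lemma gap_norm s t x : `|gap s t x| <= K * nlink s t x.
Proof.
case: (boolP [exists i, [&& inc s i, inc t i & x i != top]]) => [|no].
  move=> /existsP[i /and3P[si ti xi]].
  have l1 : 1 <= nlink s t x.
    rewrite /nlink (bigD1 i) ?si ?ti//= {1}/small xi lerDl.
    by apply: sumr_ge0 => j _; exact: small_ge0.
  apply: (@le_trans _ _ K); last by rewrite ler_peMr ?K_ge0.
  have := rmin_ge0 t x; have := rmin_le t x.
  have := rmin_ge0 t (clear s x); have := rmin_le t (clear s x).
  by rewrite /gap ler_norml; lra.
suff -> : gap s t x = 0 by rewrite normr0 mulr_ge0 ?K_ge0 ?nlink_ge0.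
apply/eqP; rewrite subr_eq0; apply/eqP; apply: eq_bigr => i ti.
rewrite ffunE; case: ifP => // si; congr vl; apply/eqP.
by move/existsPn: no => /(_ i); rewrite si ti /= negbK.
Qed.

(** Double counting: every face above [s] lies above at most [D] sets [t]. *)
Lemma sum_nlink s x : \sum_t nlink s t x <= D%:R * nsmall s x.
Proof.
rewrite /nlink (exchange_big_dep (inc s))/=; last by move=> t i _ /andP[].
rewrite /nsmall big_distrr/=; apply: ler_sum => i si.
rewrite (eq_bigl [pred t | inc t i]); last by move=> t; rewrite si.
rewrite sumr_const -[leLHS]mulr_natl ler_wpM2r ?small_ge0// ler_nat.
exact: inc_D.
Qed.

Lemma nlinkC s t x : nlink s t x = nlink t s x.
Proof. by apply: eq_bigl => i; rewrite andbC. Qed.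

Lemma jump_norm s x : `|jump s x| <= K * D%:R * nsmall s x.
Proof.
rewrite (le_trans (ler_norm_sum _ _ _))// -mulrA.
rewrite (le_trans _ (ler_wpM2l K_ge0 (sum_nlink s x)))// big_distrr/=.
by apply: ler_sum => t _; exact: gap_norm.
Qed.

Lemma Ex_jump_sqr s :
  E (fun x => jump s x ^+ 2) <= (K * D%:R) ^+ 2 * (y * (1 + y)).
Proof.
apply: (@le_trans _ _ (E (fun x => (K * D%:R) ^+ 2 * nsmall s x ^+ 2))).
  apply: Ex_le => // x; rewrite -exprMn -[leLHS]real_normK ?num_real//.
  by rewrite lerXn2r ?nnegrE ?jump_norm// ?mulr_ge0 ?K_ge0 ?nsmall_ge0.
by rewrite ExZ ler_wpM2l ?Ex_nsmall_sqr// sqr_ge0.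
Qed.

(** Nothing moves unless [x i] differs from [top]. The summand for [s] and [t] changes only if face
    [i] lies above one of them, and both of its values are at most [K ^+ 2 * nlink s t x]. The
    constant 4 counts these two values and the two roles of [s] and [t]. The last factor is phrased
    with [drop_ i x] so that it ignores coordinate [i] and is independent of [small i x]. *)
Lemma stein_drop i x :
  `|stein x - stein (drop_ i x)| <=
  small i x * (4 * K ^+ 2 * D%:R * \sum_(s | inc s i) (1 + nsmall s (drop_ i x))).
Proof.
case: (eqVneq (x i) top) => [xi|xi].
  by rewrite /small xi eqxx mul0r /drop_ -xi upd_id subrr normr0.
rewrite {1}/small xi mul1r.
have dterm s t :
    `|cmin s x * gap s t x - cmin s (drop_ i x) * gap s t (drop_ i x)| <=
    2 * K ^+ 2 * ((inc s i)%:R * nlink s t x + (inc t i)%:R * nlink t s x).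
  have bnd z : nlink s t z <= nlink s t x ->
      `|cmin s z * gap s t z| <= K ^+ 2 * nlink s t x.
    move=> zx; rewrite normrM expr2 -mulrA ler_pM ?cmin_norm//.
    by rewrite (le_trans (gap_norm _ _ _))// ler_wpM2l ?K_ge0.
  have [si|si] := boolP (inc s i); last first.
    have [ti|ti] := boolP (inc t i); last first.
      rewrite /cmin /gap (rmin_inv si) (rmin_inv ti).
      rewrite (@rmin_clear_inv s t i) ?ti ?orbT// subrr normr0.
      by rewrite !mul0r addr0 mulr0.
    rewrite mul0r mul1r add0r nlinkC (le_trans (ler_normB _ _))//.
    have := bnd x (lexx _); have := bnd _ (nlink_drop_le i s t x); lra.
  rewrite mul1r (@le_trans _ _ (2 * K ^+ 2 * nlink s t x))//; last first.
    by rewrite ler_wpM2l ?lerDl ?mulr_ge0 ?sqr_ge0 ?K_ge0 ?nlink_ge0 ?ler0n//.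
  rewrite (le_trans (ler_normB _ _))//.
  have := bnd x (lexx _); have := bnd _ (nlink_drop_le i s t x); lra.
have sum_half : \sum_s \sum_t (inc s i)%:R * nlink s t x <=
    D%:R * \sum_(s | inc s i) (1 + nsmall s (drop_ i x)).
  rewrite big_distrr/= [leRHS]big_mkcond/=; apply: ler_sum => s _.
  rewrite -big_distrr/=; case: ifP => _; last by rewrite mul0r.
  rewrite mul1r (le_trans (sum_nlink _ _))// ler_wpM2l//.
  exact: nsmall_le_drop.
have -> : stein x - stein (drop_ i x) = \sum_s \sum_t
    (cmin s x * gap s t x - cmin s (drop_ i x) * gap s t (drop_ i x)).
  rewrite /stein -sumrB; apply: eq_bigr => s _.
  by rewrite sumrB !big_distrr.
rewrite (le_trans (ler_norm_sum _ _ _))//.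
apply: (@le_trans _ _ (\sum_s \sum_t
    2 * K ^+ 2 * ((inc s i)%:R * nlink s t x + (inc t i)%:R * nlink t s x))).
  apply: ler_sum => s _; rewrite (le_trans (ler_norm_sum _ _ _))//.
  exact: ler_sum.
under eq_bigr do rewrite -big_distrr/= big_split/=.
rewrite -big_distrr/= big_split/= [X in _ + X]exchange_big/=.
set A := \sum_s _; rewrite -/A in sum_half *.
rewrite (_ : 4 * _ * _ * _ = 2 * K ^+ 2 * (2 * (D%:R *
  \sum_(s | inc s i) (1 + nsmall s (drop_ i x))))); last by ring.
rewrite ler_wpM2l ?mulr_ge0 ?sqr_ge0 ?K_ge0//.
by rewrite (_ : A + A = 2 * A); [rewrite ler_pM2l|ring].
Qed.

(** Efron-Stein, compared with [stein] after deletion of face [i]: the squared increment carries the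
    factor [small i], which is its own square and independent of the rest, hence a single factor
    [rho] per face. Of the four factors [D], two come from squaring [stein_drop] and two from
    Cauchy-Schwarz and a sum over at most [D] sets. *)
Lemma Var_stein_le :
  Var p stein <= #|I|%:R * (16 * K ^+ 4 * D%:R ^+ 4 * rho * (1 + 2 * y) ^+ 2).
Proof.
apply: (le_trans (Efron_Stein p_ge0 p_sum1 stein
  (fun i => @drop_inv i stein))).
rewrite -sum1_card natr_sum big_distrl/=; apply: ler_sum => i _; rewrite mul1r.
pose g x := (4 * K ^+ 2 * D%:R) ^+ 2 *
  (D%:R * \sum_(s | inc s i) (1 + nsmall s (drop_ i x)) ^+ 2).
apply: (@le_trans _ _ (E (fun x => small i x * g x))).
  apply: Ex_le => // x; rewrite -[leLHS]real_normK ?num_real//.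
  apply: (@le_trans _ _ ((small i x * (4 * K ^+ 2 * D%:R *
      \sum_(s | inc s i) (1 + nsmall s (drop_ i x)))) ^+ 2)).
    rewrite lerXn2r ?nnegrE ?stein_drop//.
    rewrite !mulr_ge0 ?small_ge0 ?sqr_ge0 ?K_ge0//.
    by apply: sumr_ge0 => s _; rewrite addr_ge0 ?nsmall_ge0.
  rewrite exprMn (_ : small i x ^+ 2 = small i x); last first.
    by rewrite /small; case: (_ != _); rewrite ?expr0n ?expr1n.
  rewrite ler_wpM2l ?small_ge0// exprMn ler_wpM2l ?sqr_ge0//.
  rewrite (le_trans (sqr_sum_le _ _))// ler_wpM2r ?ler_nat ?inc_D//.
  by apply: sumr_ge0 => s _; exact: sqr_ge0.
rewrite Ex_small; last exact: (@drop_inv i (fun x => (4 * K ^+ 2 * D%:R) ^+ 2 *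
  (D%:R * \sum_(s | inc s i) (1 + nsmall s x) ^+ 2))).
rewrite (_ : 16 * _ * _ * _ * _ = rho * ((4 * K ^+ 2 * D%:R) ^+ 2 *
   (D%:R * (D%:R * (1 + 2 * y) ^+ 2)))); last by ring.
rewrite ler_wpM2l ?rho_ge0// ExZ ler_wpM2l ?sqr_ge0// ExZ ler_wpM2l//.
rewrite Ex_sum (@le_trans _ _ (\sum_(s | inc s i) (1 + 2 * y) ^+ 2))//.
  apply: ler_sum => s _; apply: le_trans (Ex_nsmall1_sqr s).
  apply: Ex_le => // x; rewrite lerXn2r ?nnegrE ?addr_ge0 ?nsmall_ge0//.
  by rewrite lerD2l nsmall_drop_le.
rewrite sumr_const -[leLHS]mulr_natl ler_wpM2r ?sqr_ge0// ler_nat.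
exact: inc_D.
Qed.

Lemma sum_cmin x : rtotal x - E rtotal = \sum_s cmin s x.
Proof. by rewrite /rtotal Ex_sum -sumrB. Qed.

(** [cmin s] depends only on the faces above [s], which [clear s] overwrites, so the two factors are
    independent and the first is centred. *)
Lemma Ex_cmin_clear s (g : R -> R) :
  E (fun x => cmin s x * g (rtotal (clear s x))) = 0.
Proof.
rewrite (@Ex_indep _ _ _ _ p_sum1 [set i | inc s i]).
- by rewrite Ex_cmin mul0r.
- by move=> i; rewrite inE => si x v; rewrite /cmin rmin_inv.
- move=> i; rewrite inE => si x v; congr g; apply: eq_bigr => t _.
  by rewrite (@rmin_clear_inv s t i) ?si.
Qed.

Lemma jumpE s x : jump s x = rtotal x - rtotal (clear s x).
Proof. by rewrite /jump sumrB. Qed.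

(** In each summand the total after clearing [s] contributes nothing, by [Ex_cmin_clear], so the
    jump may be replaced by the centred total. *)
Lemma Ex_stein : E stein = Var p rtotal.
Proof.
rewrite /Var /stein Ex_sum.
transitivity (\sum_s E (fun x => cmin s x * (rtotal x - E rtotal))).
  apply: eq_bigr => s _; rewrite -[RHS]subr0.
  rewrite -(Ex_cmin_clear s (fun z => z - E rtotal)) -ExB.
  by congr Ex; apply/funext => x; rewrite jumpE; ring.
rewrite -Ex_sum; congr Ex; apply/funext => x.
by rewrite -big_distrl/= -sum_cmin expr2.
Qed.

Definition rstd (sd : R) x : R := (rtotal x - E rtotal) / sd.

(** As [cmin s] is uncorrelated with [f] of the cleared total, [f (Y x)] may be replaced by
    [f (Y x) - f (Ys s x)] and expanded at [Y x]: the linear parts add up to the Stein coefficient,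
    the remainders are quadratic in the jumps. The scale [sd] is free because it will be the
    deviation of the original total and not that of [rtotal]; the mismatch is the term
    [1 - Var p rtotal / sd ^+ 2]. *)
Lemma stein_bound (f f' : R -> R) (B1 B2 sd q : R) :
    0 < sd -> 0 <= q -> Var p stein <= q ^+ 2 ->
    (forall u, `|f' u| <= B1) ->
    (forall u v, `|f u - f v - (u - v) * f' u| <= B2 * (u - v) ^+ 2) ->
  `|E (fun x => f' (rstd sd x) - rstd sd x * f (rstd sd x))| <=
    B1 * (`|1 - Var p rtotal / sd ^+ 2| + q / sd ^+ 2) +
    B2 * (#|J|%:R * (K * ((K * D%:R) ^+ 2 * (y * (1 + y))))) / sd ^+ 3.
Proof.
move=> sd0 q0 Vq f'B fB; set Y := rstd sd.
have B10 : 0 <= B1 by apply: le_trans (f'B 0); exact: normr_ge0.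
have B20 : 0 <= B2.
  have := le_trans (normr_ge0 _) (fB 1 0).
  by rewrite subr0 expr1n mulr1.
pose Ys s x := (rtotal (clear s x) - E rtotal) / sd.
pose rem s x := f (Y x) - f (Ys s x) - (Y x - Ys s x) * f' (Y x).
have YYs s x : Y x - Ys s x = jump s x / sd.
  by rewrite /Y /Ys /rstd -mulrBl jumpE; congr (_ / _); ring.
have EYf : E (fun x => Y x * f (Y x)) =
    E (fun x => f' (Y x) * stein x) / sd ^+ 2 +
    (\sum_s E (fun x => cmin s x * rem s x)) / sd.
  have -> : E (fun x => Y x * f (Y x)) =
      (\sum_s E (fun x => cmin s x * f (Y x))) / sd.
    rewrite -Ex_sum [RHS]mulrC -ExZ; congr Ex; apply/funext => x.
    by rewrite -big_distrl/= -sum_cmin /Y /rstd; ring.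
  have -> : \sum_s E (fun x => cmin s x * f (Y x)) =
      \sum_s (E (fun x => f' (Y x) * (cmin s x * jump s x)) / sd
              + E (fun x => cmin s x * rem s x)).
    apply: eq_bigr => s _; rewrite -[LHS]subr0.
    rewrite -(Ex_cmin_clear s (fun z => f ((z - E rtotal) / sd))) -ExB.
    rewrite [X in X + _]mulrC -ExZ -ExD; congr Ex; apply/funext => x.
    rewrite /rem YYs -/(Ys s x); ring.
  rewrite big_split/= mulrDl -big_distrl/= -Ex_sum; congr (_ + _).
  rewrite expr2 invfM mulrA; congr (_ / _ / _); congr Ex; apply/funext => x.
  by rewrite /stein big_distrr.
have Erem : `|(\sum_s E (fun x => cmin s x * rem s x)) / sd| <=
    B2 * (#|J|%:R * (K * ((K * D%:R) ^+ 2 * (y * (1 + y))))) / sd ^+ 3.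
  rewrite normrM normfV (gtr0_norm sd0).
  rewrite (_ : B2 * _ / _ = (\sum_(s : J) (B2 / sd ^+ 2 * K) *
      ((K * D%:R) ^+ 2 * (y * (1 + y)))) / sd); last first.
    rewrite sumr_const -[X in _ = X / _]mulr_natl; field.
    by rewrite gt_eqF.
  rewrite ler_wpM2r ?invr_ge0 ?(ltW sd0)// (le_trans (ler_norm_sum _ _ _))//.
  apply: ler_sum => s _; rewrite (le_trans (Ex_norm p_ge0 _))//.
  apply: (@le_trans _ _ (E (fun x => (B2 / sd ^+ 2 * K) * jump s x ^+ 2))).
    apply: Ex_le => // x; rewrite normrM.
    rewrite (_ : B2 / _ * _ * _ = K * (B2 * (jump s x / sd) ^+ 2)); last first.
      by field; rewrite gt_eqF.
    by rewrite ler_pM ?cmin_norm// -YYs fB.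
  rewrite ExZ ler_wpM2l ?Ex_jump_sqr// !mulr_ge0 ?K_ge0 ?invr_ge0 ?sqr_ge0//.
rewrite ExB EYf opprD addrA (le_trans (ler_normB _ _))// lerD//.
set T := stein; set W := Var p rtotal.
(* The Stein coefficient is split into its mean [W], which gives the mismatch of scales, and its
   fluctuation, whose mean absolute value is at most [q] by Jensen's inequality. *)
have -> : E (fun x => f' (Y x)) - E (fun x => f' (Y x) * T x) / sd ^+ 2 =
    E (fun x => f' (Y x)) * (1 - W / sd ^+ 2) +
    (- E (fun x => f' (Y x) * (T x - W))) / sd ^+ 2.
  have -> : E (fun x => f' (Y x) * (T x - W)) =
     E (fun x => f' (Y x) * T x) - W * E (fun x => f' (Y x)).
    by rewrite -ExZ -ExB; congr Ex; apply/funext => x; ring.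
  by field; rewrite gt_eqF.
rewrite [leRHS]mulrDr (le_trans (ler_normD _ _))// lerD//.
  rewrite normrM ler_wpM2r// (le_trans (Ex_norm p_ge0 _))//.
  by rewrite -[leRHS](Ex_cst I p_sum1); exact: Ex_le.
rewrite mulrA normrM normfV (ger0_norm (sqr_ge0 sd)).
rewrite ler_wpM2r ?invr_ge0 ?sqr_ge0// normrN.
rewrite (le_trans (Ex_norm p_ge0 _))//.
apply: (@le_trans _ _ (E (fun x => B1 * `|T x - W|))).
  by apply: Ex_le => // x; rewrite normrM ler_wpM2r.
rewrite ExZ ler_wpM2l//.
have sq : E (fun x => `|T x - W|) ^+ 2 <= q ^+ 2.
  rewrite (le_trans (Ex_sqr_le p_ge0 p_sum1 _))// (le_trans _ Vq)//.
  rewrite /Var Ex_stein -/W; apply: Ex_le => // x.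
  by rewrite real_normK ?num_real.
by rewrite -(@ler_pXn2r _ 2) ?nnegrE ?Ex_ge0.
Qed.

End truncated_minima.

(** * Covariances of minima of geometric weights *)

Section geometric_weights.
Context (R : realFieldType) (I J : finType) (M : nat) (p : 'I_M.+1 -> R).
Context (inc : J -> I -> bool) (delta alpha : R) (m : nat).
Hypotheses (delta_ge0 : 0 <= delta) (alpha_gt0 : 0 < alpha).
Hypothesis p_tail : forall j, (j <= M)%N ->
  \sum_(v : 'I_M.+1 | (j <= v)%N) p v = alpha ^+ j.
Hypothesis inc_m : forall s, #|[pred i | inc s i]| = m.
Local Notation config := {ffun I -> 'I_M.+1}.
Local Notation E := (Ex p).
Local Notation vl := (fun v : 'I_M.+1 => delta * v%:R).
Local Notation X := (rmin inc vl (delta * M%:R)).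
Implicit Types (x : config) (s t : J) (i : I).

Definition common s t : nat := #|[pred i | inc s i && inc t i]|.

(* The covariance of two minima, when [gamma] is the probability that a minimum
   exceeds one mesh and [theta] the probability that all common faces do. *)
Definition gcov (gamma theta : R) : R := delta ^+ 2 * (1 - theta) *
  \sum_(i < M) theta ^- i.+1 * (\sum_(j < M | (i <= j)%N) gamma ^+ j.+1) ^+ 2.

Let gamma := alpha ^+ m.

(** The indicator that the smallest index above [s] exceeds [j], written as a product over all faces
    so that its mean factors. *)
Definition above s (j : nat) x : R := \prod_i (inc s i ==> (j < x i)%N)%:R.

Lemma prod_nat_of_bool (b : I -> bool) :
  \prod_i (b i)%:R = [forall i, b i]%:R :> R.
Proof.
case: (boolP [forall i, b i]) => [/forallP ball|/forallPn[i nbi]].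
  by rewrite big1// => i _; rewrite ball.
by rewrite (bigD1 i)//= (negPf nbi) mul0r.
Qed.

(** Layer-cake formula: an integer between 0 and [M] is the number of levels [j < M] below it. *)
Lemma rmin_layers s x : X s x = delta * \sum_(j < M) above s j x.
Proof.
set z := \big[minn/M]_(i | inc s i) nat_of_ord (x i).
have zM : (z <= M)%N.
  by rewrite /z; elim/big_rec: _ => // i y _ yM; rewrite geq_min yM orbT.
have -> : X s x = delta * z%:R.
  rewrite /rmin /z; elim/big_rec2: _ => // i u v _ ->.
  rewrite /minn; case: ltnP => uv.
    by rewrite min_l// ler_wpM2l// ler_nat ltnW.
  by rewrite min_r// ler_wpM2l// ler_nat.
congr (_ * _).
have aboveE (j : 'I_M) : above s j x = (j < z)%N%:R.
  rewrite /above prod_nat_of_bool; congr (nat_of_bool _)%:R.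
  apply/forallP/idP => [H|jz i]; last first.
    apply/implyP => si; apply: (leq_trans jz).
    exact: (@bigmin_le_cond _ nat _ M i (inc s) (fun i => nat_of_ord (x i)) si).
  rewrite /z; elim/big_rec: _ => // i y si jy.
  by rewrite leq_min jy andbT; have := H i; rewrite si.
under eq_bigr do rewrite aboveE.
rewrite -(big_mkord xpredT (fun j => (j < z)%N%:R)) (big_cat_nat (n := z))//=.
rewrite [X in _ + X]big1_seq ?addr0; last first.
  by move=> j /=; rewrite mem_index_iota => /andP[zj _]; rewrite ltnNge zj.
rewrite (@eq_big_nat _ _ _ _ _ _ (fun=> 1)); last by move=> j /andP[_ ->].
by rewrite sumr_const_nat subn0.
Qed.

Lemma sum_p1 : \sum_v p v = 1.
Proof. by rewrite -(expr0 alpha) -p_tail//; apply: eq_bigl. Qed.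

Lemma Ex_above s (j : 'I_M) : E (above s j) = gamma ^+ j.+1.
Proof.
rewrite (Ex_prod _ (fun i (v : 'I_M.+1) => (inc s i ==> (j < v)%N)%:R)).
rewrite (bigID (fun i => inc s i))/= [X in _ * X]big1 ?mulr1; last first.
  move=> i /negPf si; rewrite -[RHS]sum_p1; apply: eq_bigr => v _.
  by rewrite si mulr1.
rewrite (eq_bigr (fun=> alpha ^+ j.+1)).
  by rewrite prodr_const inc_m /gamma -!exprM mulnC.
move=> i si; rewrite -p_tail// [RHS]big_mkcond/=; apply: eq_bigr => v _.
by rewrite si /=; case: ifP => _; rewrite ?mulr1 ?mulr0.
Qed.

(** A face above only one of the sets contributes the tail of that level. A common face has to pass
    the larger level, and since minimum and maximum add up to [j + k], its contribution is the
    product of both tails divided by that of the smaller level. *)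
Lemma Ex_above2 s t (j k : 'I_M) :
  E (fun x => above s j x * above t k x) =
  gamma ^+ j.+1 * gamma ^+ k.+1 / (alpha ^+ common s t) ^+ (minn j k).+1.
Proof.
have -> : (fun x => above s j x * above t k x) = fun x => \prod_i
    ((inc s i ==> (j < x i)%N)%:R * (inc t i ==> (k < x i)%N)%:R).
  by apply/funext => x; rewrite big_split.
rewrite (Ex_prod _ (fun i (v : 'I_M.+1) =>
  (inc s i ==> (j < v)%N)%:R * (inc t i ==> (k < v)%N)%:R)).
have an0 n : alpha ^+ n != 0 by rewrite expf_neq0// gt_eqF.
have tail1 (l : 'I_M) (b : bool) :
    \sum_v p v * (b ==> (l < v)%N)%:R = alpha ^+ (b * l.+1).
  case: b; rewrite /= ?mul1n ?mul0n.
    rewrite -p_tail// [RHS]big_mkcond/=; apply: eq_bigr => v _.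
    by case: ifP => _; rewrite ?mulr1 ?mulr0.
  by rewrite expr0 -[RHS]sum_p1; apply: eq_bigr => v _; rewrite mulr1.
have fact i : \sum_v p v * ((inc s i ==> (j < v)%N)%:R * (inc t i ==> (k < v)%N)%:R)
    = alpha ^+ (inc s i * j.+1) * alpha ^+ (inc t i * k.+1) *
      (alpha ^- (minn j k).+1) ^+ (inc s i && inc t i).
  case: (inc s i) => /=; last first.
    rewrite mul0n expr0 mul1r mulr1 -tail1.
    by apply: eq_bigr => v _; rewrite mul1r.
  rewrite mul1n; case: (inc t i) => /=; last first.
    rewrite mul0n expr0 !mulr1 -[X in alpha ^+ X]mul1n -(tail1 _ true).
    by apply: eq_bigr => v _; rewrite mulr1.
  rewrite mul1n.
  have -> : \sum_v p v * ((j < v)%N%:R * (k < v)%N%:R) = alpha ^+ (maxn j k).+1.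
    rewrite -p_tail ?gtn_max ?ltn_ord// [RHS]big_mkcond/=.
    apply: eq_bigr => v _; rewrite gtn_max.
    by case: (j < v)%N; case: (k < v)%N; rewrite /= ?(mulr1, mulr0).
  rewrite expr1; apply: (mulIf (an0 (minn j k).+1)); rewrite mulfVK ?an0//.
  by rewrite -!exprD !addnS !addSn addnC addn_min_max.
under eq_bigr do rewrite fact.
rewrite !big_split/=.
have card_sum (b : I -> bool) : (\sum_i b i = #|[pred i | b i]|)%N.
  by rewrite -sum1_card [RHS]big_mkcond; apply: eq_bigr => i _; rewrite inE; case: (b i).
have pw u (l : nat) : \prod_i alpha ^+ (inc u i * l.+1) = gamma ^+ l.+1.
  by rewrite prodrXr -big_distrl/= card_sum inc_m exprM.
rewrite !pw prodrXr card_sum -/(common s t) exprVn -!exprM.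
by rewrite (mulnC (common s t)).
Qed.

Lemma invX_sub1 (theta : R) (l : nat) : theta != 0 ->
  theta ^- l - 1 = (1 - theta) * \sum_(i < l) theta ^- i.+1.
Proof.
move=> th0; elim: l => [|l IH]; first by rewrite big_ord0 expr0 invr1 subrr mulr0.
rewrite big_ord_recr/= mulrDr -IH exprS; field.
by rewrite th0 expf_neq0.
Qed.

(** The negative power minus 1 is opened as [1 - theta] times a geometric sum, and the sums are
    interchanged; as [i <= minn j k] means [i <= j] and [i <= k], the inner double sum is a square.
    The factor [1 - theta] is now explicit: it vanishes without common faces and is small for a
    single one. *)
Lemma gcovE (theta : R) : theta != 0 ->
  delta ^+ 2 * \sum_(j < M) \sum_(k < M)
    (gamma ^+ j.+1 * gamma ^+ k.+1 * (theta ^- (minn j k).+1 - 1)) =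
  gcov gamma theta.
Proof.
move=> th0; rewrite /gcov -mulrA; congr (_ * _).
have -> : \sum_(i < M) theta ^- i.+1 *
      (\sum_(j < M | (i <= j)%N) gamma ^+ j.+1) ^+ 2 =
    \sum_(j < M) \sum_(k < M) gamma ^+ j.+1 * gamma ^+ k.+1 *
      \sum_(i < M | (i <= minn j k)%N) theta ^- i.+1.
  have sumb (b : 'I_M -> bool) (F : 'I_M -> R) :
      \sum_(i | b i) F i = \sum_i (b i)%:R * F i.
    rewrite big_mkcond; apply: eq_bigr => i _.
    by case: (b i); rewrite ?mul1r ?mul0r.
  under eq_bigr do rewrite sumb expr2 big_distrlr/= big_distrr/=.
  rewrite exchange_big/=; apply: eq_bigr => j _.
  under eq_bigr do rewrite big_distrr/=.
  rewrite exchange_big/=; apply: eq_bigr => k _.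
  rewrite [X in _ = _ * X]sumb big_distrr/=; apply: eq_bigr => i _.
  by rewrite leq_min; case: (i <= j)%N; case: (i <= k)%N => /=; ring.
rewrite big_distrr; apply: eq_bigr => j _ /=.
rewrite big_distrr; apply: eq_bigr => k _ /=.
rewrite invX_sub1// (big_ord_widen M (fun i : nat => theta ^- i.+1))/=.
  rewrite (eq_bigl (fun i : 'I_M => (i <= minn j k)%N)); first by ring.
  by move=> i; rewrite ltnS.
by rewrite (leq_ltn_trans (geq_minl _ _)).
Qed.

Lemma cov_rmin s t :
  E (fun x => X s x * X t x) - E (X s) * E (X t) =
  gcov gamma (alpha ^+ common s t).
Proof.
have th0 : alpha ^+ common s t != 0 by rewrite expf_neq0// gt_eqF.
have EX u : E (X u) = delta * \sum_(j < M) gamma ^+ j.+1.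
  have -> : X u = fun x => delta * \sum_(j < M) above u j x.
    by apply/funext => x; exact: rmin_layers.
  rewrite ExZ Ex_sum; congr (_ * _).
  by apply: eq_bigr => j _; exact: Ex_above.
have EXX : E (fun x => X s x * X t x) = delta ^+ 2 * \sum_(j < M) \sum_(k < M)
    (gamma ^+ j.+1 * gamma ^+ k.+1 / (alpha ^+ common s t) ^+ (minn j k).+1).
  have -> : (fun x => X s x * X t x) = fun x => delta ^+ 2 *
      \sum_(j < M) \sum_(k < M) above s j x * above t k x.
    apply/funext => x; rewrite !rmin_layers -big_distrlr/=; ring.
  rewrite ExZ Ex_sum; congr (_ * _); apply: eq_bigr => j _.
  by rewrite Ex_sum; apply: eq_bigr => k _; exact: Ex_above2.
rewrite -gcovE// EXX !EX.
rewrite (_ : delta * _ * (delta * _) = delta ^+ 2 *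
    ((\sum_(j < M) gamma ^+ j.+1) * (\sum_(j < M) gamma ^+ j.+1))); last by ring.
rewrite -mulrBr; congr (_ * _); rewrite big_distrlr/= -sumrB.
by apply: eq_bigr => j _; rewrite -sumrB; apply: eq_bigr => k _; ring.
Qed.

Lemma Var_rtotal : Var p (rtotal inc vl (delta * M%:R)) =
  \sum_s \sum_t gcov gamma (alpha ^+ common s t).
Proof.
rewrite VarE ?sum_p1// /rtotal Ex_sum.
have -> : (fun x => (\sum_s X s x) ^+ 2) = fun x => \sum_s \sum_t X s x * X t x.
  by apply/funext => x; rewrite expr2 big_distrlr.
rewrite Ex_sum expr2 big_distrlr/= -sumrB; apply: eq_bigr => s _.
by rewrite Ex_sum -sumrB; apply: eq_bigr => t _; exact: cov_rmin.
Qed.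

End geometric_weights.

(** * The Stein equation *)

Section gaussian_density.
Context (R : realType).
Implicit Types (x y z B e : R) (F G H : R -> R).

Local Notation mu := lebesgue_measure.
Local Notation phi := (normal_pdf (0 : R) 1).

Lemma phiE x : phi x = normal_peak 1 * expR (- (x ^+ 2 / 2)).
Proof.
rewrite /normal_pdf oner_eq0 /normal_fun subr0 expr1n; congr (_ * expR _).
by rewrite mulNr.
Qed.

Lemma phi_gt0 x : 0 < phi x.
Proof. by rewrite phiE mulr_gt0 ?expR_gt0// normal_peak_gt0// oner_eq0. Qed.

Lemma phiN x : phi (- x) = phi x.
Proof. by rewrite !phiE sqrrN. Qed.

Lemma is_derive_phi x : is_derive x 1 phi (- (x * phi x)).
Proof.
rewrite [X in - (x * X)]phiE.
rewrite (_ : phi = normal_peak 1 \*: (fun y => expR (- (y ^+ 2 / 2)))); last first.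
  by apply/funext => y; rewrite phiE.
have dsq : is_derive x 1 (fun y : R => - (y ^+ 2 / 2)) (- x).
  rewrite (_ : (fun y : R => _) = (- 2^-1) \*: ((@id R) ^+ 2)); last first.
    by apply/funext => y; rewrite /= fctE /GRing.scale/=; field.
  by apply: is_derive_eq; rewrite /GRing.scale/= expr1 /id; field.
apply: is_derive_eq.
rewrite /GRing.scale/=; ring.
Qed.

Lemma phi_anti x y : 0 <= x -> x <= y -> phi y <= phi x.
Proof.
move=> x0 xy; rewrite !phiE ler_pM2l ?normal_peak_gt0 ?oner_eq0// ler_expR lerN2.
by rewrite ler_pM2r// lerXn2r// nnegrE (le_trans x0).
Qed.

Lemma mvt F G x y : (forall z, is_derive z 1 F (G z)) -> x <= y ->
  exists2 c, x <= c <= y & F y - F x = G c * (y - x).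
Proof.
move=> dF xy.
have cF : {within `[x, y], continuous F}.
  by apply: derivable_within_continuous => z _; exact: ex_derive.
have [c cxy Fxy] := MVT_segment xy (fun z _ => dF z) cF.
by exists c.
Qed.

Definition vanishes_y F := forall e, 0 < e -> exists a, forall x, a <= x -> `|F x| <= e.

Lemma phi_vanishes : vanishes_y phi.
Proof.
move=> e e0; pose c : R := normal_peak 1.
have c0 : 0 < c by rewrite normal_peak_gt0 ?oner_eq0.
exists (1 + c / e) => x xge.
have x1 : 1 <= x by rewrite (le_trans _ xge)// lerDl divr_ge0 ?ltW.
have xe : c <= e * x.
  rewrite mulrC -ler_pdivrMr// (le_trans _ xge)// lerDr ler01//.
rewrite (gtr0_norm (phi_gt0 x)) phiE -/c expRN.
rewrite ler_pdivrMr ?expR_gt0// (le_trans xe)// ler_pM2l//.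
apply: le_trans (expR_ge1Dx _); have := sqr_ge0 (x - 1); lra.
Qed.

(* For fixed [x], the function [y |-> x * F y + B * phi y] is nonincreasing on
   [`[x, +oo[] and vanishes at infinity, hence it is nonnegative at [x]. *)
Lemma mills_half F G B : (forall x, is_derive x 1 F (G x)) ->
  (forall x, `|G x| <= B * phi x) -> vanishes_y F ->
  forall x, 0 < x -> - (B * phi x) <= x * F x.
Proof.
move=> dF GB Fy x x0.
pose Q y := x * F y + B * phi y.
have B0 : 0 <= B.
  by rewrite -(pmulr_lge0 _ (phi_gt0 0)) (le_trans _ (GB 0)).
have dQ y : is_derive y 1 Q (x * G y - B * (y * phi y)).
  change (is_derive y 1 (x \*: F + B \*: phi) (x * G y - B * (y * phi y))).
  have := is_derive_phi y => ?.
  apply: is_derive_eq; rewrite /GRing.scale/=; ring.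
suff Q0 : 0 <= Q x by rewrite -subr_ge0 opprK.
rewrite leNgt; apply/negP => Qx.
(* With this tolerance, far out [Q y] is at least [- e * (x + B)], strictly above [Q x], whereas the
   mean value theorem gives [Q y <= Q x]. *)
have e0 : 0 < - Q x / (2 * (x + B + 1)).
  by rewrite divr_gt0 ?oppr_gt0// mulr_gt0// addr_gt0// ltr_wpDr.
have [a aF] := Fy _ e0; have [b bphi] := phi_vanishes e0.
pose y := x + `|a| + `|b|.
have xy : x <= y by rewrite /y -addrA lerDl addr_ge0.
have ay : a <= y.
  by rewrite /y; have := ler_norm a; have := normr_ge0 b; lra.
have lby : b <= y.
  by rewrite /y; have := ler_norm b; have := normr_ge0 a; lra.
have [z /andP[xz zy] Qxy] := mvt dQ xy.
have : Q y - Q x <= 0.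
  rewrite Qxy mulr_le0_ge0 ?subr_ge0// subr_le0 mulrCA.
  apply: (@le_trans _ _ (x * (B * phi z))).
    by rewrite ler_pM2l// (le_trans _ (GB z))// ler_norm.
  by rewrite ler_wpM2r// mulr_ge0// ltW// phi_gt0.
move: (aF _ ay) (bphi _ lby); set e := _ / _ => Fe pe.
have Qe : Q x = - (e * (2 * (x + B + 1))).
  by rewrite /e divfK ?opprK// gt_eqF// mulr_gt0// addr_gt0// ltr_wpDr.
have e_gt0 : 0 < e by [].
have : - (x * e) <= x * F y.
  by rewrite -mulrN ler_pM2l// lerNl (le_trans _ Fe)// -normrN ler_norm.
have : - (B * e) <= B * phi y.
  by rewrite -mulrN ler_wpM2l// lerNl (le_trans _ pe)// -normrN ler_norm.
have := mulr_gt0 e_gt0 x0; have := mulr_ge0 (ltW e_gt0) B0.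
rewrite {1}/Q Qe; lra.
Qed.

(** The constant of the tail estimate for [F] itself. For [x >= 1] the bound on [x * F x] suffices;
    on the unit interval one returns from [F 1] to [F x] by the mean value theorem, at a cost of
    [B * phi 0], and [phi 1] is the least density there. *)
Definition C0 : R := 1 + phi 0 / phi 1.

Lemma C0_ge1 : 1 <= C0.
Proof. by rewrite lerDl divr_ge0// ltW// phi_gt0. Qed.

Lemma mills_pos F G B : (forall x, is_derive x 1 F (G x)) ->
  (forall x, `|G x| <= B * phi x) -> vanishes_y F ->
  forall x, 0 <= x -> `|x * F x| <= B * phi x /\ `|F x| <= C0 * B * phi x.
Proof.
move=> dF GB Fy.
have B0 : 0 <= B.
  by rewrite -(pmulr_lge0 _ (phi_gt0 0)) (le_trans _ (GB 0)).
have Bphi y : 0 <= B * phi y by rewrite mulr_ge0// ltW// phi_gt0.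
have xF x : 0 < x -> `|x * F x| <= B * phi x.
  move=> x0; rewrite ler_norml (mills_half dF GB Fy x0)/= -lerN2 -[leRHS]mulrN.
  change (- (B * phi x) <= x * (\- F) x).
  apply: (@mills_half (\- F) (\- G) B) => //.
  - by move=> y; rewrite /= normrN.
  - by move=> e /Fy[a aF]; exists a => y /aF; rewrite /= normrN.
move=> x x0; split.
  move: x0; rewrite le_eqVlt => /orP[/eqP <-|/xF//].
  by rewrite mul0r normr0.
have [x1|x1] := leP 1 x.
  have /xF : 0 < x by rewrite (lt_le_trans _ x1).
  rewrite normrM (ger0_norm x0) => H.
  apply: (@le_trans _ _ (B * phi x)).
    by apply: le_trans H; rewrite ler_peMl.
  by rewrite -mulrA ler_peMl// C0_ge1.
have [c /andP[xc c1] F1x] := mvt dF (ltW x1).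
have F1 : `|F 1| <= B * phi 1 by rewrite -[F 1]mul1r xF.
have Fd : `|F 1 - F x| <= B * phi 0.
  rewrite F1x normrM [X in _ * X]ger0_norm ?subr_ge0 ?(ltW x1)//.
  apply: (@le_trans _ _ (B * phi 0 * 1)); last by rewrite mulr1.
  rewrite ler_pM ?subr_ge0 ?(ltW x1)//; last by rewrite lerBlDr lerDl.
  rewrite (le_trans (GB c))// ler_wpM2l// phi_anti// (le_trans x0)//.
have : `|F x| <= `|F 1| + `|F 1 - F x|.
  by rewrite -{1}(subKr (F 1) (F x)) ler_normB.
move=> H; rewrite (le_trans H)// (le_trans (lerD F1 Fd))//.
have -> : B * phi 1 + B * phi 0 = C0 * B * phi 1.
  by rewrite /C0; field; rewrite gt_eqF// phi_gt0.
rewrite ler_wpM2l ?mulr_ge0 ?(le_trans _ C0_ge1)// phi_anti// ltW//.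
Qed.

Lemma mills F G B : (forall x, is_derive x 1 F (G x)) ->
  (forall x, `|G x| <= B * phi x) -> vanishes_y F ->
  vanishes_y (fun x => F (- x)) ->
  forall x, `|x * F x| <= B * phi x /\ `|F x| <= C0 * B * phi x.
Proof.
move=> dF GB Fy FNy x; have [x0|x0] := leP 0 x; first exact: (mills_pos dF GB).
have := @mills_pos (fun x => F (- x)) (fun x => - G (- x)) B _ _ FNy (- x).
rewrite phiN opprK mulNr normrN; apply; last by rewrite oppr_ge0 ltW.
- move=> y; have dFy := dF (- y).
  have : is_derive y 1 (F \o -%R) (G (- y) * -1) by apply: is_derive1_comp.
  by rewrite mulrN1.
- by move=> y; rewrite normrN -(phiN y).
Qed.

End gaussian_density.

Section stein_equation.
Context (R : realType).
Implicit Types (x y z B e : R) (F G H : R -> R).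

Local Notation mu := lebesgue_measure.
Local Notation phi := (normal_pdf (0 : R) 1).

Lemma integrable_phi (A : set R) : measurable A ->
  mu.-integrable A (EFin \o phi).
Proof.
move=> mA; apply: (integrableS measurableT) => //.
exact: integrable_normal_pdf.
Qed.

Lemma Rintegral_phi : \int[mu]_x phi x = 1.
Proof. by rewrite /Rintegral integral_normal_pdf. Qed.

Lemma normal_prob_Rintegral (A : set R) : measurable A ->
  normal_prob 0 1 A = (\int[mu]_(x in A) phi x)%:E.
Proof.
move=> mA; rewrite /normal_prob /Rintegral fineK//.
exact: integrable_fin_num (integrable_phi mA).
Qed.

Lemma integrable_bounded_phi (u : R -> R) (A : set R) : measurable A ->
  measurable_fun setT u -> (forall x, `|u x| <= 1) ->
  mu.-integrable A (EFin \o (fun x => u x * phi x)).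
Proof.
move=> mA mu1 u1; apply: (@le_integrable _ _ _ mu _ mA _ (EFin \o phi));
  last exact: integrable_phi.
- apply/measurable_EFinP/measurable_funTS/measurable_funM => //.
  exact: measurable_normal_pdf.
- by move=> x _ /=; rewrite lee_fin normrM ler_piMl.
Qed.

(* Under the normal law, the identity is a random variable whose (c)cdf gives
   the Gaussian tails. *)
Let idTR : measurableTypeR R -> R := idfun.

#[local] HB.instance Definition _ :=
  @isMeasurableFun.Build _ _ _ _ idTR (@measurable_id _ _ setT).

Lemma normal_tails_vanish :
  vanishes_y (fun x => \int[mu]_(y in `]x, +oo[) phi y) /\
  vanishes_y (fun x => \int[mu]_(y in `]-oo, - x]) phi y).
Proof.
pose N : probability _ R := normal_prob 0 1.
have cc : ccdf (idTR : {RV N >-> R}) @ +oo --> 0%E by exact: cvg_ccdfy0.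
have c : cdf (idTR : {RV N >-> R}) @ -oo --> 0%E by exact: cvg_cdfNy0.
have phi0 (A : set R) : 0 <= \int[mu]_(y in A) phi y.
  by apply: Rintegral_ge0 => y _; exact: normal_pdf_ge0.
split=> e e0.
  have : \forall x \near +oo, fine (ccdf (idTR : {RV N >-> R}) x) < e.
    exact: (cvgr_lt _ (fine_cvg cc)).
  move=> [a [_ ae]]; exists (a + 1) => x ax.
  have /ae : a < x by rewrite (lt_le_trans _ ax)// ltrDl.
  rewrite /ccdf /distribution /pushforward preimage_id /= normal_prob_Rintegral//.
  by rewrite /= ger0_norm// => /ltW.
have : \forall x \near -oo, fine (cdf (idTR : {RV N >-> R}) x) < e.
  exact: (cvgr_lt _ (fine_cvg c)).
move=> [a [_ ae]]; exists (1 - a) => x ax.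
have /ae : - x < a by rewrite ltrNl (lt_le_trans _ ax)// ltrDr.
rewrite /cdf /distribution /pushforward preimage_id /= normal_prob_Rintegral//.
by rewrite /= ger0_norm// => /ltW.
Qed.

(** The solution is [H / phi], with [H] the integral of [u * phi] from -oo. The estimate [mills] is
    used twice: for [H], which bounds [f] and [x * f], and for [f' * phi], whose derivative is
    [(f + du) * phi], which bounds [x * f']. Hence the second derivative [f + x * f' + du] is
    bounded; the Taylor estimate is the form in which [stein_bound] consumes this. *)
Lemma stein_solution (u du : R -> R) (L : R) :
    (forall x, is_derive x 1 u (du x)) -> (forall x, `|u x| <= 1) ->
    (forall x, `|du x| <= L) -> \int[mu]_x (u x * phi x) = 0 ->
  exists f f' : R -> R,
    [/\ forall x, f' x = x * f x + u x, forall x, `|f' x| <= 2 &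
        forall x y, `|f x - f y - (x - y) * f' x| <=
                    2 * (C0 R + L) * (x - y) ^+ 2].
Proof.
move=> duE u1 duL u0.
have cu : continuous u.
  by move=> x; apply/differentiable_continuous/derivable1_diffP; exact: ex_derive.
have mu1 : measurable_fun setT u by exact: continuous_measurable_fun.
have iu (A : set R) : measurable A ->
    mu.-integrable A (EFin \o (fun x => u x * phi x)).
  by move=> mA; exact: integrable_bounded_phi.
pose H x := \int[mu]_(y in `]-oo, x]) (u y * phi y).
have dH x : is_derive x 1 H (u x * phi x).
  have cx : {for x, continuous (fun y => u y * phi y)}.
    by apply: continuousM; [exact: cu|exact: (@continuous_normal_pdf R 0 1 (oner_neq0 _))].
  have x1 : x < x + 1 by rewrite ltrDl.
  have [dH HE] := @continuous_FTC1 R (fun y => u y * phi y) -oo%O x (x + 1)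
    x1 (iu _ (measurable_itv _)) (ltNyr x) cx.
  by apply: DeriveDef; [exact: dH|rewrite -derive1E HE].
have [ty tNy] := normal_tails_vanish.
have Hle (A : set R) : measurable A ->
    `|\int[mu]_(y in A) (u y * phi y)| <= \int[mu]_(y in A) phi y.
  move=> mA; rewrite (le_trans (le_normr_Rintegral _ _))//; first exact: iu.
  apply: le_Rintegral => //; [|exact: integrable_phi|].
  - have := integrable_norm (iu _ mA); exact.
  - by move=> x _; rewrite normrM (gtr0_norm (phi_gt0 _)) ler_piMl// ltW ?phi_gt0.
(* As [u] has mean zero under the normal law, [H x] is minus the integral over the right tail, so it
   also vanishes at +oo. *)
have Hy : vanishes_y H.
  move=> e /ty[a ae]; exists a => x /ae; apply: le_trans.
  rewrite [leRHS]ger0_norm; last first.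
    by apply: Rintegral_ge0 => y _; exact: normal_pdf_ge0.
  have -> : H x = - \int[mu]_(y in `]x, +oo[) (u y * phi y).
    have UT : `]-oo, x] `|` `]x, +oo[ = [set: R].
      by rewrite -itv_bndbnd_setU// set_itvNyy.
    have disj : [disjoint `]-oo, x]%classic & `]x, +oo[%classic].
      apply/disj_set2P; rewrite -subset0 => y/=; rewrite !in_itv/= andbT.
      by move=> [yx]; rewrite ltNge yx.
    have iT : mu.-integrable (`]-oo, x] `|` `]x, +oo[)
        (EFin \o (fun y => u y * phi y)) by rewrite UT; exact: iu.
    have : \int[mu]_(y in `]-oo, x] `|` `]x, +oo[) (u y * phi y) =
        H x + \int[mu]_(y in `]x, +oo[) (u y * phi y) by exact: Rintegral_setU.
    rewrite UT u0 => /eqP; rewrite eq_sym addr_eq0 => /eqP.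
    exact.
  by rewrite normrN; exact: Hle.
have HNy : vanishes_y (fun x => H (- x)).
  move=> e /tNy[a ae]; exists a => x /ae; apply: le_trans.
  rewrite [leRHS]ger0_norm; first exact: Hle.
  by apply: Rintegral_ge0 => y _; exact: normal_pdf_ge0.
have uphi x : `|u x * phi x| <= 1 * phi x.
  by rewrite normrM (gtr0_norm (phi_gt0 _)) ler_wpM2r// ltW// phi_gt0.
have HB := mills dH uphi Hy HNy.
pose f x := H x / phi x; pose f' x := x * f x + u x.
have fB x : `|x * f x| <= 1 /\ `|f x| <= C0 R.
  have [H1 H2] := HB x; have px := phi_gt0 x.
  rewrite /f mulrA ![`|_ / _|]normrM normfV (gtr0_norm px) !ler_pdivrMr//.
  by rewrite mulr1 in H2.
have f'B x : `|f' x| <= 2.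
  by have [xf _] := fB x; rewrite (le_trans (ler_normD _ _))// lerD.
have df x : is_derive x 1 f (f' x).
  have px := phi_gt0 x; have ? := dH x; have ? := is_derive_phi x.
  have dphiV : is_derive x 1 (fun y => (phi y)^-1) (x / phi x).
    have -> : x / phi x = - phi x ^- 2 *: - (x * phi x).
      by rewrite /GRing.scale/=; field; rewrite gt_eqF.
    by apply: is_deriveV; rewrite gt_eqF.
  have -> : f' x = H x *: (x / phi x) + (phi x)^-1 *: (u x * phi x).
    by rewrite /f' /f /GRing.scale/=; field; rewrite gt_eqF.
  exact: (is_deriveM (f := H)).
have df' x : is_derive x 1 f' (f x + x * f' x + du x).
  have ? := df x; have ? := duE x.
  have -> : f x + x * f' x + du x = (x *: f' x + f x *: 1) + du x.
    by rewrite /GRing.scale/=; ring.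
  exact: (is_deriveD (f := (@id R) * f)).
pose G x := f' x * phi x.
have dG x : is_derive x 1 G ((f x + du x) * phi x).
  have ? := df' x; have ? := is_derive_phi x.
  have -> : (f x + du x) * phi x =
     f' x *: (- (x * phi x)) + phi x *: (f x + x * f' x + du x).
    by rewrite /GRing.scale/=; ring.
  exact: (is_deriveM (f := f')).
have Gv (s : R -> R) : (forall x, phi (s x) = phi x) ->
    vanishes_y (fun x => G (s x)).
  move=> sE e e0; have [|a ae] := @phi_vanishes R (e / 2); first by rewrite divr_gt0.
  exists a => x /ae; rewrite /G sE normrM => px.
  by rewrite (le_trans (ler_pM _ _ (f'B _) px))// mulrC divfK.
have GB x : `|(f x + du x) * phi x| <= (C0 R + L) * phi x.
  rewrite normrM (gtr0_norm (phi_gt0 x)) ler_wpM2r ?(ltW (phi_gt0 x))//.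
  by have [_ fx] := fB x; rewrite (le_trans (ler_normD _ _))// lerD.
have G1 := mills dG GB (Gv id (fun=> erefl)) (Gv -%R (@phiN R)).
have f''B x : `|f x + x * f' x + du x| <= 2 * (C0 R + L).
  have [+ _] := G1 x; rewrite /G mulrA normrM (gtr0_norm (phi_gt0 x)).
  rewrite ler_pM2r ?phi_gt0// => xf'; have [_ fx] := fB x; have dux := duL x.
  have := ler_normD (f x + x * f' x) (du x); have := ler_normD (f x) (x * f' x).
  lra.
exists f, f'; split=> //.
have lip x y : x <= y -> `|f' y - f' x| <= 2 * (C0 R + L) * (y - x).
  move=> xy; have [c _ ->] := mvt df' xy.
  by rewrite normrM [X in _ * X]ger0_norm ?subr_ge0// ler_wpM2r ?subr_ge0.
move=> x y.
have key a b c : a <= c <= b -> `|f' c - f' a| <= 2 * (C0 R + L) * (b - a) /\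
    `|f' c - f' b| <= 2 * (C0 R + L) * (b - a).
  move=> /andP[ac cb].
  have B0 : 0 <= 2 * (C0 R + L) by apply: le_trans (f''B 0).
  split; first by rewrite (le_trans (lip _ _ ac))// ler_wpM2l// lerD2r.
  rewrite distrC (le_trans (lip _ _ cb))// ler_wpM2l// lerD2l lerN2//.
have [xy|/ltW yx] := leP x y.
  have [c cxy fyx] := mvt df xy.
  have -> : f x - f y - (x - y) * f' x = (y - x) * (f' x - f' c).
    by rewrite -(opprB (f y)) fyx; ring.
  rewrite normrM (ger0_norm (_ : 0 <= y - x)) ?subr_ge0// mulrC distrC.
  rewrite -sqrrN opprB expr2 mulrA ler_wpM2r ?subr_ge0//.
  by have [] := key _ _ _ cxy.
have [c cxy fyx] := mvt df yx.
have -> : f x - f y - (x - y) * f' x = (x - y) * (f' c - f' x).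
  by rewrite fyx; ring.
rewrite normrM (ger0_norm (_ : 0 <= x - y)) ?subr_ge0// mulrC.
rewrite expr2 mulrA ler_wpM2r ?subr_ge0//.
by have [] := key _ _ _ cxy.
Qed.

End stein_equation.

(** * Logistic test functions *)

Section bounded_functions.
Context (R : realType) (d : measure_display) (T : measurableType d).
Context (P : probability T R).

Lemma bounded_prob_integrable (g : T -> R) (c : R) :
  measurable_fun setT g -> (forall w, `|g w| <= c) ->
  P.-integrable setT (EFin \o g).
Proof.
move=> mg gc; apply: measurable_bounded_integrable => //.
  by rewrite -ge0_fin_numE// fin_num_measure.
exists c; split; first exact: num_real.
by move=> y cy w _ /=; rewrite (le_trans (gc w))// ltW.
Qed.

Lemma Rintegral_prob_indic (A : set T) : measurable A ->
  \int[P]_w \1_A w = fine (P A).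
Proof. by move=> mA; rewrite /Rintegral integral_indic// setIT. Qed.

Lemma Rintegral_prob_cst (c : R) : \int[P]_w c = c.
Proof. by rewrite Rintegral_cst// [X in fine X](probability_setT P) mulr1. Qed.

End bounded_functions.

Section logistic_test_functions.
Context (R : realType).
Implicit Types (k t x q : R).

Local Notation mu := lebesgue_measure.
Local Notation phi := (normal_pdf (0 : R) 1).

(** For [k > 0] this is a smooth step down from 1 to 0 at [t], of steepness [k]. *)
Definition logistic k t x : R := (1 + expR (k * (x - t)))^-1.

Lemma logistic_gt0 k t x : 0 < logistic k t x.
Proof. by rewrite invr_gt0 addr_gt0 ?expR_gt0. Qed.

Lemma logistic_le1 k t x : logistic k t x <= 1.
Proof. by rewrite invf_le1 ?addr_gt0 ?expR_gt0// lerDl expR_ge0. Qed.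

Definition dlogistic k t x : R :=
  - (k * expR (k * (x - t))) * logistic k t x ^+ 2.

Lemma is_derive_logistic k t x :
  is_derive x 1 (logistic k t) (dlogistic k t x).
Proof.
have d1 : is_derive x 1 (fun y => expR (k * (y - t))) (expR (k * (x - t)) * k).
  have dl : is_derive x 1 (fun y : R => k * (y - t)) k.
    have -> : (fun y : R => k * (y - t)) = k \*: (@id R - cst t).
      by apply/funext => y.
    by apply: is_derive_eq; rewrite subr0 /GRing.scale/= mulr1.
  exact: (@is_derive1_comp _ expR).
have d2 : is_derive x 1 (fun y => 1 + expR (k * (y - t))) (expR (k * (x - t)) * k).
  have -> : (fun y => 1 + expR (k * (y - t))) =
    cst 1 + (fun y => expR (k * (y - t))) by apply/funext => y.
  by apply: is_derive_eq; rewrite add0r.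
have p0 : 1 + expR (k * (x - t)) != 0 by rewrite gt_eqF// addr_gt0 ?expR_gt0.
have := @is_deriveV R (fun y => 1 + expR (k * (y - t))) x _ 1 p0 d2.
by rewrite /dlogistic /logistic exprVn /GRing.scale/= => H; apply: is_derive_eq; field.
Qed.

Lemma dlogistic_norm k t x : 0 <= k -> `|dlogistic k t x| <= k.
Proof.
move=> k0; rewrite /dlogistic mulNr normrN ger0_norm; last first.
  exact: (mulr_ge0 (mulr_ge0 k0 (expR_ge0 _)) (sqr_ge0 _)).
rewrite -mulrA ler_piMr// /logistic exprVn ler_pdivrMr ?exprn_gt0 ?addr_gt0 ?expR_gt0//.
by have := expR_gt0 (k * (x - t)); set e := expR _ => e0; nra.
Qed.

Lemma measurable_logistic k t : measurable_fun setT (logistic k t).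
Proof.
apply: continuous_measurable_fun => x.
apply/differentiable_continuous/derivable1_diffP.
by have ? := is_derive_logistic k t x; exact: ex_derive.
Qed.

(** [q] is both the horizontal shift and the error: beyond [t + q] the logistic function is below
    [expR (- (k * q))], hence below [q]. *)
Lemma logistic_le_step k t q x : 0 < k -> expR (- (k * q)) <= q -> 0 < q ->
  logistic k t x <= (x <= t + q)%R%:R + q.
Proof.
move=> k0 kq q0; have [xt|xt] := leP x (t + q).
  by rewrite (le_trans (logistic_le1 _ _ _))// lerDl ltW.
rewrite add0r (le_trans _ kq)// expRN /logistic lef_pV2 ?posrE ?addr_gt0 ?expR_gt0//.
rewrite (@le_trans _ _ (expR (k * (x - t))))// ?lerDr// ler_expR ler_pM2l//.
by rewrite lerBrDl ltW.
Qed.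

(** To the left of [t - q] the denominator of the logistic function is at most [1 + q], so the error
    takes the form of a factor. *)
Lemma step_le_logistic k t q x : 0 < k -> expR (- (k * q)) <= q -> 0 < q ->
  (x <= t - q)%R%:R <= (1 + q) * logistic k t x.
Proof.
move=> k0 kq q0; have [xt|xt] := leP x (t - q); last first.
  by rewrite mulr_ge0 ?(ltW (logistic_gt0 _ _ _))// addr_ge0// ltW.
rewrite /logistic ler_pdivlMr ?addr_gt0 ?expR_gt0// mul1r lerD2l.
apply: le_trans kq; rewrite ler_expR -mulrN ler_pM2l//.
by rewrite lerBlDl.
Qed.

Lemma exists_sharp q : 0 < q -> exists2 k, 0 < k & expR (- (k * q)) <= q.
Proof.
(* With this slope the exponent [k * q] is [q^-1], and [expR q^-1 >= q^-1]. *)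
move=> q0; exists (q ^- 2); first by rewrite invr_gt0 exprn_gt0.
rewrite expRN -[leRHS]invrK lef_pV2 ?posrE ?expR_gt0 ?invr_gt0//.
have -> : q ^- 2 * q = q^-1 by field; rewrite gt_eqF.
by rewrite (le_trans _ (expR_ge1Dx _))// lerDr.
Qed.

Definition gauss_mean (h : R -> R) : R := \int[mu]_x (h x * phi x).

Lemma integrable_logistic_phi k t :
  mu.-integrable setT (EFin \o (fun x => logistic k t x * phi x)).
Proof.
apply: integrable_bounded_phi => //; first exact: measurable_logistic.
by move=> x; rewrite ger0_norm ?logistic_le1// ltW// logistic_gt0.
Qed.

Lemma gauss_step t q :
  mu.-integrable setT (EFin \o (fun x => ((x <= t)%R%:R + q) * phi x)) /\
  \int[mu]_x (((x <= t)%R%:R + q) * phi x) =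
  fine (normal_prob (0 : R) 1 `]-oo, t]) + q.
Proof.
have i1 : mu.-integrable setT (EFin \o (fun x => (x <= t)%R%:R * phi x)).
  apply: integrable_bounded_phi => //; last first.
    by move=> x; rewrite ger0_norm// lern1 leq_b1.
  rewrite (_ : (fun x => _) = \1_(`]-oo, t]%classic)) //.
  by apply/funext => x; rewrite indicE mem_setE in_itv.
have i2 : mu.-integrable setT (EFin \o (fun x => q * phi x)).
  have := integrableZl measurableT q (integrable_phi (R := R) measurableT).
  exact.
have E x : ((x <= t)%R%:R + q) * phi x = (x <= t)%R%:R * phi x + q * phi x.
  by rewrite mulrDl.
split; first by rewrite (eq_fun E); exact: (integrableD measurableT i1 i2).
rewrite (eq_fun E) RintegralD// RintegralZl//; last exact: integrable_phi.
rewrite Rintegral_phi mulr1; congr (_ + _).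
rewrite normal_prob_Rintegral//= [RHS]Rintegral_mkcond.
apply: eq_Rintegral => x _; rewrite patchE mem_setE in_itv/=.
by case: ifP; rewrite ?mul1r ?mul0r.
Qed.

Lemma gauss_mean_logistic_le k t q : 0 < k -> expR (- (k * q)) <= q -> 0 < q ->
  gauss_mean (logistic k t) <= fine (normal_prob (0 : R) 1 `]-oo, t + q]) + q.
Proof.
move=> k0 kq q0; have [i <-] := gauss_step (t + q) q.
apply: le_Rintegral => //; first exact: integrable_logistic_phi.
move=> x _; rewrite ler_wpM2r ?normal_pdf_ge0//.
exact: logistic_le_step.
Qed.

Lemma gauss_mean_logistic_ge k t q : 0 < k -> expR (- (k * q)) <= q -> 0 < q ->
  fine (normal_prob (0 : R) 1 `]-oo, t - q]) <=
  (1 + q) * gauss_mean (logistic k t).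
Proof.
move=> k0 kq q0; have [+ +] := gauss_step (t - q) 0; rewrite addr0 => i <-.
rewrite /gauss_mean -RintegralZl//; last exact: integrable_logistic_phi.
apply: le_Rintegral => //.
  have := integrableZl measurableT (1 + q) (integrable_logistic_phi k t).
  exact.
move=> x _; rewrite addr0 mulrA ler_wpM2r ?normal_pdf_ge0//.
exact: step_le_logistic.
Qed.

Section cdf.
Context (d : measure_display) (T : measurableType d) (P : probability T R).
Context (X : {RV P >-> R}).

Let integrable_logistic k t :
  P.-integrable setT (EFin \o (fun w => logistic k t (X w))).
Proof.
apply: (@bounded_prob_integrable _ _ _ _ _ 1).
  by apply: measurableT_comp => //; exact: measurable_logistic.
by move=> w; rewrite ger0_norm ?logistic_le1// ltW// logistic_gt0.
Qed.

Let integrable_step t q :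
  P.-integrable setT (EFin \o (fun w => (X w <= t)%R%:R + q)).
Proof.
apply: (@bounded_prob_integrable _ _ _ _ _ (1 + `|q|)).
  apply: measurable_funD => //.
  have mX : measurable (X @^-1` `]-oo, t]).
    by rewrite -[X in measurable X]setTI; exact: measurable_funP.
  have -> : (fun w : T => (X w <= t)%R%:R : R) = \1_(X @^-1` `]-oo, t]) :> (T -> R).
    apply/funext => w; rewrite indicE; congr (nat_of_bool _)%:R.
    by apply/idP/idP; rewrite ?inE/= ?in_itv.
  exact: measurable_indic.
move=> w; rewrite (le_trans (ler_normD _ _))// lerD2r.
by rewrite ger0_norm// lern1 leq_b1.
Qed.

Let Rintegral_step t q :
  \int[P]_w ((X w <= t)%R%:R + q) = fine (cdf X t) + q.
Proof.
have i1 := integrable_step t 0; have i2 := integrable_step t q.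
have mX : measurable (X @^-1` `]-oo, t]).
  by rewrite -[X in measurable X]setTI; exact: measurable_funP.
rewrite RintegralD//; last 2 first.
- by move: i1; under eq_fun do rewrite addr0.
- apply: (@bounded_prob_integrable _ _ _ _ _ `|q|) => //.
rewrite Rintegral_prob_cst; congr (_ + _).
rewrite /cdf /distribution /pushforward -Rintegral_prob_indic//.
apply: eq_Rintegral => w _; rewrite indicE; congr (nat_of_bool _)%:R.
by apply/idP/idP; rewrite ?inE/= ?in_itv.
Qed.

Lemma cdf_le_logistic k t q : 0 < k -> expR (- (k * q)) <= q -> 0 < q ->
  fine (cdf X (t - q)) <= (1 + q) * \int[P]_w logistic k t (X w).
Proof.
move=> k0 kq q0; rewrite -[leLHS]addr0 -Rintegral_step -RintegralZl//.
apply: le_Rintegral => //.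
  have := integrableZl measurableT (1 + q) (integrable_logistic k t).
  exact.
by move=> w _; rewrite addr0; exact: step_le_logistic.
Qed.

Lemma logistic_le_cdf k t q : 0 < k -> expR (- (k * q)) <= q -> 0 < q ->
  \int[P]_w logistic k t (X w) <= fine (cdf X (t + q)) + q.
Proof.
move=> k0 kq q0; rewrite -Rintegral_step; apply: le_Rintegral => //.
by move=> w _; exact: logistic_le_step.
Qed.

End cdf.

(** The upper bound on the distribution function at [x] uses the logistic function centred at
    [x + q], whose normal mean exceeds [F (x + 2 * q)] by at most [q]; the lower bound uses the one
    at [x - q] in the same way. Continuity of [F] at [x] closes the gap. *)
Lemma cvg_logistic_cvg_in_distribution (d : nat -> measure_display)
    (T : forall n, measurableType (d n)) (P : forall n, probability (T n) R)
    (X : forall n, {RV (P n) >-> R}) :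
  (forall k t, 0 < k -> \int[P n]_w logistic k t (X n w) @[n --> \oo] -->
    gauss_mean (logistic k t)) ->
  cvg_in_distribution X (normal_prob 0 1).
Proof.
move=> Xh x xc; pose F y : R := fine (normal_prob (0 : R) 1 `]-oo, y]).
have Ffin y : normal_prob (0 : R) 1 `]-oo, y] = (F y)%:E.
  by rewrite /F fineK// fin_num_measure.
have Fc : F y @[y --> x] --> F x.
  have xcF : (normal_prob (0 : R) 1 `]-oo, y]) @[y --> x] --> (F x)%:E.
    by rewrite -Ffin; exact: xc.
  exact: fine_cvg xcF.
suff : cdf (X n) x @[n --> \oo] --> (F x)%:E by rewrite -Ffin.
apply/fine_cvgP; split.
  by apply: nearW => n; rewrite fin_num_measure.
apply/cvgrPdist_le => e e0.
have [r /= r0 Fr] : exists2 r : R, 0 < r & forall y, `|x - y| <= r -> `|F x - F y| <= e / 4.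
  move/cvgrPdist_le : Fc => /(_ (e / 4)); rewrite divr_gt0// => /(_ isT).
  move=> [r /= r0 rF]; exists (r / 2); first by rewrite divr_gt0.
  move=> y xy; apply: rF => /=; rewrite (le_lt_trans xy)// ltr_pdivrMr//.
  by rewrite ltr_pMr// ltr1n.
(* [q <= r / 2] keeps [x - 2 * q] and [x + 2 * q] where [F] moves by at most [e / 4]; [q <= e / 16]
   and [q <= 1] make the factors [1 + q] and the additive errors [q] cost less than [e / 2]. *)
pose q := Num.min (r / 2) (Num.min (e / 16) 1).
have q0 : 0 < q by rewrite !lt_min !divr_gt0// ltr01.
have qr : q + q <= r.
  suff : q <= r / 2 by move: (q) (r) => a b; lra.
  by rewrite ge_min lexx.
have qe : q <= e / 16 by rewrite !ge_min lexx orbT.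
have q1 : q <= 1 by rewrite !ge_min lexx !orbT.
have [k k0 kq] := exists_sharp q0.
have F01 y : 0 <= F y <= 1.
  by rewrite fine_ge0//= -lee_fin -Ffin probability_le1.
have up := gauss_mean_logistic_le (x + q) k0 kq q0.
have lo := gauss_mean_logistic_ge (x - q) k0 kq q0.
have /cvgrPdist_le/(_ q q0) Hup := Xh k (x + q) k0.
have /cvgrPdist_le/(_ q q0) Hlo := Xh k (x - q) k0.
apply: filterS2 Hup Hlo => n hup hlo.
have cup := cdf_le_logistic (X n) (x + q) k0 kq q0.
have clo := logistic_le_cdf (X n) (x - q) k0 kq q0.
have F1 : `|F x - F (x + q + q)| <= e / 4.
  apply: Fr; rewrite (_ : x - _ = - (q + q)); last by ring.
  by rewrite normrN ger0_norm ?addr_ge0 ?(ltW q0).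
have F2 : `|F x - F (x - q - q)| <= e / 4.
  apply: Fr; rewrite (_ : x - _ = q + q); last by ring.
  by rewrite ger0_norm ?addr_ge0 ?(ltW q0).
rewrite addrK in cup; rewrite subrK in clo.
move: up lo hup hlo F1 F2; rewrite -/(F (x + q + q)) -/(F (x - q - q)) !ler_norml /=.
have := F01 (x + q + q); have := F01 (x - q - q).
set A := gauss_mean _; set B := gauss_mean _.
set a := \int[_]_w _ in cup *; set b := \int[_]_w _ in clo *.
move: cup clo; rewrite -/a -/b.
move: (F (x + q + q)) (F (x - q - q)) (F x) => f1 f2 f0.
set c := fine _.
move=> c1 c2 /andP[? ?] /andP[? ?] h1 h2 /andP[? ?] /andP[? ?] /andP[? ?] /andP[? ?].
apply/andP; split; nra.
Qed.

End logistic_test_functions.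

(** * Discretization of exponential weights *)

Section exponential_tails.
Context (R : realType).
Local Notation mu := lebesgue_measure.

Lemma exponential_prob_itvcy (r x : R) : 0 < r -> 0 <= x ->
  exponential_prob r `[x, +oo[ = (expR (- r * x))%:E.
Proof.
move=> r0 x0; rewrite /exponential_prob.
have cexp : continuous (fun z : R => expR (- r * z)).
  move=> z; apply: continuous_comp; last exact: continuous_expR.
  by apply: continuousM => //; exact: cst_continuous.
rewrite (@ge0_continuous_FTC2y _ _ (fun z => - (expR (- r * z))) _ 0).
- by rewrite EFinN oppeK add0e.
- by move=> z _; apply: exponential_pdf_ge0; exact: ltW.
- apply: (@continuous_subspaceW R^o _ _ [set` `[0, +oo[%R]).
    by move=> z /=; rewrite !in_itv/= !andbT; exact: le_trans.
  exact: within_continuous_exponential_pdf.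
- rewrite -oppr0; apply: cvgN.
  rewrite (_ : (fun z => expR (- r * z)) =
               (fun z => expR (- z)) \o (fun z => r * z)); last first.
    by apply: eq_fun => z; rewrite mulNr.
  apply: (@cvg_comp _ _ _ _ _ _ (pinfty_nbhs R)); last exact: cvgr_expR.
  exact: gt0_cvgMry.
- by move=> z _; exact: ex_derive.
- by apply: cvgN; apply/cvg_at_right_filter; exact: cexp.
- move=> z; rewrite in_itv/= andbT => xz; apply: derive1_exponential_pdf.
  by rewrite in_itv/= andbT (le_lt_trans x0).
Qed.

Lemma within_continuous_inv_sqr :
  {within `[0%R, +oo[, continuous (fun x : R => 4 / (1 + x) ^+ 2)}.
Proof.
apply: continuous_in_subspaceT => z; rewrite inE/= in_itv/= andbT => z0.
have cinv : (1 + y)^-1 @[y --> z] --> (1 + z)^-1.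
  apply: cvgV; first by rewrite gt_eqF// ltr_wpDr.
  by apply: cvgD; [exact: cvg_cst|exact: cvg_id].
rewrite (_ : (fun y => _) = (fun y : R => 4 * ((1 + y)^-1 * (1 + y)^-1))).
  by apply: cvgM; [exact: cvg_cst|exact: cvgM].
by apply/funext => y; rewrite expr2 invfM.
Qed.

(** The integrand dominates the tail of [expR (X / (2 * n))] for an exponential [X] of mean [n]:
    that tail is 1 up to 1 and [x ^- 2] beyond. *)
Lemma ge0_integral_inv_sqr :
  (\int[mu]_(x in `[0%R, +oo[) (4 / (1 + x) ^+ 2)%:E = (4 : R)%:E)%E.
Proof.
have dinv (z : R) : 0 <= z -> is_derive z 1 (fun y => - 4 * (1 + y)^-1) (4 / (1 + z) ^+ 2).
  move=> z0; have p0 : 1 + z != 0 by rewrite gt_eqF// ltr_wpDr.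
  have d1 : is_derive z 1 (fun y : R => 1 + y) 1.
    have -> : (fun y : R => 1 + y) = cst 1 + @id R by [].
    by apply: is_derive_eq; rewrite add0r.
  have d2 := @is_deriveV R (fun y => 1 + y) z _ 1 p0 d1.
  have -> : (fun y : R => - 4 * (1 + y)^-1) = (- 4 : R) \*: (fun y => (1 + y)^-1) by [].
  by apply: is_derive_eq; rewrite /GRing.scale/=; field.
have cinv (z : R) : 0 <= z -> (1 + y)^-1 @[y --> z] --> (1 + z)^-1.
  move=> z0; apply: cvgV; first by rewrite gt_eqF// ltr_wpDr.
  by apply: cvgD; [exact: cvg_cst|exact: cvg_id].
rewrite (@ge0_continuous_FTC2y _ _ (fun y => - 4 * (1 + y)^-1) _ 0).
- by rewrite -EFinB addr0 invr1 mulr1 sub0r opprK.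
- by move=> z _; rewrite divr_ge0 ?sqr_ge0.
- exact: within_continuous_inv_sqr.
- rewrite -(mulr0 (- 4)); apply: cvgM; first exact: cvg_cst.
  apply/gtr0_cvgV0; last exact: cvg_addrl.
  by near=> y; rewrite addr_gt0//; near: y; exact: nbhs_pinfty_gt.
- by move=> z z0; have ? := dinv z (ltW z0); exact: ex_derive.
- apply/cvg_at_right_filter; apply: cvgM; first exact: cvg_cst.
  exact: cinv.
- move=> z; rewrite in_itv/= andbT => z0; have ? := dinv z (ltW z0).
  by rewrite derive1E derive_val.
Unshelve. all: by end_near. Qed.

End exponential_tails.

Section exponential_variable.
Context (R : realType) (d : measure_display) (T : measurableType d).
Context (P : probability T R) (X : {RV P >-> R}) (n : R).
Hypotheses (n_gt0 : 0 < n) (X_exp : exponential_with_mean n X).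
Local Notation mu := lebesgue_measure.

Lemma exponential_ge (x : R) : 0 <= x ->
  P (X @^-1` `[x, +oo[) = (expR (- (x / n)))%:E.
Proof.
move=> x0; rewrite -mulNr -(mulrC n^-1) mulrN -mulNr.
rewrite -exponential_prob_itvcy ?invr_gt0//.
exact: X_exp (measurable_itv _).
Qed.

Lemma exponential_ae_ge0 : {ae P, forall t, 0 <= X t}.
Proof.
exists (X @^-1` `]-oo, 0[); split.
- by rewrite -[X in measurable X]setTI; exact: measurable_funP.
- transitivity (exponential_prob n^-1 `]-oo, 0[).
    exact: X_exp (measurable_itv _).
  rewrite /exponential_prob integral0_eq// => x /=; rewrite in_itv/= => x0.
  by rewrite lt0_exponential_pdf.
- by move=> t /=; rewrite in_itv/= => /negP; rewrite -ltNge.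
Qed.

Lemma exponential_laplace :
  (\int[P]_t (expR (X t / (2 * n)))%:E <= (4 : R)%:E)%E.
Proof.
have mY : measurable_fun setT (fun t => expR (X t / (2 * n))).
  by apply: measurableT_comp => //; exact: measurable_funM.
pose Yf := mfun_Sub (mem_set mY : _ \in mfun).
pose Y : {RV P >-> R} := Yf.
have := @ge0_expectation_ccdf _ _ _ P Y (fun t => expR_ge0 _).
rewrite expectation_def => ->.
rewrite -ge0_integral_inv_sqr; apply: ge0_le_integral => //=.
- by apply: measurable_funTS; exact: ccdf_measurable.
- apply/measurable_EFinP; apply: subspace_continuous_measurable_fun => //.
  exact: within_continuous_inv_sqr.
- move=> x; rewrite in_itv/= andbT => x0.
  have p0 : 0 < (1 + x) ^+ 2 by rewrite exprn_gt0// ltr_wpDr.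
  have [x1|x1] := leP 1 x; last first.
    rewrite (le_trans (probability_le1 _ _))// lee_fin ler_pdivlMr// mul1r.
    nra.
  have xp : 0 < x by rewrite (lt_le_trans _ x1).
  rewrite (@le_trans _ _ (P (X @^-1` `[2 * n * ln x, +oo[)))//.
    rewrite /ccdf /distribution /pushforward; apply: le_measure.
    - by rewrite inE; apply: measurable_funPTI.
    - by rewrite inE; apply: measurable_funPTI.
    - move=> t /=; rewrite !in_itv/= !andbT => xY.
      rewrite mulrC -ler_pdivlMr ?mulr_gt0// -ler_expR lnK// ltW//.
  rewrite exponential_ge; last by rewrite !mulr_ge0 ?ln_ge0// ltW.
  rewrite lee_fin (_ : 2 * n * ln x / n = ln x + ln x); last first.
    by field; rewrite gt_eqF.
  rewrite expRN expRD lnK// -expr2 ler_pdivlMr// mulrC ler_pdivrMr ?exprn_gt0//.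
  nra.
Qed.

(** For [y = X / (8 * n)] the inequality [y <= expR y] gives [X ^+ 4 <= (8 * n) ^+ 4 * expR (X / (2
    * n))]; here [8 ^+ 4 = 4 ^+ 6], and the seventh factor 4 is the bound of
    [exponential_laplace]. *)
Lemma exponential_fourth_moment :
  (\int[P]_t (X t ^+ 4)%:E <= (4 ^+ 7 * n ^+ 4)%:E)%E.
Proof.
have mX4 : measurable_fun setT (fun t => X t ^+ 4) by exact: measurable_funX.
have mY : measurable_fun setT (fun t => expR (X t / (2 * n))).
  by apply: measurableT_comp => //; exact: measurable_funM.
have -> : (4 ^+ 7 * n ^+ 4)%:E = ((4 ^+ 6 * n ^+ 4)%:E * (4 : R)%:E)%E.
  by rewrite -EFinM; congr EFin; ring.
have c0 : 0 <= 4 ^+ 6 * n ^+ 4 by rewrite mulr_ge0 ?exprn_ge0 ?ler0n ?(ltW n_gt0).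
apply: le_trans (lee_wpmul2l _ exponential_laplace); last by rewrite lee_fin.
rewrite -ge0_integralZl//=; last exact/measurable_EFinP.
apply: ae_ge0_le_integral => //.
- by move=> t _; rewrite lee_fin exprn_even_ge0.
- exact/measurable_EFinP.
- by move=> t _; rewrite -EFinM lee_fin mulr_ge0 ?expR_ge0.
- by apply/measurable_EFinP; exact: measurable_funM.
apply: filterS exponential_ae_ge0 => t X0 _; rewrite -EFinM lee_fin.
set y := X t / (2 * n) / 4.
have y0 : 0 <= y by rewrite !divr_ge0 ?mulr_ge0// ltW.
have -> : expR (X t / (2 * n)) = expR y ^+ 4.
  by rewrite -expRM_natl; congr expR; rewrite /y; field; rewrite gt_eqF.
have -> : X t ^+ 4 = 4 ^+ 6 * n ^+ 4 * y ^+ 4.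
  by rewrite /y; field; rewrite gt_eqF.
rewrite ler_wpM2l// lerXn2r ?nnegrE ?expR_ge0//.
by rewrite (le_trans _ (expR_ge1Dx _))// lerDr.
Qed.

End exponential_variable.

Lemma Rintegral_finite (R : realType) (d : measure_display) (T : measurableType d)
    (P : probability T R) (V : finType) (c : T -> V) (g : V -> R) :
  (forall v, measurable (c @^-1` [set v])) ->
  P.-integrable setT (EFin \o (fun t => g (c t))) /\
  \int[P]_t g (c t) = \sum_v fine (P (c @^-1` [set v])) * g v.
Proof.
move=> mc.
pose f v t := g v * \1_(c @^-1` [set v]) t.
have gE : (fun t => g (c t)) = (fun t => \sum_v f v t).
  apply/funext => t; rewrite (bigD1 (c t))//= big1 ?addr0; last first.
    move=> v vc; rewrite /f indicE memNset ?mulr0//= => /esym/eqP.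
    by rewrite (negPf vc).
  by rewrite /f indicE mem_set ?mulr1.
have fi v : P.-integrable setT (EFin \o f v).
  apply: (@bounded_prob_integrable _ _ _ _ _ `|g v|).
    by apply: measurable_funM => //; exact: measurable_indic.
  by move=> t; rewrite /f normrM ler_piMr// indicE ger0_norm// lern1 leq_b1.
suff H (s : seq V) : P.-integrable setT (EFin \o (fun t => \sum_(v <- s) f v t)) /\
    \int[P]_t (\sum_(v <- s) f v t) =
    \sum_(v <- s) fine (P (c @^-1` [set v])) * g v.
  have [] := H (index_enum V).
  by rewrite -gE.
elim: s => [|v0 s [IHi IHe]].
  have -> : (fun t => \sum_(v <- [::]) f v t) = cst 0.
    by apply/funext => t; rewrite big_nil.
  rewrite big_nil Rintegral_prob_cst; split=> //.
  by apply: (@bounded_prob_integrable _ _ _ _ _ 0) => // t; rewrite normr0.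
have -> : (fun t => \sum_(u <- v0 :: s) f u t) =
    (fun t => f v0 t + \sum_(u <- s) f u t).
  by apply/funext => t; rewrite big_cons.
split; first exact: (integrableD measurableT (fi v0) IHi).
rewrite RintegralD// IHe big_cons; congr (_ + _).
rewrite /f RintegralZl//; last first.
  apply: (@bounded_prob_integrable _ _ _ _ _ 1); first exact: measurable_indic.
  by move=> t; rewrite indicE ger0_norm// lern1 leq_b1.
by rewrite Rintegral_prob_indic// mulrC.
Qed.

Section cells.
Context (R : realType) (M : nat) (delta : R).
Hypothesis delta_gt0 : 0 < delta.

(** Rounding down to the mesh, capped at [M]: the last cell collects all values from [delta * M] on
    and plays the part of [top]. *)
Definition cell (y : R) : 'I_M.+1 := inord (minn M (Num.truncn (y / delta))).

Lemma cell_gt (y : R) (j : nat) : (j < M)%N ->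
  (j < cell y)%N = (delta * j.+1%:R <= y).
Proof.
move=> jM; rewrite /cell inordK ?ltnS ?geq_minl// leq_min jM/=.
by rewrite truncn_gt_nat ler_pdivlMr// mulrC.
Qed.

Lemma measurable_cell_gt (j : nat) :
  measurable [set y : R | (j < cell y)%N].
Proof.
have [jM|Mj] := ltnP j M.
  rewrite (_ : [set _ | _] = `[delta * j.+1%:R, +oo[%classic) //.
  by apply/seteqP; split=> y /=; rewrite in_itv/= andbT cell_gt.
rewrite (_ : [set _ | _] = set0) //.
rewrite -subset0 => y /=; rewrite ltnNge => /negP; apply.
by rewrite (leq_trans _ Mj)// -ltnS ltn_ord.
Qed.

Lemma measurable_cell (v : 'I_M.+1) : measurable (cell @^-1` [set v]).
Proof.
have mge (j : nat) : measurable [set y : R | (j <= cell y)%N].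
  case: j => [|j]; last exact: measurable_cell_gt.
  by rewrite (_ : [set _ | _] = setT)//; apply/seteqP.
rewrite (_ : _ @^-1` _ = [set y | (v <= cell y)%N] `\` [set y | (v < cell y)%N]).
  by apply: measurableD => //; exact: measurable_cell_gt.
apply/seteqP; split=> y /=; first by move=> ->; rewrite leqnn ltnn.
by move=> [vy /negP]; rewrite -leqNgt => yv; apply/val_inj/eqP; rewrite eqn_leq yv.
Qed.

End cells.

Section law_of_cells.
Context (R : realType) (d : measure_display) (T : measurableType d).
Context (P : probability T R) (I : finType) (w : I -> {RV P >-> R}).
Context (n delta : R) (M : nat).
Hypotheses (n_gt0 : 0 < n) (delta_gt0 : 0 < delta).
Hypothesis w_indep : mutually_independent w.
Hypothesis w_exp : forall i, exponential_with_mean n (w i).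

Definition cellp (v : 'I_M.+1) : R :=
  fine (exponential_prob n^-1 (cell M delta @^-1` [set v])).

Definition cells (t : T) : {ffun I -> 'I_M.+1} := [ffun i => cell M delta (w i t)].

Lemma cellpE i v : P (w i @^-1` (cell M delta @^-1` [set v])) = (cellp v)%:E.
Proof.
have mc := measurable_cell delta_gt0 v.
rewrite /cellp -(w_exp i mc) fineK//.
exact: fin_num_measure mc.
Qed.

Lemma measurable_cells x : measurable (cells @^-1` [set x]).
Proof.
rewrite (_ : _ @^-1` _ = \bigcap_(i in [set` [set: I]%SET])
    (w i @^-1` (cell M delta @^-1` [set x i]))).
  apply: fin_bigcap_measurable => [|i _]; first exact: finite_finpred.
  by apply: measurable_funPTI; exact: measurable_cell.
apply/seteqP; split=> t /=.
  by move=> <- i _ /=; rewrite ffunE.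
move=> H; apply/ffunP => i; rewrite ffunE; apply: H.
by rewrite /= inE.
Qed.

Lemma law_cells x : fine (P (cells @^-1` [set x])) = \prod_i cellp (x i).
Proof.
have -> : cells @^-1` [set x] = \bigcap_(i in [set` [set: I]%SET])
    (w i @^-1` (cell M delta @^-1` [set x i])).
  apply/seteqP; split=> t /=.
    by move=> <- i _ /=; rewrite ffunE.
  move=> H; apply/ffunP => i; rewrite ffunE; apply: H.
  by rewrite /= inE.
rewrite w_indep; last by move=> i _; exact: measurable_cell.
rewrite (eq_bigr (fun i => (cellp (x i))%:E)); last by move=> i _; exact: cellpE.
by rewrite prodEFin /=; apply: eq_bigl => i; rewrite inE.
Qed.

(** The bridge to the finite product space: the independence of the weights enters through
    [law_cells] and is used in this form from here on. *)
Lemma Rintegral_cells (g : {ffun I -> 'I_M.+1} -> R) :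
  P.-integrable setT (EFin \o (fun t => g (cells t))) /\
  \int[P]_t g (cells t) = Ex cellp g.
Proof.
have [gi ->] := Rintegral_finite P g measurable_cells; split=> //.
by apply: eq_bigr => x _; rewrite law_cells.
Qed.

Lemma cellp_ge0 v : 0 <= cellp v.
Proof.
by apply: fine_ge0; apply: integral_ge0 => x _;
  rewrite lee_fin exponential_pdf_ge0// invr_ge0 ltW.
Qed.

(** For [j > 0] the rounded weight reaches [j] exactly when the weight reaches [delta * j], so the
    exponential tail becomes a geometric one without loss. The law is read off from the weight
    [w i]. *)
Lemma cellp_tail (i : I) (j : nat) : (j <= M)%N ->
  \sum_(v : 'I_M.+1 | (j <= v)%N) cellp v = expR (- (delta / n)) ^+ j.
Proof.
move=> jM.
have mci v : measurable ((fun t => cell M delta (w i t)) @^-1` [set v]).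
  exact: (measurable_funPTI (w i) (measurable_cell delta_gt0 v)).
pose g (v : 'I_M.+1) : R := (j <= v)%N%:R.
have [_ E] := Rintegral_finite P g mci.
transitivity (\int[P]_t g (cell M delta (w i t))).
  rewrite E big_mkcond; apply: eq_bigr => v _; rewrite /g.
  rewrite (_ : P _ = (cellp v)%:E); last exact: cellpE.
  by case: ifP => _; rewrite ?mulr1 ?mulr0.
case: j jM @g E => [|j] jM g _.
  by rewrite expr0 /g; under eq_fun do rewrite leq0n; exact: Rintegral_prob_cst.
have mA : measurable (w i @^-1` `[delta * j.+1%:R, +oo[).
  by apply: measurable_funPTI.
have -> : (fun t => g (cell M delta (w i t))) = \1_(w i @^-1` `[delta * j.+1%:R, +oo[).
  apply/funext => t; rewrite /g cell_gt// indicE; congr (nat_of_bool _)%:R.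
  by apply/idP/idP; rewrite inE/= in_itv/= andbT.
rewrite Rintegral_prob_indic// (exponential_ge n_gt0 (w_exp i))//; last by rewrite mulr_ge0// ltW.
rewrite /= -expRM_natl; congr expR; ring.
Qed.

End law_of_cells.

(** * Mean square error of truncation and rounding *)

Section discretization_error.
Context (R : realType) (disp : measure_display) (T : measurableType disp).
Context (P : probability T R) (n d : nat) (w : ksubset n d.+1 -> {RV P >-> R}).
Context (a delta : R) (M : nat).
Hypotheses (a_gt0 : 0 < a) (delta_gt0 : 0 < delta).
Hypothesis w_indep : mutually_independent w.
Hypothesis w_exp : forall i, exponential_with_mean a (w i).
Local Notation I := (ksubset n d.+1).
Local Notation J := (ksubset n d).

Definition incident (s : J) (i : I) : bool := val s \subset val i.

Context (m : nat).
Hypothesis inc_m : forall s, #|[pred i | incident s i]| = m.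
Hypothesis m_gt0 : (0 < m)%N.

Local Notation vl := (fun v : 'I_M.+2 => delta * v%:R).
Local Notation X := (rmin incident vl (delta * M.+1%:R)).
Local Notation cells := (cells w delta M.+1).
Local Notation alpha := (expR (- (delta / a))).

Lemma cell_le (y : R) : 0 <= y -> delta * (cell M.+1 delta y)%:R <= y.
Proof.
move=> y0; case E : (cell M.+1 delta y : nat) => [|j]; first by rewrite mulr0.
rewrite -(cell_gt (M := M.+1)) ?E// -ltnS -E; exact: ltn_ord.
Qed.

Lemma cell_lt (y : R) : (cell M.+1 delta y < M.+1)%N ->
  y < delta * (cell M.+1 delta y)%:R + delta.
Proof.
move=> cM; have := cell_gt delta_gt0 y cM; rewrite ltnn => /esym/negbT.
by rewrite -ltNge -natr1 mulrDr mulr1.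
Qed.

Lemma has_coface s : exists i, incident s i.
Proof.
have : (0 < #|[pred i | incident s i]|)%N by rewrite inc_m.
by move=> /card_gt0P[i]; rewrite inE => si; exists i.
Qed.

Lemma nearest_face_weightP s t :
  (forall i, incident s i -> nearest_face_weight w s t <= w i t) /\
  exists2 i, incident s i & nearest_face_weight w s t = w i t.
Proof.
have [i0 si0] := has_coface s.
have [i1 si1 E] := @eq_bigmin _ (\bar R) I +oo%E i0 (incident s)
  (fun i => (w i t)%:E) si0 (fun i _ => leey _).
have NE : nearest_face_weight w s t = fine (w i1 t)%:E by rewrite -E.
split; last by exists i1.
move=> i si; rewrite NE -lee_fin -E.
exact: (@bigmin_le_cond _ (\bar R) I +oo%E i (incident s) (fun i => (w i t)%:E)).
Qed.

Lemma rminP s x : (forall i, incident s i -> X s x <= delta * (x i)%:R) /\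
  exists2 i, incident s i & X s x = delta * (x i)%:R.
Proof.
have [i0 si0] := has_coface s.
have bnd i : incident s i -> delta * (x i)%:R <= delta * M.+1%:R.
  by move=> _; rewrite ler_pM2l// ler_nat -ltnS ltn_ord.
have [i1 si1 E] := @eq_bigmin _ R I (delta * M.+1%:R) i0 (incident s)
  (fun i => delta * (x i)%:R) si0 bnd.
split; last by exists i1.
move=> i si.
exact: (@bigmin_le_cond _ R I _ i (incident s) (fun i => delta * (x i)%:R)).
Qed.

(** If the smallest rounded weight is below the cap, the error is that of rounding, less than
    [delta]. Otherwise all weights above [s] reach the cutoff, the indicator [above] is 1, and the
    error is at most the minimum itself, hence at most the weight of any chosen coface [i0]. *)
Lemma discretization_sqr s i0 t : (forall i, 0 <= w i t) -> incident s i0 ->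
  (nearest_face_weight w s t - X s (cells t)) ^+ 2 <=
  delta ^+ 2 + w i0 t ^+ 2 * above R incident s M (cells t).
Proof.
move=> w0 si0.
have [Nle [i1 si1 N1]] := nearest_face_weightP s t.
have [Xle [i3 si3 X3]] := rminP s (cells t).
have NX : X s (cells t) <= nearest_face_weight w s t.
  rewrite N1 (le_trans (Xle _ si1))// ffunE; exact: cell_le.
have ab0 : 0 <= above R incident s M (cells t) by apply: prodr_ge0.
have [cM|cM] := ltnP (cells t i3) M.+1.
  rewrite -[leLHS]addr0 lerD ?mulr_ge0 ?sqr_ge0//.
  rewrite lerXn2r ?nnegrE ?subr_ge0 ?(ltW delta_gt0)//.
  rewrite lerBlDl (le_trans (Nle _ si3))// X3 ltW//.
  by rewrite ffunE in cM *; exact: cell_lt.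
have c3 : cells t i3 = M.+1 :> nat.
  by apply/eqP; rewrite eqn_leq cM andbT -ltnS ltn_ord.
have -> : above R incident s M (cells t) = 1.
  rewrite /above big1// => i _; case: (boolP (incident s i)) => //= si.
  have := Xle _ si; rewrite X3 ler_pM2l// ler_nat c3 => cMi.
  by rewrite cMi.
rewrite mulr1 -[leLHS]add0r lerD ?sqr_ge0// lerXn2r ?nnegrE ?subr_ge0 ?w0//.
rewrite lerBlDr (le_trans (Nle _ si0))// lerDl X3 mulr_ge0// ltW//.
Qed.

Lemma prob_above s : \int[P]_t above R incident s M (cells t) =
  (alpha ^+ m) ^+ M.+1.
Proof.
have [i0 _] := has_coface s.
have [_ ->] := Rintegral_cells delta_gt0 w_indep w_exp
  (above R incident s M : {ffun I -> 'I_M.+2} -> R).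
exact: (Ex_above (cellp_tail a_gt0 delta_gt0 w_exp i0) inc_m s ord_max).
Qed.

(** Cauchy-Schwarz over the d-sets reduces this to one minimum. On the rare event [above] the
    squared weight is unbounded, so it is separated from the indicator: the price is [eps] times a
    fourth moment and the probability of the event divided by [eps]. *)
Lemma discretization_error (eps : R) : 0 < eps ->
  (\int[P]_t ((total_nearest_face_weight w t -
     rtotal incident vl (delta * M.+1%:R) (cells t)) ^+ 2)%:E <=
  (#|J|%:R ^+ 2 * (delta ^+ 2 +
     (eps * (4 ^+ 7 * a ^+ 4) + (alpha ^+ m) ^+ M.+1 / eps) / 2))%:E)%E.
Proof.
move=> eps0.
have i0P s : {i | incident s i} by apply: cid; exact: has_coface.
pose i0 s := projT1 (i0P s).
have si0 s : incident s (i0 s) := projT2 (i0P s).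
pose ab s t : R := above R incident s M (cells t).
have ab0 s t : 0 <= ab s t by apply: prodr_ge0.
have mab s : measurable_fun setT (ab s).
  have [/integrableP[] /measurable_EFinP + _ _] := Rintegral_cells delta_gt0 w_indep w_exp
    (above R incident s M : {ffun I -> 'I_M.+2} -> R).
  exact.
have e2 : 0 <= eps / 2 by rewrite divr_ge0// ltW.
have e3 : 0 <= (2 * eps)^-1 by rewrite invr_ge0 mulr_ge0// ltW.
pose g s t : \bar R := ((delta ^+ 2)%:E + ((eps / 2)%:E * (w (i0 s) t ^+ 4)%:E +
   (2 * eps)^-1%:E * (ab s t)%:E))%E.
have g0 s t : (0 <= g s t)%E.
  rewrite /g -!EFinM -!EFinD lee_fin.
  by rewrite !addr_ge0 ?sqr_ge0// mulr_ge0// exprn_even_ge0.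
have m4 s : measurable_fun setT (fun t => (w (i0 s) t ^+ 4)%:E).
  by apply/measurable_EFinP; exact: measurable_funX.
have mabE s : measurable_fun setT (fun t => (ab s t)%:E).
  exact/measurable_EFinP.
have mg1 s : measurable_fun setT (fun t => (eps / 2)%:E * (w (i0 s) t ^+ 4)%:E)%E.
  by apply: measurable_funeM.
have mg2 s : measurable_fun setT (fun t => (2 * eps)^-1%:E * (ab s t)%:E)%E.
  by apply: measurable_funeM.
have mg s : measurable_fun setT (g s).
  by apply: emeasurable_funD => //; exact: emeasurable_funD.
have w40 s t : (0 <= (w (i0 s) t ^+ 4)%:E)%E.
  by rewrite lee_fin exprn_even_ge0.
have intg s : (\int[P]_t g s t <= (delta ^+ 2 +
     (eps * (4 ^+ 7 * a ^+ 4) + (alpha ^+ m) ^+ M.+1 / eps) / 2)%:E)%E.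
  rewrite ge0_integralD//=; last 3 first.
  - by move=> t _; rewrite lee_fin sqr_ge0.
  - by move=> t _; rewrite adde_ge0// mule_ge0// lee_fin.
  - exact: emeasurable_funD.
  rewrite integral_cst// [X in (_ * X)%E]probability_setT mule1.
  rewrite ge0_integralD//=; last 2 first.
  - by move=> t _; rewrite mule_ge0// lee_fin.
  - by move=> t _; rewrite mule_ge0// lee_fin.
  rewrite ge0_integralZl ?lee_fin//= ge0_integralZl ?lee_fin//=; last first.
    by move=> t _; rewrite lee_fin.
  rewrite EFinD leeD2l//.
  have -> : (\int[P]_t (ab s t)%:E = ((alpha ^+ m) ^+ M.+1)%:E)%E.
    rewrite -(prob_above s) /Rintegral fineK//.
    have [/integrable_fin_num + _] := Rintegral_cells delta_gt0 w_indep w_exp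
      (above R incident s M : {ffun I -> 'I_M.+2} -> R).
    exact.
  apply: (@le_trans _ _ ((eps / 2)%:E * (4 ^+ 7 * a ^+ 4)%:E +
     (2 * eps)^-1%:E * ((alpha ^+ m) ^+ M.+1)%:E)%E).
    by rewrite leeD2r// lee_wpmul2l ?lee_fin// exponential_fourth_moment.
  rewrite -!EFinM -EFinD lee_fin le_eqVlt; apply/orP; left; apply/eqP.
  by field; rewrite gt_eqF.
apply: (@le_trans _ _ (\int[P]_t (#|J|%:R%:E * \sum_(s : J) g s t))%E).
  apply: ae_ge0_le_integral => //.
  - by move=> t _; rewrite lee_fin sqr_ge0.
  - apply/measurable_EFinP/measurable_funX/measurable_funB => //.
    have [/integrableP[] /measurable_EFinP + _ _] :=
      Rintegral_cells delta_gt0 w_indep w_exp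
      (rtotal incident vl (delta * M.+1%:R) : {ffun I -> 'I_M.+2} -> R).
    exact.
  - by move=> t _; rewrite mule_ge0 ?lee_fin// sume_ge0.
  - by apply: measurable_funeM; exact: emeasurable_sum.
  have aew (r : seq I) : {ae P, forall t, forall i, i \in r -> 0 <= w i t}.
    elim: r => [|i r IH]; first exact: aeW.
    have := exponential_ae_ge0 (w_exp i).
    by apply: filterS2 IH => t H wi j; rewrite inE => /orP[/eqP->//|]; exact: H.
  apply: filterS (aew (index_enum I)) => t wt _.
  have w0 i : 0 <= w i t by apply: wt; exact: mem_index_enum.
  pose gr s : R := delta ^+ 2 + (eps / 2 * w (i0 s) t ^+ 4 + (2 * eps)^-1 * ab s t).
  have -> : (\sum_(s : J) g s t)%E = (\sum_(s : J) gr s)%:E.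
    by rewrite -sumEFin; apply: eq_bigr => s _; rewrite /g -!EFinM -!EFinD.
  rewrite -EFinM lee_fin /total_nearest_face_weight /rtotal -sumrB.
  rewrite (le_trans (sqr_sum_le xpredT _))// ler_wpM2l// ?ler0n//.
  apply: ler_sum => s _; rewrite (le_trans (discretization_sqr w0 (si0 s)))//.
  rewrite lerD2l -/(ab s t).
  have ab2 : ab s t ^+ 2 = ab s t.
    by rewrite /ab /above prod_nat_of_bool; case: [forall _, _]; rewrite ?expr0n ?expr1n.
  rewrite -[in X in _ <= _ + X]ab2.
  (* AM-GM *)
  have -> : eps / 2 * w (i0 s) t ^+ 4 + (2 * eps)^-1 * ab s t ^+ 2 =
      w (i0 s) t ^+ 2 * ab s t +
      (2 * eps)^-1 * (eps * w (i0 s) t ^+ 2 - ab s t) ^+ 2.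
    by field; rewrite gt_eqF.
  by rewrite lerDl mulr_ge0 ?sqr_ge0.
rewrite ge0_integralZl ?lee_fin ?ler0n//=; last 2 first.
- exact: emeasurable_sum.
- by move=> t _; rewrite sume_ge0.
rewrite ge0_integral_sum// expr2 -mulrA EFinM lee_wpmul2l ?lee_fin ?ler0n//.
rewrite (le_trans (lee_sum _ (fun s _ => intg s)))//.
by rewrite sumEFin sumr_const -[X in (X%:E <= _)%E]mulr_natl.
Qed.

End discretization_error.

(** * Incidences of the complete complex *)

Section incidence_counts.
Local Open Scope set_scope.
Context (n d : nat).
Local Notation I := (ksubset n d.+1).
Local Notation J := (ksubset n d).

Lemma card_ksubset k : #|ksubset n k| = 'C(n, k).
Proof. by rewrite card_sig -[in RHS](card_ord n) -card_draws cardsE. Qed.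

Lemma card_val_ksubset k (Q : pred {set 'I_n}) :
  #|[pred i : ksubset n k | Q (val i)]| =
  #|[set A : {set 'I_n} | (#|A| == k) && Q A]|.
Proof.
pose f (i : ksubset n k) : {set 'I_n} := val i.
rewrite -(@card_in_imset _ _ f); last by move=> i j _ _; exact: val_inj.
apply: eq_card => A; rewrite !inE; apply/imsetP/andP.
  by move=> [i]; rewrite inE => Qi ->; split; [exact: (valP i)|].
by move=> [Ak QA]; exists (Sub A Ak : ksubset n k); rewrite ?inE /f SubK.
Qed.

Lemma card_cofaces (s : J) : #|[pred i : I | incident s i]| = (n - d)%N.
Proof.
have sd : #|val s| = d by apply/eqP; exact: valP s.
rewrite (card_val_ksubset d.+1 (fun A => val s \subset A)).
have -> : [set A : {set 'I_n} | (#|A| == d.+1) && (val s \subset A)] =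
    [set x |: val s | x in ~: val s].
  apply/setP => A; rewrite !inE; apply/andP/imsetP.
    move=> [/eqP Ad sA].
    have /cards1P[x xE] : #|A :\: val s| == 1%N.
      by rewrite cardsD (finset.setIidPr sA) Ad sd subSnn.
    exists x; first by have := finset.set11 x; rewrite -xE !inE => /andP[].
    by rewrite -xE finset.setUC -{1}(finset.setID A (val s)) (finset.setIidPr sA).
  move=> [x]; rewrite inE => xs ->; split; last exact: finset.subsetUr.
  by rewrite cardsU1 xs sd.
rewrite card_in_imset; first by rewrite cardsCs finset.setCK card_ord sd.
move=> x y; rewrite !inE => xs ys E.
have : x \in y |: val s by rewrite -E finset.setU11.
by rewrite !inE (negPf xs) orbF => /eqP.
Qed.

Lemma card_faces (i : I) : #|[pred s : J | incident s i]| = d.+1.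
Proof.
have id : #|val i| = d.+1 by apply/eqP; exact: valP i.
rewrite (card_val_ksubset d (fun A => A \subset val i)).
transitivity 'C(#|val i|, d); last by rewrite id binSn.
rewrite -cards_draws; apply: eq_card => A.
by rewrite !inE andbC.
Qed.

Lemma common_id (s : J) : common (@incident n d) s s = (n - d)%N.
Proof.
by rewrite -(card_cofaces s); apply: eq_card => i; rewrite !inE andbb.
Qed.

(* Two distinct d-sets are contained in at most one (d+1)-set, their union. *)
Lemma common_le1 (s t : J) : t != s -> (common (@incident n d) s t <= 1)%N.
Proof.
move=> ts; apply/card_le1_eqP => i j; rewrite !inE.
have sd : #|val s| = d by apply/eqP; exact: valP s.
have td : #|val t| = d by apply/eqP; exact: valP t.
have big : (d < #|val s :|: val t|)%N.
  rewrite ltnNge; apply/negP => le; case/eqP: ts; apply/val_inj.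
  have /eqP sU : val s == val s :|: val t by rewrite eqEcard finset.subsetUl sd.
  have /eqP tU : val t == val s :|: val t by rewrite eqEcard finset.subsetUr td.
  by rewrite tU -sU.
have uE (k : I) : incident s k && incident t k -> val k = val s :|: val t.
  move=> /andP[sk tk]; apply/esym/eqP; rewrite eqEcard finset.subUset.
  rewrite -/(incident s k) -/(incident t k) sk tk /=.
  by have /eqP -> := valP k.
by move=> /uE iE /uE jE; apply/val_inj; rewrite iE jE.
Qed.

(** Double counting: each of the [n - d] cofaces of [s] contains [d] further d-sets. *)
Lemma sum_common (s : J) :
  (\sum_(t | t != s) common (@incident n d) s t = (n - d) * d)%N.
Proof.
have : (\sum_t common (@incident n d) s t = (n - d) * d.+1)%N.
  rewrite /common; under eq_bigr do rewrite -sum1_card.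
  rewrite (exchange_big_dep (fun i => incident s i))/=; last first.
    by move=> t i _; rewrite inE => /andP[].
  rewrite (eq_bigr (fun=> d.+1)).
    by rewrite sum_nat_const (card_cofaces s).
  move=> i si; transitivity #|[pred t : J | incident t i]|; last exact: card_faces.
  rewrite -sum1_card; apply: eq_bigl => t.
  by rewrite !inE si.
rewrite (bigD1 s)//= common_id mulnSr addnC => /eqP.
by rewrite eqn_add2r => /eqP.
Qed.

Context (R : realFieldType) (M : nat) (p : 'I_M.+1 -> R) (delta alpha : R).
Hypotheses (delta_ge0 : 0 <= delta) (alpha_gt0 : 0 < alpha).
Hypothesis p_tail : forall j, (j <= M)%N ->
  \sum_(v : 'I_M.+1 | (j <= v)%N) p v = alpha ^+ j.

Lemma Var_rtotal_faces : Var p (rtotal (@incident n d)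
    (fun v : 'I_M.+1 => delta * v%:R) (delta * M%:R)) =
  'C(n, d)%:R * (gcov M delta (alpha ^+ (n - d)) (alpha ^+ (n - d)) +
    ((n - d) * d)%:R * gcov M delta (alpha ^+ (n - d)) alpha).
Proof.
rewrite (Var_rtotal delta_ge0 alpha_gt0 p_tail card_cofaces).
rewrite -card_ksubset -sum1_card natr_sum big_distrl/=.
apply: eq_bigr => s _; rewrite mul1r (bigD1 s)//= common_id; congr (_ + _).
rewrite -(sum_common s) natr_sum big_distrl/=; apply: eq_bigr => t ts.
(* Here [common] is 0 or 1 and [gcov] vanishes at [theta = 1], so each covariance is [common] times
   the one for a single common face. *)
have := common_le1 ts; case: (common _ s t) => [_|[|//] _].
  by rewrite /gcov expr0 subrr !(mulr0, mul0r).
by rewrite expr1 mul1r.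
Qed.

End incidence_counts.

(** * Asymptotics *)

Lemma geometric_tail_mul (R : realFieldType) (x : R) (i N : nat) : (i <= N)%N ->
  (1 - x) * (\sum_(j < N | (i <= j)%N) x ^+ j.+1) = x ^+ i.+1 - x ^+ N.+1.
Proof.
elim: N => [|N IH]; first by rewrite leqn0 => /eqP->; rewrite big_ord0 mulr0 subrr.
rewrite leq_eqVlt => /orP[/eqP ->|iN].
  rewrite big1 ?mulr0 ?subrr// => j; rewrite leqNgt => /negP[].
  exact: ltn_ord.
rewrite big_mkcond big_ord_recr/= -big_mkcond/= mulrDr IH// -ltnS iN.
by rewrite (exprS x N.+1); ring.
Qed.

Section gcov_bounds.
Context (R : realType) (M : nat) (delta gamma theta : R).
Hypotheses (gamma_gt0 : 0 < gamma) (gamma_lt1 : gamma < 1).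
Hypotheses (gamma_le : gamma <= theta) (theta_le1 : theta <= 1).
(** The ratio of the geometric series in [gcov] once its inner tail sums have been evaluated. *)
Let r := gamma ^+ 2 / theta.

Let theta_gt0 : 0 < theta. Proof. exact: lt_le_trans gamma_le. Qed.

Let r_gt0 : 0 < r. Proof. by rewrite divr_gt0// exprn_gt0. Qed.

Let r_le : r <= gamma.
Proof. by rewrite ler_pdivrMr// expr2 ler_pM2l. Qed.

Let r_lt1 : r < 1. Proof. exact: le_lt_trans gamma_lt1. Qed.

Lemma geometric_tail (i : nat) : (i <= M)%N ->
  \sum_(j < M | (i <= j)%N) gamma ^+ j.+1 =
  (gamma ^+ i.+1 - gamma ^+ M.+1) / (1 - gamma).
Proof.
move=> iM; rewrite -geometric_tail_mul// [X in _ = X / _]mulrC mulfK// gt_eqF//.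
by rewrite subr_gt0.
Qed.

(** The upper bound drops [gamma ^+ M.+1]. In the lower one, [gamma ^+ i.+1 <= theta ^+ i.+1]
    cancels the negative power of [theta] in the cross term. *)
Lemma gcov_summand (i : nat) : (i <= M)%N ->
  r ^+ i.+1 - 2 * gamma ^+ M <=
  theta ^- i.+1 * (gamma ^+ i.+1 - gamma ^+ M.+1) ^+ 2 <= r ^+ i.+1.
Proof.
move=> iM; have t0 : 0 < theta ^+ i.+1 by rewrite exprn_gt0.
have g0 k : 0 < gamma ^+ k by rewrite exprn_gt0.
have gi : gamma ^+ i.+1 <= theta ^+ i.+1.
  by rewrite lerXn2r// nnegrE ltW.
have gM : gamma ^+ M.+1 <= gamma ^+ M by rewrite exprS ler_piMl// ltW.
have gMi : gamma ^+ M.+1 <= gamma ^+ i.+1.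
  by rewrite ler_wiXn2l// ltW.
have rE : r ^+ i.+1 = gamma ^+ i.+1 ^+ 2 / theta ^+ i.+1.
  by rewrite /r expr_div_n -!exprM mulnC.
rewrite rE; move: (gamma ^+ i.+1) (gamma ^+ M.+1) (gamma ^+ M) (theta ^+ i.+1)
  (g0 i.+1) (g0 M.+1) (g0 M) gi gM gMi t0 => A B C D A0 B0 C0 AD BC BA D0.
rewrite (mulrC D^-1) ler_pM2r ?invr_gt0//; apply/andP; split; last by nra.
rewrite lerBlDr ler_pdivrMr// mulrDl divfK ?gt_eqF//; nra.
Qed.

Let Asq := (delta / (1 - gamma)) ^+ 2.

Let gcov_E : gcov M delta gamma theta = Asq * ((1 - theta) *
  \sum_(i < M) theta ^- i.+1 * (gamma ^+ i.+1 - gamma ^+ M.+1) ^+ 2).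
Proof.
rewrite /gcov (eq_bigr (fun i : 'I_M => (1 - gamma) ^- 2 *
    (theta ^- i.+1 * (gamma ^+ i.+1 - gamma ^+ M.+1) ^+ 2))); last first.
  by move=> i _; rewrite geometric_tail ?(ltnW (ltn_ord i))// expr_div_n; ring.
by rewrite -big_distrr/= /Asq expr_div_n; ring.
Qed.

Let sum_r : \sum_(i < M) r ^+ i.+1 = r * (1 - r ^+ M) / (1 - r).
Proof.
have r1 : 1 - r != 0 by rewrite gt_eqF// subr_gt0.
apply: (mulfI r1); rewrite (eq_bigl (fun j : 'I_M => (0 <= j)%N))//.
rewrite (geometric_tail_mul r (leq0n M)) !exprS expr0; field.
exact: r1.
Qed.

Lemma gcov_le : gcov M delta gamma theta <= Asq * ((1 - theta) / (1 - r)).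
Proof.
rewrite gcov_E ler_wpM2l ?sqr_ge0// ler_wpM2l ?subr_ge0//.
apply: (@le_trans _ _ (\sum_(i < M) r ^+ i.+1)).
  by apply: ler_sum => i _; case/andP: (gcov_summand (ltnW (ltn_ord i))).
have r1 : 0 < 1 - r by rewrite subr_gt0.
rewrite sum_r ler_pdivrMr// mulVf ?gt_eqF//.
have := ltW r_lt1; have := ltW r_gt0; have := exprn_ge0 M (ltW r_gt0); nra.
Qed.

Lemma gcov_ge : Asq * ((1 - theta) * (r * (1 - r ^+ M) / (1 - r)) -
  2 * (1 - theta) * (M%:R * gamma ^+ M)) <= gcov M delta gamma theta.
Proof.
rewrite gcov_E ler_wpM2l ?sqr_ge0//.
rewrite (_ : _ - _ = (1 - theta) * (r * (1 - r ^+ M) / (1 - r) -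
  2 * (M%:R * gamma ^+ M))); last by ring.
rewrite ler_wpM2l ?subr_ge0// -sum_r; apply: (@le_trans _ _ (\sum_(i < M) (r ^+ i.+1 - 2 * gamma ^+ M))).
  by rewrite sumrB sumr_const card_ord -[in X in _ <= _ - X]mulr_natl; lra.
by apply: ler_sum => i _; case/andP: (gcov_summand (ltnW (ltn_ord i))).
Qed.

End gcov_bounds.

Section limits.
Context (R : realType).

Lemma cvg_invn : (n%:R : R)^-1 @[n --> \oo] --> (0 : R).
Proof.
apply/gtr0_cvgV0; last exact: cvgr_idn.
by near=> n; rewrite ltr0n; near: n; exact: nbhs_infty_gt.
Unshelve. all: by end_near. Qed.

Lemma cvg_nBd (d : nat) : ((n - d)%N%:R / n%:R : R) @[n --> \oo] --> (1 : R).
Proof.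
have H : (1 - d%:R * (n%:R : R)^-1) @[n --> \oo] --> (1 - d%:R * 0 : R).
  by apply: cvgB; [exact: cvg_cst|apply: cvgM; [exact: cvg_cst|exact: cvg_invn]].
rewrite mulr0 subr0 in H; apply: cvg_trans H; apply: near_eq_cvg; near=> n.
have dn : (d < n)%N by near: n; exact: nbhs_infty_gt.
rewrite natrB 1?ltnW// mulrBl divff// pnatr_eq0 -lt0n.
exact: leq_ltn_trans dn.
Unshelve. all: by end_near. Qed.

Lemma cvg_ln_nat : ln (n%:R : R) @[n --> \oo] --> +oo.
Proof.
apply/cvgryPge => A; near=> n.
have n0 : (0 : R) < n%:R by rewrite ltr0n; near: n; exact: nbhs_infty_gt.
rewrite -ler_expR lnK ?posrE//; near: n; exact: nbhs_infty_ger.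
Unshelve. all: by end_near. Qed.

(** By [expR x >= 1 + x] at [x = ln n / (k + 1)], the power of [1 + ln n / (k + 1)] with exponent
    [k + 1] is at most [n]; with one exponent to spare, the quotient is O(1 / ln n). *)
Lemma cvg_log_poly (c : R) (k : nat) : 0 <= c ->
  ((1 + c * ln n%:R) ^+ k / n%:R : R) @[n --> \oo] --> (0 : R).
Proof.
move=> c0; pose c' := 1 + c * k.+1%:R.
have c'0 : 0 < c' by rewrite ltr_pwDl// mulr_ge0.
have H : (c' ^+ k * (1 + ln (n%:R : R) / k.+1%:R)^-1) @[n --> \oo] --> (0 : R).
  rewrite -(mulr0 (c' ^+ k)); apply: cvgM; first exact: cvg_cst.
  apply/gtr0_cvgV0.
    near=> n; rewrite ltr_pwDl// divr_ge0// ln_ge0// ler1n.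
    near: n; exact: nbhs_infty_gt.
  apply/cvgryPge => A; near=> n.
  have : A * k.+1%:R <= ln (n%:R : R).
    by near: n; move/cvgryPge : cvg_ln_nat; exact.
  rewrite -ler_pdivlMr ?ltr0n// => /le_trans; apply.
  by rewrite lerDr.
apply: (squeeze_cvgr _ (cvg_cst 0) H); near=> n.
have n0 : (0 : R) < n%:R by rewrite ltr0n; near: n; exact: nbhs_infty_gt.
have L0 : 0 <= ln (n%:R : R) by rewrite ln_ge0// ler1n -(ltr0n R).
have b0 : 0 < 1 + ln (n%:R : R) / k.+1%:R by rewrite ltr_pwDl// divr_ge0.
apply/andP; split; first by rewrite divr_ge0// exprn_ge0// addr_ge0// mulr_ge0.
rewrite ler_pdivrMr// mulrAC ler_pdivlMr//.
have nE : (1 + ln (n%:R : R) / k.+1%:R) ^+ k.+1 <= n%:R.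
  rewrite -[leRHS]lnK ?posrE//.
  rewrite [X in expR X](_ : _ = k.+1%:R * (ln (n%:R : R) / k.+1%:R)); last first.
    by rewrite mulrC divfK.
  rewrite expRM_natl lerXn2r ?nnegrE ?expR_ge0 ?(ltW b0)//.
  exact: expR_ge1Dx.
apply: (@le_trans _ _ (c' ^+ k * (1 + ln (n%:R : R) / k.+1%:R) ^+ k.+1)); last first.
  by rewrite ler_wpM2l// exprn_ge0// ltW.
rewrite [leLHS]mulrC [in leRHS]exprS [leRHS]mulrCA ler_wpM2l ?(ltW b0)// -exprMn.
rewrite lerXn2r ?nnegrE ?addr_ge0 ?mulr_ge0 ?(ltW c'0) ?(ltW b0)//.
rewrite /c' mulrDl mul1r mulrDr mulr1.
have -> : c * k.+1%:R * (ln (n%:R : R) / k.+1%:R) = c * ln (n%:R : R).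
  by rewrite -mulrA; congr (_ * _); rewrite mulrC divfK.
rewrite -addrA lerD2l addrA lerDr addr_ge0 ?mulr_ge0 ?divr_ge0//.
Unshelve. all: by end_near. Qed.

(** [1 + x <= expR x], used at [x n] and at [- x n], puts the quotient between [(1 + x n)^-1] and
    1. *)
Lemma cvg_1BexpR_div (x : R^nat) : (\forall n \near \oo, 0 < x n) ->
  x n @[n --> \oo] --> (0 : R) ->
  (1 - expR (- x n)) / x n @[n --> \oo] --> (1 : R).
Proof.
move=> x0 xc.
have H : (1 + x n)^-1 @[n --> \oo] --> (1 : R).
  rewrite -[X in _ --> X]invr1; apply: cvgV; first exact: oner_neq0.
  by rewrite -[X in _ --> X]addr0; apply: cvgD => //; exact: cvg_cst.
apply: (@squeeze_cvgr _ _ _ _ (fun n => (1 + x n)^-1) (fun=> 1)); [|exact: H|exact: cvg_cst]; near=> n.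
have xn0 : 0 < x n by near: n; exact: x0.
have p0 : 0 < 1 + x n by rewrite addr_gt0.
apply/andP; split.
  rewrite ler_pdivlMr// mulrC ler_pdivrMr//.
  have : expR (- x n) * (1 + x n) <= 1.
    by rewrite expRN mulrC ler_pdivrMr ?expR_gt0// mul1r expR_ge1Dx.
  lra.
by rewrite ler_pdivrMr// mul1r; have := expR_ge1Dx (- x n); lra.
Unshelve. all: by end_near. Qed.

End limits.

(** * Choice of cutoff and mesh, and the resulting limits of the covariances *)

Section truncation_parameters.
Context (R : realType) (d : nat).
Implicit Types n : nat.

(* The constant in [cutoff] is chosen so that a nearest face-weight exceeds the
   cutoff with probability at most [n%:R ^- (4 * d + 6)]; [decay n] and
   [decay n ^+ (n - d)] are the probabilities that a weight, respectively a
   nearest face-weight, exceeds one mesh. *)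
Definition cutoff n : R := (2 * (4 * d + 6))%:R * ln n%:R.
(** With this many layers, rounding moves each of the at most [n ^ d] minima by less than one mesh,
    hence their total by less than [cutoff n / n]. *)
Definition layers n : nat := (n ^ d.+1)%N.
Definition mesh n : R := cutoff n / (layers n)%:R.
Definition decay n : R := expR (- (mesh n / n%:R)).

(** One mesh in units of [n / (n - d)], the mean of the minimum of [n - d] weights. *)
Let u n : R := mesh n * ((n - d)%:R / n%:R).

Lemma decayX n : decay n ^+ (n - d) = expR (- u n).
Proof. by rewrite /decay -expRM_natl /u; congr expR; ring. Qed.

Section large.
Context (n : nat) (n_gt1 : (1 < n)%N) (n_gt2d : (2 * d < n)%N).

Lemma n_gt0R : (0 : R) < n%:R.
Proof. by rewrite ltr0n ltnW. Qed.

Lemma layers_gt0 : (0 < layers n)%N.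
Proof. by rewrite expn_gt0 ltnW. Qed.

Lemma cutoff_gt0 : 0 < cutoff n.
Proof. by rewrite mulr_gt0 ?ln_gt0 ?ltr1n// ltr0n muln_gt0 addn_gt0 orbT. Qed.

Lemma mesh_gt0 : 0 < mesh n.
Proof. by rewrite divr_gt0 ?cutoff_gt0// ltr0n layers_gt0. Qed.

Lemma mesh_layers : mesh n * (layers n)%:R = cutoff n.
Proof. by rewrite divfK// pnatr_eq0 -lt0n layers_gt0. Qed.

Lemma half_le_ratio : 2^-1 <= ((n - d)%:R / n%:R : R).
Proof.
rewrite ler_pdivlMr ?n_gt0R// mulrC ler_pdivrMr// -natrM ler_nat.
by rewrite muln2 -addnn; move: n_gt2d; lia.
Qed.

(** The minimum of [n - d] weights has rate [(n - d) / n], at least one half as [n > 2 * d]; the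
    leading factor 2 in [cutoff] makes up for this half. *)
Lemma decay_layers :
  (decay n ^+ (n - d)) ^+ layers n <= n%:R ^- (4 * d + 6).
Proof.
rewrite decayX -expRM_natl.
have -> : (layers n)%:R * - u n = - (cutoff n * ((n - d)%:R / n%:R)).
  by rewrite -mesh_layers /u; ring.
have -> : n%:R ^- (4 * d + 6) = expR (- (cutoff n * 2^-1)) :> R.
  rewrite expRN -[in LHS](lnK (x := n%:R)) ?posrE ?n_gt0R// -expRM_natl.
  by congr (expR _)^-1; rewrite /cutoff natrM; field.
by rewrite ler_expR lerN2 ler_wpM2l ?half_le_ratio// ltW// cutoff_gt0.
Qed.

Lemma decay_layers_invn : (decay n ^+ (n - d)) ^+ layers n <= n%:R^-1.
Proof.
rewrite (le_trans decay_layers)// lef_pV2 ?posrE ?exprn_gt0 ?n_gt0R//.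
have e1 : (1 <= 4 * d + 6)%N by lia.
have n1 : (1 : R) <= n%:R by rewrite ler1n ltnW.
by have := ler_weXn2l n1 e1; rewrite expr1.
Qed.

Lemma u_gt0 : 0 < u n.
Proof.
by rewrite mulr_gt0 ?mesh_gt0// (lt_le_trans _ half_le_ratio)// invr_gt0.
Qed.

End large.

Let large : \forall n \near \oo, (1 < n)%N /\ (2 * d < n)%N.
Proof. by near=> n; split; near: n; exact: nbhs_infty_gt.
Unshelve. all: by end_near. Qed.

Lemma cvg_cutoff_div (k : nat) :
  ((1 + 2 * cutoff n) ^+ k / n%:R) @[n --> \oo] --> (0 : R).
Proof.
have := @cvg_log_poly R (2 * (2 * (4 * d + 6))%:R) k (mulr_ge0 _ _).
by rewrite !ler0n => /(_ isT isT); under eq_fun do rewrite -mulrA.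
Qed.

Lemma cvg_mesh : mesh n @[n --> \oo] --> (0 : R).
Proof.
apply: (@squeeze_cvgr _ _ _ _ (fun=> 0) (fun n => (1 + 2 * cutoff n) ^+ 1 / n%:R));
  [|exact: cvg_cst|exact: cvg_cutoff_div].
near=> n; have [n1 n2] : (1 < n)%N /\ (2 * d < n)%N by near: n; exact: large.
rewrite ltW ?mesh_gt0//= expr1 /mesh.
have c0 := cutoff_gt0 n1; have n0 := n_gt0R n1.
rewrite ler_pM ?invr_ge0 ?ler0n ?(ltW c0)//; first by lra.
have l0 : (0 : R) < (layers n)%:R by rewrite ltr0n layers_gt0.
rewrite lef_pV2 ?posrE ?n0 ?l0// ler_nat /layers expnS.
by rewrite leq_pmulr// expn_gt0 (ltnW n1).
Unshelve. all: by end_near. Qed.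

Lemma cvg_u : u n @[n --> \oo] --> (0 : R).
Proof.
rewrite -(mulr0 (0 : R)) -[X in _ --> X](mulr1 (0 * 0)) mul0r.
by apply: cvgM; [exact: cvg_mesh|exact: cvg_nBd].
Qed.

Lemma cvg_decayX : decay n ^+ (n - d) @[n --> \oo] --> (1 : R).
Proof.
under eq_fun do rewrite decayX.
rewrite -expR0 -oppr0; apply: continuous_cvg; first exact: continuous_expR.
by apply: cvgN; exact: cvg_u.
Qed.

Lemma cvg_decay_layers : (decay n ^+ (n - d)) ^+ layers n @[n --> \oo] --> (0 : R).
Proof.
apply: (@squeeze_cvgr _ _ _ _ (fun=> 0) (fun n => n%:R^-1));
  [|exact: cvg_cst|exact: cvg_invn].
near=> n; have [n1 n2] : (1 < n)%N /\ (2 * d < n)%N by near: n; exact: large.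
by rewrite decay_layers_invn// andbT !exprn_ge0// expR_ge0.
Unshelve. all: by end_near. Qed.

Lemma cvg_cutoff_decay :
  cutoff n * (decay n ^+ (n - d)) ^+ layers n @[n --> \oo] --> (0 : R).
Proof.
apply: (@squeeze_cvgr _ _ _ _ (fun=> 0) (fun n => (1 + 2 * cutoff n) ^+ 1 / n%:R));
  [|exact: cvg_cst|exact: cvg_cutoff_div].
near=> n; have [n1 n2] : (1 < n)%N /\ (2 * d < n)%N by near: n; exact: large.
have c0 := cutoff_gt0 n1.
have g0 : 0 <= (decay n ^+ (n - d)) ^+ layers n by rewrite !exprn_ge0// expR_ge0.
rewrite mulr_ge0//= ?(ltW c0)// expr1 ler_pM ?(ltW c0) ?decay_layers_invn//.
lra.
Unshelve. all: by end_near. Qed.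

Lemma cvg_square : (mesh n / (1 - decay n ^+ (n - d))) ^+ 2 @[n --> \oo] --> (1 : R).
Proof.
suff H : (mesh n / (1 - decay n ^+ (n - d))) @[n --> \oo] --> (1 : R).
  by rewrite -[X in _ --> X](mulr1 1); under eq_fun do rewrite expr2; exact: cvgM.
have H1 : ((1 - expR (- u n)) / u n)^-1 @[n --> \oo] --> (1 : R).
  rewrite -[X in _ --> X]invr1; apply: cvgV; first exact: oner_neq0.
  apply: cvg_1BexpR_div; last exact: cvg_u.
  by near=> n; have [n1 n2] : (1 < n)%N /\ (2 * d < n)%N by [near: n; exact: large];
    exact: u_gt0.
have H2 : ((n - d)%:R / n%:R : R)^-1 @[n --> \oo] --> (1 : R).
  rewrite -[X in _ --> X]invr1; apply: cvgV; first exact: oner_neq0.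
  exact: cvg_nBd.
have H : ((1 - expR (- u n)) / u n)^-1 * ((n - d)%:R / n%:R : R)^-1
    @[n --> \oo] --> (1 : R).
  by rewrite -[X in _ --> X]mulr1; exact: cvgM.
apply: cvg_trans H; apply: near_eq_cvg.
near=> n; have [n1 n2] : (1 < n)%N /\ (2 * d < n)%N by near: n; exact: large.
have m0 := mesh_gt0 n1; have r0 := half_le_ratio n1 n2.
have {}r0 : (n - d)%:R / n%:R != 0 :> R.
  by rewrite gt_eqF// (lt_le_trans _ r0)// invr_gt0.
by rewrite decayX /= invf_div mulrAC {1}/u mulfK.
Unshelve. all: by end_near. Qed.

Lemma decay_bounds n : (1 < n)%N -> (2 * d < n)%N ->
  [/\ 0 < decay n ^+ (n - d), decay n ^+ (n - d) < 1,
      decay n ^+ (n - d) <= decay n & decay n <= 1].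
Proof.
move=> n1 n2.
have a1 : decay n <= 1.
  rewrite /decay -expR0 ler_expR oppr_le0 divr_ge0 ?(ltW (n_gt0R n1))//.
  exact: ltW (mesh_gt0 n1).
have a0 : 0 < decay n by exact: expR_gt0.
split=> //; first by rewrite exprn_gt0.
- by rewrite decayX -expR0 ltr_expR oppr_lt0 u_gt0.
- rewrite -[leRHS]expr1 ler_wiXn2l// ?(ltW a0)//; lia.
Qed.

(** With [theta = gamma] the ratio of the series is [gamma] again, so [(1 - theta) / (1 - r)] is 1
    and the prefactor of [cvg_square] gives the limit; the correction in the lower bound is at most
    [2 * cutoff n] times a vanishing exceedance probability. *)
Lemma cvg_gcov_variance : gcov (layers n) (mesh n) (decay n ^+ (n - d))
  (decay n ^+ (n - d)) @[n --> \oo] --> (1 : R).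
Proof.
pose g n := decay n ^+ (n - d); pose A n := (mesh n / (1 - g n)) ^+ 2.
have H : A n * (g n * (1 - g n ^+ layers n) -
    2 * (cutoff n * g n ^+ layers n)) @[n --> \oo] --> (1 : R).
  rewrite [X in _ --> X](_ : _ = 1 * (1 * (1 - 0) - 2 * 0) :> R); last by ring.
  apply: cvgM; first exact: cvg_square.
  apply: cvgB; last by apply: cvgM; [exact: cvg_cst|exact: cvg_cutoff_decay].
  apply: cvgM; first exact: cvg_decayX.
  by apply: cvgB; [exact: cvg_cst|exact: cvg_decay_layers].
apply: squeeze_cvgr H cvg_square.
near=> n; have [n1 n2] : (1 < n)%N /\ (2 * d < n)%N by near: n; exact: large.
have [g0 g1 ga a1] := decay_bounds n1 n2.
have gE : decay n ^+ (n - d) ^+ 2 / decay n ^+ (n - d) = decay n ^+ (n - d).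
  by rewrite expr2 mulfK// gt_eqF.
have g1' : 0 < 1 - decay n ^+ (n - d) by rewrite subr_gt0.
have := gcov_le (layers n) (mesh n) g0 g1 (lexx _) (ltW g1).
have := gcov_ge (layers n) (mesh n) g0 g1 (lexx _) (ltW g1).
rewrite gE divff ?gt_eqF// mulr1 -/(g n) -/(A n) => lo ->; rewrite andbT.
apply: le_trans lo; rewrite ler_wpM2l ?sqr_ge0//.
have -> : (1 - g n) * (g n * (1 - g n ^+ layers n) / (1 - g n)) =
    g n * (1 - g n ^+ layers n) by field; rewrite gt_eqF.
have key : 1 - g n <= mesh n.
  have := expR_ge1Dx (- u n); rewrite -decayX -/(g n).
  have : u n <= mesh n.
    rewrite /u ler_piMr ?(ltW (mesh_gt0 n1))// ler_pdivrMr ?n_gt0R// mul1r.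
    by rewrite ler_nat leq_subr.
  lra.
have := ler_wpM2r (mulr_ge0 (ler0n _ (layers n)) (exprn_ge0 (layers n) (ltW g0))) key.
rewrite lerD2l lerN2 -(mesh_layers n1) -/(g n); lra.
Unshelve. all: by end_near. Qed.

(** The origin of 1/2: two d-sets with one common coface have [2 * (n - d) - 1] cofaces together, so
    both minima exceed one mesh with probability [expR (- b n)], where [b n] is about [2 * mesh n];
    for the common coface alone the exponent is [mesh n / n]. *)
Lemma cvg_rate_ratio : n%:R * ((1 - decay n) /
   (1 - (decay n ^+ (n - d)) ^+ 2 / decay n)) @[n --> \oo] --> (2^-1 : R).
Proof.
pose a n : R := mesh n / n%:R.
pose k n : R := 2 * ((n - d)%:R / n%:R) - n%:R^-1.
pose b n : R := mesh n * k n.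
have ck : k n @[n --> \oo] --> (2 : R).
  rewrite -[X in _ --> X]subr0 -[X in _ --> X - 0]mulr1.
  apply: cvgB; last exact: cvg_invn.
  by apply: cvgM; [exact: cvg_cst|exact: cvg_nBd].
have k_gt n : (1 < n)%N -> (2 * d < n)%N -> 0 < k n.
  move=> n1 n2; have := half_le_ratio n1 n2; rewrite /k => h.
  have : n%:R^-1 <= 2^-1 :> R by rewrite lef_pV2 ?posrE ?n_gt0R// ler_nat.
  have h2 : 2^-1 < 1 :> R by rewrite invf_lt1// ltr1n.
  have : 2 * 2^-1 = 1 :> R by rewrite divff.
  lra.
have ca : a n @[n --> \oo] --> (0 : R).
  by rewrite -(mulr0 (0 : R)); apply: cvgM; [exact: cvg_mesh|exact: cvg_invn].
have cb : b n @[n --> \oo] --> (0 : R).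
  by rewrite -(mul0r (2 : R)); apply: cvgM; [exact: cvg_mesh|exact: ck].
have Ha : (1 - expR (- a n)) / a n @[n --> \oo] --> (1 : R).
  apply: cvg_1BexpR_div ca; near=> n.
  have [n1 n2] : (1 < n)%N /\ (2 * d < n)%N by near: n; exact: large.
  by rewrite divr_gt0 ?mesh_gt0 ?n_gt0R.
have Hb : ((1 - expR (- b n)) / b n)^-1 @[n --> \oo] --> (1 : R).
  rewrite -[X in _ --> X]invr1; apply: cvgV; first exact: oner_neq0.
  apply: cvg_1BexpR_div cb; near=> n.
  have [n1 n2] : (1 < n)%N /\ (2 * d < n)%N by near: n; exact: large.
  by rewrite mulr_gt0 ?mesh_gt0 ?k_gt.
have Hk : (k n)^-1 @[n --> \oo] --> (2^-1 : R).
  by apply: cvgV => //; rewrite pnatr_eq0.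
have H : (1 - expR (- a n)) / a n * ((1 - expR (- b n)) / b n)^-1 * (k n)^-1
    @[n --> \oo] --> (2^-1 : R).
  rewrite [X in _ --> X](_ : _ = 1 * 1 * 2^-1 :> R); last by rewrite !mul1r.
  by apply: cvgM => //; exact: cvgM.
apply: cvg_trans H; apply: near_eq_cvg.
near=> n; have [n1 n2] : (1 < n)%N /\ (2 * d < n)%N by near: n; exact: large.
have m0 := mesh_gt0 n1; have n0 := n_gt0R n1; have k0 := k_gt n n1 n2.
have -> : decay n ^+ (n - d) ^+ 2 / decay n = expR (- b n).
  rewrite decayX -expRM_natl /decay -expRN -expRD; congr expR.
  by rewrite /u /b /k; field; rewrite gt_eqF.
have b0 : 0 < 1 - expR (- b n).
  by rewrite subr_gt0 -expR0 ltr_expR oppr_lt0 mulr_gt0.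
have -> : decay n = expR (- a n) by [].
move: (expR (- a n)) (expR (- b n)) b0 => A B B0; rewrite /b /a.
move: (mesh n) (k n) (n%:R : R) m0 k0 n0 => x y z x0 y0 z0; field.
by rewrite !gt_eqF.
Unshelve. all: by end_near. Qed.

Lemma cvg_gcov_covariance : n%:R * gcov (layers n) (mesh n) (decay n ^+ (n - d))
  (decay n) @[n --> \oo] --> (2^-1 : R).
Proof.
pose g n := decay n ^+ (n - d); pose A n := (mesh n / (1 - g n)) ^+ 2.
pose r n := g n ^+ 2 / decay n.
pose q n := n%:R * ((1 - decay n) / (1 - r n)).
have r_le n : (1 < n)%N -> (2 * d < n)%N -> 0 <= r n <= g n.
  move=> n1 n2; have [g0 g1 ga a1] := decay_bounds n1 n2.
  have a0 := lt_le_trans g0 ga.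
  by rewrite divr_ge0 ?sqr_ge0 ?(ltW a0)//= ler_pdivrMr// expr2 ler_pM2l.
have cq : q n @[n --> \oo] --> (2^-1 : R) by exact: cvg_rate_ratio.
have cr : r n @[n --> \oo] --> (1 : R).
  have c1 : decay n @[n --> \oo] --> (1 : R).
    apply: (@squeeze_cvgr _ _ _ _ (fun n => decay n ^+ (n - d)) (fun=> 1));
      [|exact: cvg_decayX|exact: cvg_cst]; near=> n.
    have [n1 n2] : (1 < n)%N /\ (2 * d < n)%N by near: n; exact: large.
    by have [g0 g1 -> ->] := decay_bounds n1 n2.
  rewrite [X in _ --> X](_ : _ = 1 * 1 / 1 :> R); last by rewrite divr1 mulr1.
  apply: cvgM; last by apply: cvgV => //; exact: oner_neq0.
  by under eq_fun do rewrite expr2; apply: cvgM; exact: cvg_decayX.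
have crM : r n ^+ layers n @[n --> \oo] --> (0 : R).
  apply: (squeeze_cvgr _ (cvg_cst 0) cvg_decay_layers); near=> n.
  have [n1 n2] : (1 < n)%N /\ (2 * d < n)%N by near: n; exact: large.
  have /andP[r0 rg] := r_le n n1 n2.
  by rewrite exprn_ge0//= lerXn2r// nnegrE (le_trans r0).
have Hlo : A n * (q n * (r n * (1 - r n ^+ layers n)) -
    2 * (cutoff n * g n ^+ layers n)) @[n --> \oo] --> (2^-1 : R).
  rewrite [X in _ --> X](_ : _ = 1 * (2^-1 * (1 * (1 - 0)) - 2 * 0) :> R); last by ring.
  apply: cvgM; first exact: cvg_square.
  apply: cvgB; last by apply: cvgM; [exact: cvg_cst|exact: cvg_cutoff_decay].
  apply: cvgM => //; apply: cvgM => //.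
  by apply: cvgB; [exact: cvg_cst|].
have Hup : A n * q n @[n --> \oo] --> (2^-1 : R).
  by rewrite -[X in _ --> X]mul1r; apply: cvgM => //; exact: cvg_square.
apply: squeeze_cvgr Hlo Hup.
near=> n; have [n1 n2] : (1 < n)%N /\ (2 * d < n)%N by near: n; exact: large.
have [g0 g1 ga a1] := decay_bounds n1 n2; have n0 := n_gt0R n1.
have /andP[r0 rg] := r_le n n1 n2.
have r1 : 0 < 1 - r n by rewrite subr_gt0 (le_lt_trans rg).
have := gcov_le (layers n) (mesh n) g0 g1 ga a1.
have := gcov_ge (layers n) (mesh n) g0 g1 ga a1.
rewrite -/(g n) -/(r n) -/(A n) => lo up; apply/andP; split; last first.
  by apply: (le_trans (ler_wpM2l (ltW n0) up)); rewrite mulrCA.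
apply: le_trans (ler_wpM2l (ltW n0) lo).
rewrite [leRHS]mulrCA ler_wpM2l ?sqr_ge0// [leRHS]mulrBr.
have -> : n%:R * ((1 - decay n) * (r n * (1 - r n ^+ layers n) / (1 - r n))) =
    q n * (r n * (1 - r n ^+ layers n)).
  by rewrite /q; ring.
rewrite lerD2l lerN2 -(mesh_layers n1).
(* As [mesh n] times the number of layers is [cutoff n], this bounds the correction term of
   [gcov_ge], multiplied by [n], by the vanishing [2 * (cutoff n * g n ^+ layers n)]. *)
have key : n%:R * (1 - decay n) <= mesh n.
  have := expR_ge1Dx (- (mesh n / n%:R)); rewrite -/(decay n) => h.
  by rewrite mulrC -ler_pdivlMr//; lra.
have := ler_wpM2r (mulr_ge0 (ler0n _ (layers n)) (exprn_ge0 (layers n) (ltW g0))) key.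
rewrite -/(g n); lra.
Unshelve. all: by end_near. Qed.

End truncation_parameters.

(** * Transfer of variance and test functions along a mean square approximation *)

Section square_integrable_perturbation.
Context (R : realType) (d : measure_display) (T : measurableType d).
Context (P : probability T R) (S : {RV P >-> R}) (F : T -> R) (B e : R).
Hypotheses (mF : measurable_fun setT F) (F_le : forall t, `|F t| <= B).
Hypothesis SF : (\int[P]_t ((S t - F t) ^+ 2)%:E <= e%:E)%E.
Local Notation E g := (\int[P]_t g t).
Local Notation integrable g := (P.-integrable setT (EFin \o g)).

Let integrable_dom (f g : T -> R) : measurable_fun setT f -> integrable g ->
  (forall t, `|f t| <= g t) -> integrable f.
Proof.
move=> mf ig fg; apply: (@le_integrable _ _ _ P _ measurableT _ (EFin \o g)) => //.
  exact/measurable_EFinP.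
by move=> t _ /=; rewrite lee_fin (le_trans (fg t))// ler_norm.
Qed.

Let integrableD' (f g : T -> R) : integrable f -> integrable g ->
  integrable (fun t => f t + g t).
Proof. by move=> i1 i2; exact: (integrableD measurableT i1 i2). Qed.

Let integrableZ (c : R) (f : T -> R) : integrable f ->
  integrable (fun t => c * f t).
Proof. by move=> i; exact: (integrableZl measurableT c i). Qed.

Let integrable_cst (c : R) : integrable (fun=> c).
Proof. by apply: (@bounded_prob_integrable _ _ _ _ _ `|c|). Qed.

Let A t := S t - F t.

Let mA : measurable_fun setT A. Proof. exact: measurable_funB. Qed.

Let iA2 : integrable (fun t => A t ^+ 2).
Proof.
apply/integrableP; split; first by apply/measurable_EFinP; exact: measurable_funX.
apply: le_lt_trans (ltry e).
by under eq_integral do rewrite /= ger0_norm ?sqr_ge0//.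
Qed.

Let A2_le : E (fun t => A t ^+ 2) <= e.
Proof.
by rewrite -lee_fin /Rintegral fineK//; exact: integrable_fin_num.
Qed.

Let iA : integrable A.
Proof.
apply: (integrable_dom mA (integrableD' (integrable_cst 1) iA2)) => t.
rewrite -(real_normK (num_real (A t))).
have := sqr_ge0 (`|A t| - 1); have := normr_ge0 (A t); nra.
Qed.

Let iF : integrable F. Proof. exact: bounded_prob_integrable F_le. Qed.

Let muF := E F.
Let muA := E A.
Let x t := F t - muF.
Let y t := A t - muA.

Let ix2 : integrable (fun t => x t ^+ 2).
Proof.
apply: (@bounded_prob_integrable _ _ _ _ _ ((B + `|muF|) ^+ 2)).
  by apply: measurable_funX; exact: measurable_funB.
move=> t; rewrite normrX lerXn2r ?nnegrE ?addr_ge0//.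
  by rewrite (le_trans _ (F_le t)).
by rewrite (le_trans (ler_normB _ _))// lerD2r.
Qed.

Let my : measurable_fun setT y. Proof. exact: measurable_funB. Qed.

Let iy : integrable y.
Proof.
have := integrableD' iA (integrable_cst (- muA)); exact.
Qed.

Let y2E : (fun t => y t ^+ 2) = (fun t => A t ^+ 2 + ((- 2 * muA) * A t + muA ^+ 2)).
Proof. by apply/funext => t; rewrite /y; ring. Qed.

Let iy2 : integrable (fun t => y t ^+ 2).
Proof.
rewrite y2E; apply: integrableD' => //.
by apply: integrableD' => //; exact: integrableZ.
Qed.

Let y2_le : E (fun t => y t ^+ 2) <= e.
Proof.
rewrite y2E RintegralD//; last by apply: integrableD' => //; exact: integrableZ.
rewrite RintegralD//; last exact: integrableZ.
rewrite RintegralZl// Rintegral_prob_cst -/muA (le_trans _ A2_le)//.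
rewrite gerDl (_ : _ + _ = - muA ^+ 2); last by ring.
by rewrite oppr_le0 sqr_ge0.
Qed.

Let SE : (S : T -> R) = (fun t => F t + A t).
Proof. by apply/funext => t; rewrite /A addrC subrK. Qed.

Lemma perturbed_mean : fine 'E_P[S] = muF + muA.
Proof. by rewrite expectation_def -/(Rintegral P setT S) SE RintegralD. Qed.

Let xyE t : S t - fine 'E_P[S] = x t + y t.
Proof. by rewrite perturbed_mean /x /y /A; ring. Qed.

Lemma perturbed_varianceE : fine 'V_P[S] = E (fun t => (x t + y t) ^+ 2).
Proof.
rewrite /variance covariance.unlock.
transitivity (fine 'E_P[fun t => (x t + y t) ^+ 2]).
  by congr (fine 'E_P[_]); apply/funext => t; rewrite -xyE expr2.
by rewrite expectation.unlock.
Qed.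

Let ixy : integrable (fun t => (x t + y t) ^+ 2).
Proof.
apply: (integrable_dom _ (integrableD' (integrableZ 2 ix2) (integrableZ 2 iy2))).
  by apply: measurable_funX; apply: measurable_funD => //; exact: measurable_funB.
move=> t; rewrite ger0_norm ?sqr_ge0//.
have := sqr_ge0 (x t - y t); lra.
Qed.

(** Centring does not increase the mean square of the error, and the cross term is split by
    [2 * x * y <= l * x ^+ 2 + l^-1 * y ^+ 2]. A small [l] makes the relative error small. *)
Lemma perturbed_variance (l : R) : 0 < l ->
  `|fine 'V_P[S] - E (fun t => (F t - muF) ^+ 2)| <=
  l * E (fun t => (F t - muF) ^+ 2) + (1 + l^-1) * e.
Proof.
move=> l0; rewrite perturbed_varianceE.
have lV : 0 < l^-1 by rewrite invr_gt0.
have ey : E (fun t => y t ^+ 2) >= 0 by apply: Rintegral_ge0 => t _; exact: sqr_ge0.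
have cross t : `|2 * x t * y t| <= l * x t ^+ 2 + l^-1 * y t ^+ 2.
  have E1 : l * x t ^+ 2 + l^-1 * y t ^+ 2 - 2 * x t * y t =
      l^-1 * (l * x t - y t) ^+ 2 by field; rewrite gt_eqF.
  have E2 : l * x t ^+ 2 + l^-1 * y t ^+ 2 + 2 * x t * y t =
      l^-1 * (l * x t + y t) ^+ 2 by field; rewrite gt_eqF.
  have := mulr_ge0 (ltW lV) (sqr_ge0 (l * x t - y t)).
  have := mulr_ge0 (ltW lV) (sqr_ge0 (l * x t + y t)).
  by rewrite -E1 -E2 ler_norml; lra.
have up : E (fun t => (x t + y t) ^+ 2) <=
    (1 + l) * E (fun t => x t ^+ 2) + (1 + l^-1) * E (fun t => y t ^+ 2).
  rewrite -!RintegralZl// -RintegralD//; [|exact: integrableZ..].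
  apply: le_Rintegral => //; first by apply: integrableD'; exact: integrableZ.
  move=> t _; have := cross t; rewrite ler_norml => /andP[].
  move: (x t) (y t) => a b c1 c2; rewrite sqrrD; lra.
have lo : (1 - l) * E (fun t => x t ^+ 2) - l^-1 * E (fun t => y t ^+ 2) <=
    E (fun t => (x t + y t) ^+ 2).
  rewrite -mulNr -!RintegralZl// -RintegralD//; [|exact: integrableZ..].
  apply: le_Rintegral => //; first by apply: integrableD'; exact: integrableZ.
  move=> t _; have := cross t; rewrite ler_norml => /andP[].
  move: (x t) (y t) => a b c1 c2; have := sqr_ge0 b; rewrite sqrrD; lra.
have h1 : l^-1 * E (fun t => y t ^+ 2) <= l^-1 * e by rewrite ler_wpM2l// ltW.
move: y2_le h1 up lo ey; rewrite -/(E (fun t => x t ^+ 2)).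
move: (E (fun t => (x t + y t) ^+ 2)) (E (fun t => x t ^+ 2))
  (E (fun t => y t ^+ 2)) => a b c h0 h1 up lo c0.
by rewrite ler_norml; apply/andP; split; nra.
Qed.

(** Lipschitz continuity together with [|y| <= 1 + y ^+ 2] for the centred error [y]; the crude 1 is
    affordable because [sd] tends to infinity in the application. *)
Lemma perturbed_test_function (h : R -> R) (L sd : R) : 0 <= L -> 0 < sd ->
    measurable_fun setT h -> (forall z, `|h z| <= 1) ->
    (forall a b, `|h a - h b| <= L * `|a - b|) ->
  `|E (fun t => h ((S t - fine 'E_P[S]) / sd)) -
    E (fun t => h ((F t - muF) / sd))| <= L * (1 + e) / sd.
Proof.
move=> L0 sd0 mh h1 hL.
have ih (f : T -> R) : measurable_fun setT f -> integrable (fun t => h (f t / sd)).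
  move=> mf; apply: (@bounded_prob_integrable _ _ _ _ _ 1) => //.
  by apply: measurableT_comp => //; exact: measurable_funM.
have i1 : integrable (fun t => h ((S t - fine 'E_P[S]) / sd)).
  by apply: ih; exact: measurable_funB.
have i2 : integrable (fun t => h ((F t - muF) / sd)).
  by apply: ih; exact: measurable_funB.
rewrite -RintegralB// (le_trans (le_normr_Rintegral _ _))//.
  by have := integrableB measurableT i1 i2; exact.
apply: (@le_trans _ _ (E (fun t => (L / sd) * (1 + y t ^+ 2)))).
  apply: le_Rintegral => //.
  - have := integrable_norm (integrableB measurableT i1 i2); exact.
  - by apply: integrableZ; exact: integrableD'.
  - move=> t _; rewrite (le_trans (hL _ _))// -mulrA ler_wpM2l//.
    rewrite -mulrBl xyE /x [X in `|X / _|](_ : _ = y t); last by ring.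
    rewrite normrM normfV (gtr0_norm sd0) mulrC ler_wpM2l ?invr_ge0 ?(ltW sd0)//.
    rewrite -(real_normK (num_real (y t))).
    have := sqr_ge0 (`|y t| - 1); have := normr_ge0 (y t); nra.
rewrite RintegralZl//; last exact: integrableD'.
rewrite RintegralD// Rintegral_prob_cst mulrAC ler_wpM2r ?invr_ge0 ?(ltW sd0)//.
by rewrite ler_wpM2l// lerD2l.
Qed.

End square_integrable_perturbation.

Lemma ffact_ge_exp (n m : nat) : ((n - m) ^ m <= n ^_ m)%N.
Proof.
elim: m => [|m IH]; first by rewrite ffactn0 expn0.
rewrite ffactnSr expnSr leq_mul ?leq_sub2l// (leq_trans _ IH)//.
case: m {IH} => [|m]; first by rewrite !expn0.
by rewrite leq_exp2r// leq_sub2l.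
Qed.

Lemma ffact_le_exp (n m : nat) : (n ^_ m <= n ^ m)%N.
Proof.
elim: m => [|m IH]; first by rewrite ffactn0 expn0.
by rewrite ffactnSr expnSr leq_mul// leq_subr.
Qed.

Lemma bin_le_exp (n m : nat) : ('C(n, m) <= n ^ m)%N.
Proof.
apply: leq_trans (ffact_le_exp n m); rewrite -bin_ffact leq_pmulr//.
exact: fact_gt0.
Qed.

Lemma exponent_bounds (d : nat) : [/\ (d.+1 * 2 = 2 * d + 2)%N,
  ((d * 2).+1 <= 2 * d + 2)%N, ((d * 2 + 4).+1 <= 2 * d + 5)%N &
  ((d * 2 + (2 * d + 5)).+1 <= 4 * d + 6)%N].
Proof. by split; lia. Qed.

(** * Explicit error bounds for a fixed number of vertices *)

Section fixed_size.
Context (R : realType) (disp : measure_display) (T : measurableType disp).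
Context (P : probability T R) (n d : nat) (w : ksubset n d.+1 -> {RV P >-> R}).
Hypotheses (d_gt0 : (0 < d)%N) (n_gt1 : (1 < n)%N) (n_gt2d : (2 * d < n)%N).
Hypothesis w_indep : mutually_independent w.
Hypothesis w_exp : forall i, exponential_with_mean n%:R (w i).
Local Notation I := (ksubset n d.+1).
Local Notation J := (ksubset n d).
Local Notation NN := (total_nearest_face_weight w : {RV P >-> R}).

Let M := (layers d n).-1.
Let ML : M.+1 = layers d n. Proof. by rewrite prednK// layers_gt0. Qed.
Let delta : R := mesh R d n.
Let K : R := cutoff R d n.
Let Z : R := 1 + 2 * K.
Let p : 'I_M.+2 -> R := cellp n%:R delta (M := M.+1).
Let alpha : R := decay R d n.
Let vl := (fun v : 'I_M.+2 => delta * v%:R).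
Let KE : delta * M.+1%:R = K. Proof. by rewrite ML mesh_layers. Qed.
Let F (t : T) : R := rtotal (@incident n d) vl (delta * M.+1%:R) (cells w delta M.+1 t).

(** By [Var_F] this is the exact variance of the discretized total. *)
Definition approx_variance : R := 'C(n, d)%:R *
  (gcov (layers d n) delta (alpha ^+ (n - d)) (alpha ^+ (n - d)) +
   ((n - d) * d)%:R * gcov (layers d n) delta (alpha ^+ (n - d)) alpha).

Definition approx_error : R := 4 ^+ 8 * (Z ^+ 2 / n%:R).

Let n0 : (0 : R) < n%:R. Proof. exact: n_gt0R. Qed.
Let delta_gt0 : 0 < delta. Proof. exact: mesh_gt0. Qed.
Let K_gt0 : 0 < K. Proof. exact: cutoff_gt0. Qed.
Let alpha_gt0 : 0 < alpha. Proof. exact: expR_gt0. Qed.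

Let face : I.
Proof.
have : (0 < #|I|)%N by rewrite card_ksubset bin_gt0; move: n_gt2d; lia.
by move=> /card_gt0P/cid[i _].
Qed.

Let p_tail j : (j <= M.+1)%N ->
  \sum_(v : 'I_M.+2 | (j <= v)%N) p v = alpha ^+ j.
Proof. exact: (cellp_tail n0 delta_gt0 w_exp face). Qed.

Let p_ge0 v : 0 <= p v. Proof. exact: cellp_ge0. Qed.

Let p_sum1 : \sum_v p v = 1. Proof. exact: sum_p1 p_tail. Qed.

Let vl_ge0 v : 0 <= vl v. Proof. by rewrite mulr_ge0// ltW. Qed.

Let vl_top : vl ord_max = delta * M.+1%:R. Proof. by []. Qed.

Let Ex_F (g : R -> R) : \int[P]_t g (F t) =
  Ex p (fun x => g (rtotal (@incident n d) vl (delta * M.+1%:R) x)).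
Proof.
have [_] := Rintegral_cells delta_gt0 w_indep w_exp
  (fun x : {ffun I -> 'I_M.+2} => g (rtotal (@incident n d) vl (delta * M.+1%:R) x)).
exact.
Qed.

Let mF : measurable_fun setT F.
Proof.
have [/integrableP[] /measurable_EFinP + _ _] := Rintegral_cells delta_gt0 w_indep w_exp
  (rtotal (@incident n d) vl (delta * M.+1%:R) : {ffun I -> 'I_M.+2} -> R).
exact.
Qed.

Let F_le t : `|F t| <= \sum_(s : J) delta * M.+1%:R.
Proof.
rewrite /F /rtotal (le_trans (ler_norm_sum _ _ _))//; apply: ler_sum => s _.
by rewrite ger0_norm ?rmin_le// (rmin_ge0 _ vl_ge0 vl_top).
Qed.

Let Var_F : \int[P]_t (F t - \int[P]_t F t) ^+ 2 = approx_variance.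
Proof.
rewrite (Ex_F (fun z => (z - \int[P]_t F t) ^+ 2)) (Ex_F id).
transitivity (Var p (rtotal (@incident n d) vl (delta * M.+1%:R))) => //.
by rewrite (Var_rtotal_faces n d (ltW delta_gt0) alpha_gt0 p_tail) ML.
Qed.

Let Z_ge1 : 1 <= Z. Proof. by rewrite /Z; have := K_gt0; lra. Qed.

Let card_J : (#|J|%:R : R) <= n%:R ^+ d.
Proof.
by rewrite card_ksubset -natrX ler_nat bin_le_exp.
Qed.

Let card_I : (#|I|%:R : R) <= n%:R ^+ d.+1.
Proof. by rewrite card_ksubset -natrX ler_nat bin_le_exp. Qed.

Let error_le : (\int[P]_t ((NN t - F t) ^+ 2)%:E <= approx_error%:E)%E.
Proof.
have [x0 x1 x2 x3] := exponent_bounds d.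
(* The squared number of d-sets costs [n ^+ (2 * d)]. The exponent [2 * d + 5] beats it together
   with the fourth moment of order [n ^+ 4], and the exponent [4 * d + 6] of the exceedance
   probability beats it together with [n ^+ (2 * d + 5)]; each leaves a factor [n^-1]. *)
have eps0 : (0 : R) < n%:R ^- (2 * d + 5) by rewrite invr_gt0 exprn_gt0.
have nd : (0 < n - d)%N by rewrite subn_gt0; move: n_gt2d; lia.
apply: le_trans (discretization_error M n0 delta_gt0 w_indep w_exp
  (@card_cofaces n d) nd eps0) _.
rewrite lee_fin invrK.
have dec : (expR (- (delta / n%:R)) ^+ (n - d)) ^+ M.+1 <= n%:R ^- (4 * d + 6).
  by rewrite ML; exact: decay_layers.
have del : delta ^+ 2 <= Z ^+ 2 / n%:R ^+ (2 * d + 2).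
  have -> : Z ^+ 2 / n%:R ^+ (2 * d + 2) = (Z / n%:R ^+ d.+1) ^+ 2.
    by rewrite expr_div_n -exprM; rewrite x0.
  rewrite lerXn2r ?nnegrE ?(ltW delta_gt0) ?divr_ge0 ?exprn_ge0 ?(ltW n0) ?(le_trans ler01)//.
  rewrite /delta /mesh natrX ler_wpM2r ?invr_ge0 ?exprn_ge0 ?(ltW n0)//.
  by rewrite /Z -/K; have := K_gt0; lra.
have N0 k : (0 : R) < n%:R ^+ k by rewrite exprn_gt0.
have e1 : n%:R ^+ d ^+ 2 * delta ^+ 2 <= Z ^+ 2 / n%:R.
  apply: (le_trans (ler_wpM2l _ del)); first by rewrite sqr_ge0.
  rewrite mulrCA ler_wpM2l ?sqr_ge0// -exprM.
  rewrite ler_pdivrMr// ler_pdivlMl// -exprS.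
  by apply: ler_weXn2l x1; rewrite ler1n ltnW.
have e2 : n%:R ^+ d ^+ 2 * (n%:R ^- (2 * d + 5) * n%:R ^+ 4) <= n%:R^-1 :> R.
  rewrite -exprM mulrCA -exprD ler_pdivrMl// ler_pdivlMr// -exprSr.
  by apply: ler_weXn2l x2; rewrite ler1n ltnW.
have e3 : n%:R ^+ d ^+ 2 * ((expR (- (delta / n%:R)) ^+ (n - d)) ^+ M.+1 *
    n%:R ^+ (2 * d + 5)) <= n%:R^-1 :> R.
  apply: (@le_trans _ _ (n%:R ^+ d ^+ 2 * (n%:R ^- (4 * d + 6) * n%:R ^+ (2 * d + 5)))).
    by rewrite ler_wpM2l ?sqr_ge0// ler_wpM2r// ltW.
  rewrite -exprM mulrCA -exprD ler_pdivrMl// ler_pdivlMr// -exprSr.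
  by apply: ler_weXn2l x3; rewrite ler1n ltnW.
set X1 := delta ^+ 2 in e1 *; set X3 := _ ^+ M.+1 in e3 *.
have X30 : 0 <= X3 by rewrite !exprn_ge0// expR_ge0.
have c4 : #|J|%:R ^+ 2 <= n%:R ^+ d ^+ 2 :> R by rewrite lerXn2r ?nnegrE ?ler0n ?exprn_ge0 ?(ltW n0).
apply: (le_trans (ler_wpM2r _ c4)).
  rewrite addr_ge0 ?sqr_ge0// divr_ge0// addr_ge0// !mulr_ge0 ?exprn_ge0 ?invr_ge0 ?ler0n//.
have Zn : n%:R^-1 <= Z ^+ 2 / n%:R.
  by rewrite -[leLHS]mul1r ler_wpM2r ?invr_ge0 ?(ltW n0)// exprn_ege1.
have g0 : 0 <= Z ^+ 2 / n%:R by rewrite divr_ge0 ?sqr_ge0 ?(ltW n0).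
rewrite /approx_error; move: e1 e2 e3 Zn g0.
move: (n%:R^-1 : R) (Z ^+ 2 / n%:R) (n%:R ^+ d ^+ 2 : R) (n%:R ^+ (2 * d + 5) : R)
  (n%:R ^- (2 * d + 5) : R) (n%:R ^+ 4 : R) => h g a f b c e1 e2 e3 Zn g0.
have -> : a * (X1 + (b * (4 ^+ 7 * c) + X3 * f) / 2) =
  a * X1 + (4 ^+ 7 * (a * (b * c)) + a * (X3 * f)) / 2 by field.
lra.
Qed.

(** [perturbed_variance] at [l = n^-1]: the amplified error is still only a power of ln n, whereas
    the variance has order [n ^ d]. *)
Lemma variance_approx :
  `|fine 'V_P[NN] - approx_variance| <=
  n%:R^-1 * approx_variance + (1 + n%:R) * approx_error.
Proof.
have ninv : (0 : R) < n%:R^-1 by rewrite invr_gt0.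
have := perturbed_variance mF F_le error_le ninv.
by rewrite Var_F invrK.
Qed.

Let rho0 := rho p ord_max.

Let rho_le : rho0 <= K / n%:R.
Proof.
have -> : rho0 = 1 - alpha ^+ M.+1.
  have : \sum_v p v = rho0 + \sum_(v : 'I_M.+2 | (M.+1 <= v)%N) p v.
    rewrite (bigID (fun v => v != ord_max))/=; congr (_ + _).
    apply: eq_bigl => v; rewrite negbK -val_eqE/=.
    by rewrite eqn_leq -ltnS ltn_ord.
  by rewrite p_sum1 p_tail// => ->; rewrite addrK.
have -> : alpha ^+ M.+1 = expR (- (K / n%:R)).
  rewrite /alpha /decay -expRM_natl -KE -/delta; congr expR; ring.
have := expR_ge1Dx (- (K / n%:R)); lra.
Qed.

(** The mean number of cofaces of a d-set with weight below the cutoff; that it is at most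
    logarithmic in [n] keeps the Stein errors under control. *)
Let y0 := (n - d)%:R * rho0.

Let y_bounds : 0 <= y0 <= K.
Proof.
have r0 : 0 <= rho0 by apply: sumr_ge0 => v _; exact: p_ge0.
rewrite mulr_ge0//= (le_trans (ler_wpM2l _ rho_le))//.
by rewrite mulrA ler_pdivrMr// mulrC ler_wpM2l ?(ltW K_gt0)// ler_nat leq_subr.
Qed.

(** [Var_stein_le] yields at most [n ^+ d.+1] faces, times [rho <= Z / n], times [Z ^+ 6]. The
    resulting [n ^+ d * Z ^+ 7] is at most the square of [n ^+ d] times [Z ^+ 7 / n], because
    [n <= n ^+ d]. *)
Definition stein_error : R := 16 * d.+1%:R ^+ 4 * (Z ^+ 7 / n%:R).

Let KZ : K <= Z. Proof. by rewrite /Z; have := K_gt0; lra. Qed.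

Let Var_stein : Var p (stein p ord_max (@incident n d) vl (delta * M.+1%:R)) <=
  (n%:R ^+ d * Num.sqrt stein_error) ^+ 2.
Proof.
have e0 : 0 <= stein_error.
  by rewrite !mulr_ge0 ?exprn_ge0 ?invr_ge0 ?ler0n ?(le_trans ler01).
have iD i : (#|[pred s | @incident n d s i]| <= d.+1)%N by rewrite card_faces.
have im s : (#|[pred i | @incident n d s i]| <= n - d)%N by rewrite card_cofaces.
apply: (le_trans (Var_stein_le p_ge0 p_sum1 vl_ge0 vl_top iD im)).
rewrite [leRHS]exprMn sqr_sqrtr// -/rho0 -/y0 KE.
have /andP[y00 yK] := y_bounds.
have r0 : 0 <= rho0 by apply: sumr_ge0 => v _; exact: p_ge0.
have K0 := ltW K_gt0; have Z0 : 0 <= Z := le_trans ler01 Z_ge1.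
have yZ : (1 + 2 * y0) ^+ 2 <= Z ^+ 2.
  have yZ1 : 1 + 2 * y0 <= Z by rewrite /Z lerD2l ler_wpM2l.
  by rewrite lerXn2r ?nnegrE// addr_ge0// mulr_ge0.
have K4 : K ^+ 4 <= Z ^+ 4 by rewrite lerXn2r ?nnegrE.
have rZ : rho0 <= Z / n%:R.
  by rewrite (le_trans rho_le)// ler_wpM2r ?invr_ge0 ?(ltW n0).
apply: (@le_trans _ _ (n%:R ^+ d.+1 * (16 * Z ^+ 4 * d.+1%:R ^+ 4 * (Z / n%:R) * Z ^+ 2))).
  have f0 : 0 <= 16 * K ^+ 4 * d.+1%:R ^+ 4.
    by rewrite mulr_ge0 ?exprn_ge0 ?ler0n// mulr_ge0 ?exprn_ge0 ?ler0n.
  have f1 : 0 <= 16 * K ^+ 4 * d.+1%:R ^+ 4 * rho0 by exact: mulr_ge0.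
  have f2 : 16 * K ^+ 4 * d.+1%:R ^+ 4 <= 16 * Z ^+ 4 * d.+1%:R ^+ 4.
    by rewrite ler_wpM2r ?exprn_ge0 ?ler0n// ler_wpM2l ?ler0n.
  apply: (ler_pM (ler0n _ _) (mulr_ge0 f1 (sqr_ge0 _)) card_I).
  by apply: (ler_pM f1 (sqr_ge0 _) _ yZ); exact: ler_pM.
rewrite /stein_error exprS; have nd1 : (1 : R) <= n%:R ^+ d by rewrite exprn_ege1// ler1n ltnW.
have nd : (n%:R : R) <= n%:R ^+ d.
  by rewrite -[leLHS]expr1 ler_weXn2l// ler1n ltnW.
have -> : n%:R * n%:R ^+ d * (16 * Z ^+ 4 * d.+1%:R ^+ 4 * (Z / n%:R) * Z ^+ 2) =
  (n%:R ^+ d * n%:R) * (16 * d.+1%:R ^+ 4 * (Z ^+ 7 / n%:R)) by ring.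
by rewrite ler_wpM2r// expr2 ler_wpM2l// exprn_ge0 ?(ltW n0).
Qed.

(** The first term of the bound is the cost of replacing the total by its discretization; the others
    are [stein_bound] for the solution of Stein's equation with right-hand side [logistic k t] minus
    its normal mean. Both steps scale by the deviation of [NN]. *)
Lemma logistic_approx (k t : R) : 0 < k -> 0 < fine 'V_P[NN] ->
  `|\int[P]_x logistic k t ((standardize NN : {RV P >-> R}) x) -
    gauss_mean (logistic k t)| <=
  k * (1 + approx_error) / Num.sqrt (fine 'V_P[NN]) +
  (2 * (`|1 - approx_variance / fine 'V_P[NN]| +
        n%:R ^+ d * Num.sqrt stein_error / fine 'V_P[NN]) +
   2 * (C0 R + k) * (n%:R ^+ d * (d.+1%:R ^+ 2 * Z ^+ 5)) /
     (fine 'V_P[NN] * Num.sqrt (fine 'V_P[NN]))).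
Proof.
move=> k0 V0; set V := fine 'V_P[NN] in V0 *; set sd := Num.sqrt V.
have sd0 : 0 < sd by rewrite sqrtr_gt0.
have sd2 : sd ^+ 2 = V by rewrite sqr_sqrtr// ltW.
pose h := logistic k t; pose c := gauss_mean h.
have h0 z : 0 <= h z by rewrite ltW// logistic_gt0.
have h1 z : h z <= 1 by exact: logistic_le1.
have hn z : `|h z| <= 1 by rewrite ger0_norm.
have hL a b : `|h a - h b| <= k * `|a - b|.
  have lip u v : u <= v -> `|h v - h u| <= k * `|v - u|.
    move=> uv; have [z _ ->] := mvt (is_derive_logistic k t) uv.
    by rewrite normrM ler_wpM2r// dlogistic_norm// ltW.
  have [ab|/ltW ba] := leP a b; last exact: lip.
  by rewrite distrC (distrC a) lip.
have c01 : 0 <= c <= 1.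
  apply/andP; split.
    by apply: Rintegral_ge0 => z _; rewrite mulr_ge0 ?h0 ?normal_pdf_ge0.
  rewrite -(Rintegral_phi R); apply: le_Rintegral => //.
  - exact: integrable_logistic_phi.
  - exact: integrable_phi.
  - by move=> z _; rewrite ler_piMl ?normal_pdf_ge0.
have duE (z : R) : is_derive z 1 (fun z => h z - c) (dlogistic k t z).
  have ? := is_derive_logistic k t z.
  have -> : (fun z => h z - c) = h - cst c by apply/funext.
  by apply: is_derive_eq; rewrite subr0.
have u1 z : `|h z - c| <= 1.
  have := h0 z; have := h1 z; case/andP: c01; rewrite ler_norml; lra.
have u0 : \int[lebesgue_measure]_z ((h z - c) * normal_pdf (0 : R) 1 z) = 0.
  under eq_Rintegral do rewrite mulrBl.
  rewrite RintegralB//; last 2 first.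
  - exact: integrable_logistic_phi.
  - have := integrableZl measurableT c (integrable_phi (R := R) measurableT); exact.
  rewrite RintegralZl//; last exact: integrable_phi.
  by rewrite Rintegral_phi mulr1 subrr.
have [f [f' [f'E f'B fB]]] := stein_solution duE u1
  (fun z => dlogistic_norm t z (ltW k0)) u0.
have iD i : (#|[pred s | @incident n d s i]| <= d.+1)%N by rewrite card_faces.
have im s : (#|[pred i | @incident n d s i]| <= n - d)%N by rewrite card_cofaces.
have q0 : 0 <= n%:R ^+ d * Num.sqrt stein_error.
  by rewrite mulr_ge0 ?sqrtr_ge0// exprn_ge0 ?(ltW n0).
have SB := stein_bound p_ge0 p_sum1 vl_ge0 vl_top iD im sd0 q0 Var_stein f'B fB.
have PB := perturbed_test_function mF F_le error_le (ltW k0) sd0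
  (measurable_logistic k t) hn hL.
have -> : \int[P]_x logistic k t ((standardize NN : {RV P >-> R}) x) - c =
  (\int[P]_x h ((NN x - fine 'E_P[NN]) / sd) -
   \int[P]_x h ((F x - \int[P]_x F x) / sd)) +
  (\int[P]_x h ((F x - \int[P]_x F x) / sd) - c).
  by rewrite addrA subrK.
rewrite (le_trans (ler_normD _ _))// lerD//.
set Y := rstd p (@incident n d) vl (delta * M.+1%:R) sd in SB.
have -> : \int[P]_x h ((F x - \int[P]_x F x) / sd) - c =
    Ex p (fun x => f' (Y x) - Y x * f (Y x)).
  rewrite (Ex_F (fun z => h ((z - \int[P]_x F x) / sd))) (Ex_F id).
  rewrite -[in LHS](Ex_cst I p_sum1 c) -ExB; congr Ex; apply/funext => x.
  by rewrite f'E addrAC subrr add0r.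
apply: (le_trans SB).
have -> : Var p (rtotal (@incident n d) vl (delta * M.+1%:R)) = approx_variance.
  by rewrite (Var_rtotal_faces n d (ltW delta_gt0) alpha_gt0 p_tail) ML.
rewrite sd2 (exprSr sd 2) sd2 -/V lerD// ler_wpM2r ?invr_ge0 ?mulr_ge0 ?(ltW V0) ?(ltW sd0)//.
have C00 : 0 <= 2 * (C0 R + k).
  by rewrite mulr_ge0// addr_ge0 ?(ltW k0)// (le_trans ler01 (C0_ge1 R)).
have /andP[y00 yK] := y_bounds; have K0 := ltW K_gt0.
have Z0 : 0 <= Z := le_trans ler01 Z_ge1.
have T0 : 0 <= K * ((K * d.+1%:R) ^+ 2 * (y0 * (1 + y0))).
  exact: mulr_ge0 K0 (mulr_ge0 (sqr_ge0 _) (mulr_ge0 y00 (addr_ge0 ler01 y00))).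
have T1 : K * ((K * d.+1%:R) ^+ 2 * (y0 * (1 + y0))) <= d.+1%:R ^+ 2 * Z ^+ 5.
  have -> : d.+1%:R ^+ 2 * Z ^+ 5 = Z * ((Z * d.+1%:R) ^+ 2 * (Z * Z)) by ring.
  have y1 : 0 <= 1 + y0 := addr_ge0 ler01 y00.
  apply: (ler_pM K0 (mulr_ge0 (sqr_ge0 _) (mulr_ge0 y00 y1)) KZ).
  apply: (ler_pM (sqr_ge0 _) (mulr_ge0 y00 y1)).
    have KD : K * d.+1%:R <= Z * d.+1%:R by rewrite ler_wpM2r ?ler0n.
    by rewrite lerXn2r ?nnegrE// mulr_ge0 ?ler0n.
  apply: (ler_pM y00 y1 (le_trans yK KZ)).
  by rewrite /Z lerD2l (le_trans yK)// mulr2n mulrDl mul1r lerDl.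
rewrite ler_wpM2l// KE; exact: ler_pM (ler0n _ _) T0 card_J T1.
Qed.

End fixed_size.

(** * Limits as the number of vertices grows *)

Section asymptotics.
Context (R : realType) (d : nat).
Hypothesis d_gt0 : (0 < d)%N.

Let large : \forall n \near \oo, (1 < n)%N /\ (2 * d < n)%N.
Proof. by near=> n; split; near: n; exact: nbhs_infty_gt.
Unshelve. all: by end_near. Qed.

Lemma cvg_sqrt0 (x : R^nat) : x n @[n --> \oo] --> (0 : R) ->
  Num.sqrt (x n) @[n --> \oo] --> (0 : R).
Proof.
move=> x0; rewrite -[X in _ --> X]sqrtr0.
by apply: continuous_cvg => //; exact: sqrt_continuous.
Qed.

(** A lower bound for ['C(n, d) / n ^ d] when [n > 2 * d], as each factor of the falling factorial
    is then at least [n / 2]. *)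
Definition binomial_ratio : R := (2 ^ d * d`!)%:R^-1.

Lemma binomial_ratio_gt0 : 0 < binomial_ratio.
Proof. by rewrite invr_gt0 ltr0n muln_gt0 expn_gt0 fact_gt0. Qed.

Lemma bin_ge_exp n : (2 * d < n)%N -> binomial_ratio * n%:R ^+ d <= 'C(n, d)%:R :> R.
Proof.
move=> n2; rewrite ler_pdivrMl ?ltr0n ?muln_gt0 ?expn_gt0 ?fact_gt0//.
rewrite -natrX -natrM ler_nat -mulnA [(d`! * _)%N]mulnC bin_ffact.
apply: leq_trans (leq_mul (leqnn _) (ffact_ge_exp n d)).
by rewrite -expnMn leq_exp2r//; move: n2; lia.
Qed.

Let V0 n : R := (1 + d%:R / 2) * 'C(n, d)%:R.

Lemma bin_le_V0 n : 'C(n, d)%:R <= V0 n.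
Proof. by rewrite /V0 ler_peMl ?ler0n// lerDl divr_ge0 ?ler0n. Qed.

Lemma V0_ge n : (2 * d < n)%N -> binomial_ratio * n%:R ^+ d <= V0 n.
Proof. by move=> n2; rewrite (le_trans (bin_ge_exp n2))// bin_le_V0. Qed.

Lemma V0_gt0 n : (1 < n)%N -> (2 * d < n)%N -> 0 < V0 n.
Proof.
move=> n1 n2; apply: lt_le_trans (V0_ge n2).
by rewrite mulr_gt0 ?binomial_ratio_gt0// exprn_gt0// n_gt0R.
Qed.

Lemma cvg_approx_variance :
  approx_variance R n d / V0 n @[n --> \oo] --> (1 : R).
Proof.
pose g1 n : R := gcov (layers d n) (mesh R d n) (decay R d n ^+ (n - d))
  (decay R d n ^+ (n - d)).
pose g2 n : R := gcov (layers d n) (mesh R d n) (decay R d n ^+ (n - d)) (decay R d n).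
have c0 : 1 + d%:R / 2 != 0 :> R by rewrite gt_eqF// ltr_pwDl// divr_ge0 ?ler0n.
have H : (g1 n + d%:R * ((n - d)%:R / n%:R * (n%:R * g2 n))) / (1 + d%:R / 2)
    @[n --> \oo] --> (1 : R).
  rewrite [X in _ --> X](_ : _ = (1 + d%:R * (1 * 2^-1)) / (1 + d%:R / 2)); last first.
    by rewrite mul1r divff.
  apply: cvgM; last exact: cvg_cst.
  apply: cvgD; first exact: cvg_gcov_variance.
  apply: cvgM; first exact: cvg_cst.
  by apply: cvgM; [exact: cvg_nBd|exact: cvg_gcov_covariance].
apply: cvg_trans H; apply: near_eq_cvg; near=> n.
have [n1 n2] : (1 < n)%N /\ (2 * d < n)%N by near: n; exact: large.
have n0 := n_gt0R R n1.
have C0 : 'C(n, d)%:R != 0 :> R.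
  by rewrite pnatr_eq0 -lt0n bin_gt0; move: n2; lia.
rewrite /approx_variance /V0 -/(g1 n) -/(g2 n) natrM /=.
move: (g1 n) (g2 n) ((n - d)%:R : R) n0 C0 c0 => a b c n0 C0 c0.
have {}n0 : n%:R != 0 :> R by rewrite gt_eqF.
move: n0 C0 c0; move: (n%:R : R) ('C(n, d)%:R : R) (d%:R : R) (1 + _ : R).
by move=> x y z u x0 y0 u0; field; rewrite x0 y0 u0.
Unshelve. all: by end_near. Qed.

Lemma cvg_approx_error : approx_error R n d @[n --> \oo] --> (0 : R).
Proof.
rewrite -(mulr0 (4 ^+ 8)); apply: cvgM; first exact: cvg_cst.
exact: cvg_cutoff_div.
Qed.

Lemma cvg_stein_error : stein_error R n d @[n --> \oo] --> (0 : R).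
Proof.
rewrite -(mulr0 (16 * d.+1%:R ^+ 4)); apply: cvgM; first exact: cvg_cst.
exact: cvg_cutoff_div.
Qed.

Context (disp : nat -> measure_display) (Omega : forall n, measurableType (disp n)).
Context (P : forall n, probability (Omega n) R).
Context (w : forall n, ksubset n d.+1 -> {RV (P n) >-> R}).
Hypothesis w_indep : forall n, mutually_independent (@w n).
Hypothesis w_exp : forall n tau, exponential_with_mean n%:R (@w n tau).
Let NN n : {RV (P n) >-> R} := total_nearest_face_weight (@w n).
Let V n := fine 'V_(P n)[NN n].

Lemma cvg_variance : V n / V0 n @[n --> \oo] --> (1 : R).
Proof.
pose b n : R := n%:R^-1 * (approx_variance R n d / V0 n) +
  2 * binomial_ratio^-1 * approx_error R n d.
have b0 : b n @[n --> \oo] --> (0 : R).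
  rewrite [X in _ --> X](_ : _ = 0 * 1 + 2 * binomial_ratio^-1 * 0); last by ring.
  apply: cvgD; first by apply: cvgM; [exact: cvg_invn|exact: cvg_approx_variance].
  by apply: cvgM; [exact: cvg_cst|exact: cvg_approx_error].
apply: (@squeeze_cvgr _ _ _ _ (fun n => approx_variance R n d / V0 n - b n)
  (fun n => approx_variance R n d / V0 n + b n)).
- near=> n; have [n1 n2] : (1 < n)%N /\ (2 * d < n)%N by near: n; exact: large.
  have V00 := V0_gt0 n1 n2; have n0 := n_gt0R R n1; have k0 := binomial_ratio_gt0.
  have := variance_approx d_gt0 n1 n2 (@w_indep n) (@w_exp n); rewrite -/(NN n) -/(V n).
  have e0 : 0 <= approx_error R n d.
    by rewrite mulr_ge0 ?exprn_ge0// divr_ge0 ?sqr_ge0 ?(ltW n0).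
  (* [1 + n <= 2 * n <= 2 * n ^+ d], where [d >= 1] enters, and [n ^+ d] is at most a constant times
     [V0 n]. *)
  have eb : (1 + n%:R) * approx_error R n d / V0 n <=
      2 * binomial_ratio^-1 * approx_error R n d.
    rewrite ler_pdivrMr// mulrAC ler_wpM2r//.
    apply: (@le_trans _ _ (2 * binomial_ratio^-1 * (binomial_ratio * n%:R ^+ d))); last first.
      by rewrite ler_wpM2l ?V0_ge// mulr_ge0// invr_ge0 ltW.
    rewrite mulrA mulfVK ?gt_eqF//.
    have nd : (n%:R : R) <= n%:R ^+ d.
      by rewrite -[leLHS]expr1 ler_weXn2l// ler1n ltnW.
    have : (1 : R) <= n%:R by rewrite ler1n ltnW.
    by move: nd; move: (n%:R ^+ d : R) (n%:R : R) => x y; lra.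
  rewrite ler_norml => /andP[lo up].
  have V0i : 0 <= (V0 n)^-1 by rewrite invr_ge0 ltW.
  have := ler_wpM2r V0i lo; have := ler_wpM2r V0i up.
  rewrite /b; move: eb; move: (V0 n)^-1 (V n) (approx_variance R n d)
    (approx_error R n d) (n%:R^-1 : R) (n%:R : R) binomial_ratio^-1.
  by move=> v x y z i m r *; apply/andP; split; lra.
- by rewrite -[X in _ --> X]subr0; apply: cvgB => //; exact: cvg_approx_variance.
- by rewrite -[X in _ --> X]addr0; apply: cvgD => //; exact: cvg_approx_variance.
Unshelve. all: by end_near. Qed.

Lemma variance_large : \forall n \near \oo, binomial_ratio / 2 * n%:R ^+ d <= V n.
Proof.
have h2 : 2^-1 < 1 :> R by rewrite invf_lt1// ltr1n.
have H := cvgr_gt _ cvg_variance _ h2.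
near=> n; have [n1 n2] : (1 < n)%N /\ (2 * d < n)%N by near: n; exact: large.
have : 2^-1 < V n / V0 n by near: n; exact: H.
rewrite ltr_pdivlMr ?V0_gt0// => /ltW; apply: le_trans.
by rewrite mulrAC mulrC ler_wpM2l ?invr_ge0// V0_ge.
Unshelve. all: by end_near. Qed.

Lemma cvg_logistic (k t : R) : 0 < k ->
  \int[P n]_x logistic k t ((standardize (NN n) : {RV (P n) >-> R}) x)
    @[n --> \oo] --> gauss_mean (logistic k t).
Proof.
(* [A], [B] and [D] majorize the error terms of [logistic_approx]; [c] bounds [n ^+ d / V n], by
   [variance_large]. *)
move=> k0; pose c : R := 2 * binomial_ratio^-1.
pose Z n : R := 1 + 2 * cutoff R d n.
pose A n : R := k * (1 + approx_error R n d) * Num.sqrt (c * n%:R^-1).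
pose B n : R := 2 * (`|1 - approx_variance R n d / V n| +
  c * Num.sqrt (stein_error R n d)).
pose D n : R := 2 * (C0 R + k) * (c * d.+1%:R ^+ 2 *
   (Num.sqrt c * Num.sqrt (Z n ^+ 10 / n%:R))).
have c0 : 0 < c by rewrite mulr_gt0// invr_gt0 binomial_ratio_gt0.
have cA : A n @[n --> \oo] --> (0 : R).
  rewrite [X in _ --> X](_ : _ = k * (1 + 0) * 0); last by ring.
  apply: cvgM.
    by apply: cvgM; [exact: cvg_cst|apply: cvgD; [exact: cvg_cst|exact: cvg_approx_error]].
  apply: cvg_sqrt0; rewrite -[X in _ --> X](mulr0 c).
  by apply: cvgM; [exact: cvg_cst|exact: cvg_invn].
have cVV : approx_variance R n d / V n @[n --> \oo] --> (1 : R).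
  have H : (approx_variance R n d / V0 n) * (V n / V0 n)^-1 @[n --> \oo] --> (1 : R).
    rewrite [X in _ --> X](_ : _ = 1 * 1^-1); last by rewrite invr1 mulr1.
    apply: cvgM; first exact: cvg_approx_variance.
    by apply: cvgV; [exact: oner_neq0|exact: cvg_variance].
  apply: cvg_trans H; apply: near_eq_cvg; near=> n.
  have [n1 n2] : (1 < n)%N /\ (2 * d < n)%N by near: n; exact: large.
  have V00 := V0_gt0 n1 n2.
  by rewrite invf_div mulrA divfK// gt_eqF.
have cB : B n @[n --> \oo] --> (0 : R).
  rewrite [X in _ --> X](_ : _ = 2 * (`|1 - 1| + c * 0)); last first.
    by rewrite subrr normr0 !mulr0 addr0 mulr0.
  apply: cvgM; first exact: cvg_cst.
  apply: cvgD; first by apply: cvg_norm; apply: cvgB => //; exact: cvg_cst.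
  by apply: cvgM; [exact: cvg_cst|apply: cvg_sqrt0; exact: cvg_stein_error].
have cD : D n @[n --> \oo] --> (0 : R).
  rewrite [X in _ --> X](_ : _ = 2 * (C0 R + k) * (c * d.+1%:R ^+ 2 *
     (Num.sqrt c * 0))); last by rewrite !mulr0.
  apply: cvgM; first exact: cvg_cst.
  apply: cvgM; first exact: cvg_cst.
  apply: cvgM; first exact: cvg_cst.
  by apply: cvg_sqrt0; exact: cvg_cutoff_div.
have cb : A n + (B n + D n) @[n --> \oo] --> (0 : R).
  rewrite [X in _ --> X](_ : _ = 0 + (0 + 0)); last by rewrite !addr0.
  by apply: cvgD => //; exact: cvgD.
apply/cvgrPdist_le => e e0.
have cbe := cvgr_lt _ cb _ e0.
near=> n; have [n1 n2] : (1 < n)%N /\ (2 * d < n)%N by near: n; exact: large.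
have n0 := n_gt0R R n1.
have Vge : binomial_ratio / 2 * n%:R ^+ d <= V n by near: n; exact: variance_large.
have nd0 : (0 : R) < n%:R ^+ d by rewrite exprn_gt0.
have V_gt0 : 0 < V n.
  by apply: lt_le_trans Vge; rewrite !mulr_gt0 ?invr_gt0 ?binomial_ratio_gt0.
have nV : n%:R ^+ d / V n <= c.
  rewrite ler_pdivrMr//; apply: (le_trans _ (ler_wpM2l (ltW c0) Vge)).
  rewrite /c mulrA (_ : 2 / binomial_ratio * (binomial_ratio / 2) = 1) ?mul1r//.
  by field; rewrite gt_eqF// binomial_ratio_gt0.
have sV : (Num.sqrt (V n))^-1 <= Num.sqrt (c * n%:R^-1).
  rewrite -sqrtrV ?(ltW V_gt0)// ler_wsqrtr//.
  rewrite -[leLHS]mul1r ler_pdivrMr//.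
  rewrite mulrAC ler_pdivlMr// mul1r.
  have nd : (n%:R : R) <= n%:R ^+ d.
    by rewrite -[leLHS]expr1 ler_weXn2l// ler1n ltnW.
  by rewrite (le_trans nd)// -ler_pdivrMr.
have se0 : 0 <= Num.sqrt (stein_error R n d) by exact: sqrtr_ge0.
have ae0 : 0 <= approx_error R n d.
  by rewrite mulr_ge0 ?exprn_ge0// divr_ge0 ?sqr_ge0 ?(ltW n0).
have Z1 : 0 <= Z n by rewrite addr_ge0// mulr_ge0// ltW// cutoff_gt0.
have CK : 0 <= 2 * (C0 R + k).
  by rewrite mulr_ge0// addr_ge0 ?(ltW k0)// (le_trans ler01 (C0_ge1 R)).
have := logistic_approx d_gt0 n1 n2 (@w_indep n) (@w_exp n) t k0 V_gt0.
rewrite distrC => /le_trans; apply.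
apply: (@le_trans _ _ (A n + (B n + D n))); last first.
  by apply: ltW; near: n; exact: cbe.
rewrite -/(NN n) -/(V n) lerD//.
  by rewrite /A ler_wpM2l// mulr_ge0 ?(ltW k0)// addr_ge0.
rewrite lerD//.
  by rewrite /B ler_wpM2l// lerD2l mulrAC ler_wpM2r.
rewrite /D -mulrA ler_wpM2l//.
have -> : n%:R ^+ d * (d.+1%:R ^+ 2 * (1 + 2 * cutoff R d n) ^+ 5) /
    (V n * Num.sqrt (V n)) =
    n%:R ^+ d / V n * d.+1%:R ^+ 2 * (Z n ^+ 5 * (Num.sqrt (V n))^-1).
  by rewrite invfM /Z; ring.
(* The power of the logarithm and the root of [n] are put under one root, so that [cvg_cutoff_div]
   with exponent 10 makes [D] vanish. *)
have sZ : Num.sqrt (Z n ^+ 10 / n%:R) = Z n ^+ 5 * Num.sqrt n%:R^-1.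
  rewrite sqrtrM ?exprn_ge0//; congr (_ * _).
  by rewrite (exprM _ 5 2) sqrtr_sqr ger0_norm// exprn_ge0.
rewrite sZ [Num.sqrt c * _]mulrCA -sqrtrM ?(ltW c0)//.
apply: ler_pM; rewrite ?ler_wpM2r ?ler_wpM2l ?sqr_ge0 ?exprn_ge0//.
- by rewrite mulr_ge0 ?sqr_ge0// divr_ge0 ?(ltW nd0) ?(ltW V_gt0).
- by rewrite mulr_ge0 ?exprn_ge0// invr_ge0 sqrtr_ge0.
Unshelve. all: by end_near. Qed.

End asymptotics.

Theorem theorem1p1 (R : realType) (d : nat) (d_gt0 : (0 < d)%N)
    (disp : nat -> measure_display)
    (Omega : forall n, measurableType (disp n))
    (P : forall n, probability (Omega n) R)
    (w : forall n, ksubset n d.+1 -> {RV (P n) >-> R})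
    (w_indep : forall n, mutually_independent (w n))
    (w_exp : forall n (tau : ksubset n d.+1),
      exponential_with_mean n%:R (w n tau)) :
  let NN n : {RV (P n) >-> R} := total_nearest_face_weight (w n) in
  asymptotically_equivalent
    (fun n => fine 'V_(P n)[NN n])
    (fun n => (1 + d%:R / 2) * 'C(n, d)%:R)
  /\
  cvg_in_distribution (fun n => standardize (NN n) : {RV (P n) >-> R})
    (normal_prob 0 1).
Proof.
move=> NN; split; first exact: cvg_variance d_gt0 _ _ _ _ w_indep w_exp.
apply: cvg_logistic_cvg_in_distribution => k t k0.
exact: (cvg_logistic d_gt0 w_indep w_exp k0).
Qed.
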